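(* Let $K$ be a polyhedron satisfying the mesh assumptions, with tetrahedral subdivision $\mathcal T_K$, let $k\ge1$, let $V_k^{\mathrm c}(K)$ be the 3D enhanced conforming virtual element space, and let $\widetilde I_k^K:V_k^{\mathrm c}(K)\to\widetilde V_k(\mathcal T_K)$ be the interpolation operator, all as defined in the context. Then for any $v_h\in V_k^{\mathrm c}(K)$, $$(\nabla\widetilde I_k^Kv_h,\nabla q)_K=(\nabla v_h,\nabla q)_K,\qquad(\widetilde I_k^Kv_h,q)_K=(v_h,q)_K,\qquad\forall q\in\mathbb P_k(K).$$
   Context: Notation: $(\cdot,\cdot)_S$ is the $L^2(S)$ inner product. $\mathbb P_m(S)$ is the space of polynomials of degree $\le m$ on $S$ (in intrinsic coordinates of the line/plane containing $S$ if $S$ is an edge/face; $\{0\}$ if $m<0$); $\overline{\mathbb P}_m(S)$ is the subspace of homogeneous polynomials of degree $m$ in $\bm x-\bm x_S$ ($\{0\}$ if $m<0$), $\bm x_S$ the barycenter of $S$. $\mathbb M_m(S)=\{((\bm x-\bm x_S)/h_S)^{\bm\beta}:|\bm\beta|\le m\}$ is the scaled monomial basis of $\mathbb P_m(S)$ ($h_S$ the diameter; empty if $m<0$). Mesh assumptions: $K\subset\mathbb R^3$ is a polyhedron of diameter $h_K$, star-shaped with respect to a ball of radius $\ge\rho h_K$; every edge has length $\ge\rho h_K$; every face is star-shaped in the same sense with parameter $\rho>0$. $\mathcal T_K$ is a conforming shape-regular tetrahedral subdivision of $K$ whose tetrahedra have diameters comparable to $h_K$, such that the edges of $K$ are not subdivided;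 it induces a triangulation of each face of $K$. $\mathcal V(K),\mathcal E(K),\mathcal F(K)$ are the vertices, edges, faces of $K$; $\mathcal V^\partial(\mathcal T_K),\mathcal E^\partial(\mathcal T_K),\mathcal F^\partial(\mathcal T_K)$ (resp. $\mathcal V^{\mathrm{int}}(\mathcal T_K),\mathcal E^{\mathrm{int}}(\mathcal T_K),\mathcal F^{\mathrm{int}}(\mathcal T_K)$) are the vertices, edges, triangular faces of $\mathcal T_K$ located on $\partial K$ (resp. in the interior of $K$). Projections: for $S=K$ or $S=F\in\mathcal F(K)$, $Q_k^S$ is the $L^2(S)$ projection onto $\mathbb P_k(S)$, and for $v\in H^1(S)$, $\Pi_k^Sv\in\mathbb P_k(S)$ is defined by $(\nabla\Pi_k^Sv,\nabla q)_S=(\nabla v,\nabla q)_S$ for all $q\in\mathbb P_k(S)$ and $\int_{\partial S}\Pi_k^Sv\,\mathrm ds=\int_{\partial S}v\,\mathrm ds$. Set $\Pi_{k,h}^{\partial K}|_F=\Pi_k^F$, $Q_{k,h}^{\partial K}|_F=Q_k^F$ for $F\in\mathcal F(K)$. Virtual element spaces: for a face $F$ (a polygon), with $\mathbb B_k(\partial F)=\{v\in C^0(\partial F):v|_e\in\mathbb P_k(e)$ for each edge $e$ of $F\}$, $V_k^{\mathrm c}(F)=\{v\in H^1(F):\Delta v\in\mathbb P_k(F),\ v|_{\partial F}\in\mathbb B_k(\partial F),\ (v,q)_F=(\Pi_k^Fv,q)_F\ \forall q\in\overline{\mathbb P}_k(F)\oplus\overline{\mathbb P}_{k-1}(F)\}$.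 With $\mathbb B_k(\partial K)=\{v\in H^1(\partial K):v|_F\in V_k^{\mathrm c}(F)\ \forall F\in\mathcal F(K)\}$, $$V_k^{\mathrm c}(K)=\{v\in H^1(K):\Delta v\in\mathbb P_k(K),\ v|_{\partial K}\in\mathbb B_k(\partial K),\ (v,q)_K=(\Pi_k^Kv,q)_K\ \forall q\in\overline{\mathbb P}_k(K)\oplus\overline{\mathbb P}_{k-1}(K)\}.$$ Macro finite element space: for a tetrahedron $T$ let $b_T$ be the product of its four barycentric coordinates and, for a face $F$ of $T$, $b_F$ the product of the three barycentric coordinates of the vertices of $F$; polynomials on $F$ are extended to $T$ via their Bernstein form in the barycentric coordinates. Then $$\widetilde V_k(T)=\mathbb P_k(T)\oplus\sum_{i=0}^3b_T\overline{\mathbb P}_{k-i}(T)\oplus\sum_{F\in\mathcal F(T)}\big(b_F\overline{\mathbb P}_{k-2}(F)\oplus b_F\overline{\mathbb P}_{k-1}(F)\oplus b_F\overline{\mathbb P}_k(F)\big),$$ with unisolvent degrees of freedom: vertex values; $\frac1{|e|}(v,q)_e$, $q\in\mathbb M_{k-2}(e)$, on edges; $\frac1{|F|}(v,q)_F$, $q\in\mathbb M_k(F)$, on faces; $\frac1{|T|}(v,q)_T$, $q\in\mathbb M_k(T)$. $\widetilde V_k(\mathcal T_K)=\{v\in C^0(K):v|_T\in\widetilde V_k(T)\ \forall T\in\mathcal T_K\}$. Interpolation: for $v_h\in V_k^{\mathrm c}(K)$, $w:=\widetilde I_k^Kv_h\in\widetilde V_k(\mathcal T_K)$ is determined by - $w(\delta)=v_h(\delta)$,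 $\delta\in\mathcal V(K)$; $w(\delta)=\Pi_{k,h}^{\partial K}v_h(\delta)$, $\delta\in\mathcal V^\partial(\mathcal T_K)\setminus\mathcal V(K)$; $w(\delta)=\Pi_k^Kv_h(\delta)$, $\delta\in\mathcal V^{\mathrm{int}}(\mathcal T_K)$; - for all $q\in\mathbb M_{k-2}(e)$: $(w-v_h,q)_e=0$, $e\in\mathcal E(K)$; $(w-\Pi_{k,h}^{\partial K}v_h,q)_e=0$, $e\in\mathcal E^\partial(\mathcal T_K)\setminus\mathcal E(K)$; $(w-\Pi_k^Kv_h,q)_e=0$, $e\in\mathcal E^{\mathrm{int}}(\mathcal T_K)$; - for all $q\in\mathbb M_k(F)$: $(w-Q_{k,h}^{\partial K}v_h,q)_F=0$, $F\in\mathcal F^\partial(\mathcal T_K)$; $(w-\Pi_k^Kv_h,q)_F=0$, $F\in\mathcal F^{\mathrm{int}}(\mathcal T_K)$; - $(w-Q_k^Kv_h,q)_T=0$, $q\in\mathbb M_k(T)$, $T\in\mathcal T_K$. *)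

(* Defs.v *)
From HB Require Import structures.
From mathcomp Require Import all_boot all_order all_algebra.
From mathcomp Require Import all_classical all_reals all_analysis.

Set Implicit Arguments.
Unset Strict Implicit.
Unset Printing Implicit Defensive.

Import Order.TTheory GRing.Theory Num.Theory.
Import numFieldNormedType.Exports.

Local Open Scope classical_set_scope.
Local Open Scope ring_scope.

Definition measure_rV_display : measure_display.
Proof. exact: default_measure_display. Qed.

Section measurable_rV.
Context {R : realType} (n : nat).

Definition rV_coord (i : 'I_n) (x : 'rV[R]_n) : measurableTypeR R := x 0 i.

Let rV_set0 : g_sigma_preimage rV_coord set0.
Proof. exact: sigma_algebra0. Qed.

Let rV_setC A : g_sigma_preimage rV_coord A ->
  g_sigma_preimage rV_coord (~` A).
Proof. exact: sigma_algebraC. Qed.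

Let rV_bigcup (F : (set _)^nat) : (forall i, g_sigma_preimage rV_coord (F i)) ->
  g_sigma_preimage rV_coord (\bigcup_i (F i)).
Proof. exact: sigma_algebra_bigcup. Qed.

HB.instance Definition _ := @isMeasurable.Build measure_rV_display
  'rV[R]_n (g_sigma_preimage rV_coord) rV_set0 rV_setC rV_bigcup.

End measurable_rV.

Section leb.
Context {R : realType}.

Lemma measurable_rV_coord n (i : 'I_n) :
  measurable_fun [set: 'rV[R]_n] (@rV_coord R n i).
Proof.
move=> _ Y mY; rewrite setTI; apply: sub_sigma_algebra => /=.
rewrite -bigcup_seq/=; exists i => /=; first by rewrite mem_index_enum.
by exists Y => //; rewrite setTI.
Qed.

Lemma measurable_rVP d (T : measurableType d) n (f : T -> 'rV[R]_n) :
  (forall i, measurable_fun [set: T] (@rV_coord R n i \o f)) ->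
  measurable_fun [set: T] f.
Proof.
move=> mf _ Y mY; rewrite setTI.
have : preimage_set_system setT f (g_sigma_preimage (@rV_coord R n)) (f @^-1` Y).
  by exists Y => //; rewrite setTI.
rewrite -g_sigma_preimage_comp.
apply: smallest_sub; first exact: sigma_algebra_measurable.
case: n f mf {Y mY} => [|n] f mf; first by rewrite big_ord0.
rewrite -bigcup_mkord_ord; apply: bigcup_sub => i Ii.
by move=> A [B mB <-]; exact: mf.
Qed.

Definition rV_cons n (p : measurableTypeR R * 'rV[R]_n) : 'rV[R]_n.+1 :=
  row_mx (p.1 : R)%:M p.2 : 'rV[R]_(1 + n).

Definition rV_uncons n (x : 'rV[R]_n.+1) : measurableTypeR R * 'rV[R]_n :=
  ((x : 'rV[R]_(1 + n)) 0 (lshift n 0), rsubmx (x : 'rV[R]_(1 + n))).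

Lemma rV_consK n : cancel (@rV_cons n) (@rV_uncons n).
Proof.
move=> [r x]; rewrite /rV_uncons /rV_cons /=; congr pair; last exact: row_mxKr.
by rewrite (@row_mxEl _ 1 1 n) mxE eqxx mulr1n.
Qed.

Lemma measurable_rV_cons n : measurable_fun setT (@rV_cons n).
Proof.
apply: measurable_rVP => i; case: (@split_ordP 1 n i) => j ->.
  rewrite (_ : _ \o _ = fst) ?measurable_fst//; apply/funext => p /=.
  by rewrite /rV_coord (@row_mxEl _ 1 1 n) ord1 mxE eqxx mulr1n.
rewrite (_ : _ \o _ = @rV_coord R n j \o snd); last first.
  by apply/funext => p /=; rewrite /rV_coord (@row_mxEr _ 1 1 n).
by apply: measurableT_comp => //; exact: measurable_rV_coord.
Qed.

Lemma measurable_rV_uncons n : measurable_fun setT (@rV_uncons n).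
Proof.
apply/measurable_fun_pairP; split.
  exact: (@measurable_rV_coord n.+1 (lshift n 0 : 'I_(1 + n))).
apply: measurable_rVP => i.
rewrite (_ : _ \o _ = @rV_coord R n.+1 (rshift 1 i : 'I_(1 + n))).
  exact: measurable_rV_coord.
by apply/funext => x; rewrite /rV_coord /= mxE.
Qed.

Section step.
Local Open Scope ereal_scope.
Context n (m : {sigma_finite_measure set 'rV[R]_n -> \bar R}).

Definition leb_step : set 'rV[R]_n.+1 -> \bar R :=
  pushforward (@lebesgue_measure R \x m) (@rV_cons n).

Let leb_step0 : leb_step set0 = 0.
Proof. by rewrite /leb_step /pushforward preimage_set0 measure0. Qed.

Let leb_step_ge0 A : 0 <= leb_step A.
Proof. by rewrite /leb_step /pushforward; apply: measure_ge0. Qed.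

Let leb_step_sigma_additive : semi_sigma_additive leb_step.
Proof.
move=> F mF tF mUF; rewrite /leb_step /pushforward preimage_bigcup.
apply: measure_semi_sigma_additive.
- by move=> k; rewrite -[X in measurable X]setTI; exact: measurable_rV_cons.
- apply/trivIsetP => /= i j _ _ ij; rewrite -preimage_setI.
  by move/trivIsetP : tF => /(_ _ _ _ _ ij) ->//; rewrite preimage_set0.
- rewrite -preimage_bigcup -[X in measurable X]setTI.
  exact: measurable_rV_cons.
Qed.

HB.instance Definition _ := isMeasure.Build _ _ _
  leb_step leb_step0 leb_step_ge0 leb_step_sigma_additive.

Let leb_step_sigma_finite : sigma_finite setT leb_step.
Proof.
have /sigma_finiteP[F [TF ndF Foo]] := sigma_finiteT (@lebesgue_measure R).
have /sigma_finiteP[G [TG ndG Goo]] := sigma_finiteT m.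
exists (fun k => @rV_uncons n @^-1` (F k `*` G k)).
  rewrite -preimage_bigcup -[LHS](preimage_setT (@rV_uncons n)); congr preimage.
  apply/esym; rewrite -subTset => -[x y] _.
  have [i _ Fix] : (\bigcup_k F k) x by rewrite -TF.
  have [j _ Gjy] : (\bigcup_k G k) y by rewrite -TG.
  exists (maxn i j) => //; split.
    by move: x Fix; exact/subsetPset/ndF/leq_maxl.
  by move: y Gjy; exact/subsetPset/ndG/leq_maxr.
move=> k; have [mF Fk] := Foo k; have [mG Gk] := Goo k; split.
  rewrite -[X in measurable X]setTI; apply: measurable_rV_uncons => //.
  exact: measurableX.
rewrite /leb_step /pushforward -comp_preimage.
rewrite (_ : _ \o _ = id); last by apply/funext => p /=; rewrite rV_consK.
by rewrite preimage_id product_measure1E// lte_mul_pinfty// ge0_fin_numE.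
Qed.

HB.instance Definition _ := Measure_isSigmaFinite.Build _ _ _ leb_step
  leb_step_sigma_finite.

End step.

Fixpoint leb (n : nat) : {sigma_finite_measure set 'rV[R]_n -> \bar R} :=
  if n is n'.+1 then leb_step (leb n') else \d_(0 : 'rV[R]_0).

End leb.

Section geometry.
Context {R : realType}.

Definition enorm n (x : 'rV[R]_n) : R := Num.sqrt (\sum_i x 0 i ^+ 2).

Definition diam n (S : set 'rV[R]_n) : R :=
  sup [set r | exists x y, [/\ S x, S y & r = enorm (x - y)]].

Definition frontier n (S : set 'rV[R]_n) : set 'rV[R]_n :=
  closure S `\` interior S.

Definition seg n (p q : 'rV[R]_n) : set 'rV[R]_n :=
  [set x | exists2 t : R, 0 <= t <= 1 & x = p + t *: (q - p)].

(* Star-shaped with respect to an open Euclidean ball of radius r; the matrix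
   norm of the library is the maximum norm, hence enorm. *)
Definition star_shaped_ball n (S : set 'rV[R]_n) (r : R) : Prop :=
  exists c : 'rV[R]_n, forall y, enorm (y - c) < r ->
    S y /\ forall x, S x -> seg y x `<=` S.

(* A piece of an m-dimensional affine subspace of R^n, given in the intrinsic
   coordinates t |-> org + t *m frame; frame is required to have orthonormal
   rows wherever patches are used. *)
Record patch (m n : nat) := Patch {
  org : 'rV[R]_n;
  frame : 'M[R]_(m, n);
  dom : set 'rV[R]_m }.

Definition emb m n (c : patch m n) (t : 'rV[R]_m) : 'rV[R]_n :=
  org c + t *m frame c.

Definition coord m n (c : patch m n) (x : 'rV[R]_n) : 'rV[R]_m :=
  (x - org c) *m (frame c)^T.

Definition isometric m n (c : patch m n) : Prop := frame c *m (frame c)^T = 1%:M.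

Definition patch_set m n (c : patch m n) : set 'rV[R]_n := emb c @` dom c.

(* The segment from p to q, parametrized by arc length. *)
Definition edge_patch n (p q : 'rV[R]_n) : patch 1 n :=
  Patch p ((enorm (q - p))^-1 *: (q - p))
    [set t | 0 <= t 0 0 <= enorm (q - p)].

Record polygon := Polygon {
  pg_size : nat;
  pg_vtx : 'I_pg_size -> 'rV[R]_2;
  pg_reg : set 'rV[R]_2 }.

Definition pg_edge (P : polygon) (i : 'I_(pg_size P)) : patch 1 2 :=
  edge_patch (pg_vtx i) (pg_vtx (ordS i)).

Definition pg_bdry (P : polygon) : set 'rV[R]_2 :=
  \bigcup_i seg (@pg_vtx P i) (pg_vtx (ordS i)).

(* The boundary is a simple closed polygonal curve; consecutive edges may be
   collinear. *)
Definition is_polygon (P : polygon) : Prop :=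
  [/\ (2 < pg_size P)%N, injective (@pg_vtx P),
      forall i j x, i != j ->
        seg (@pg_vtx P i) (pg_vtx (ordS i)) x ->
        seg (@pg_vtx P j) (pg_vtx (ordS j)) x ->
        (x = pg_vtx i \/ x = pg_vtx (ordS i)) /\
        (x = pg_vtx j \/ x = pg_vtx (ordS j)),
      compact (pg_reg P) /\ closure (interior (pg_reg P)) = pg_reg P
    & frontier (pg_reg P) = pg_bdry P].

Record face := Face {
  fc_poly : polygon;
  fc_org : 'rV[R]_3;
  fc_frame : 'M[R]_(2, 3) }.

Definition fc_patch (F : face) : patch 2 3 :=
  Patch (fc_org F) (fc_frame F) (pg_reg (fc_poly F)).

Definition fc_set (F : face) : set 'rV[R]_3 := patch_set (fc_patch F).

Definition fc_size (F : face) : nat := pg_size (fc_poly F).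

Definition fc_vtx (F : face) (i : 'I_(fc_size F)) : 'rV[R]_3 :=
  emb (fc_patch F) (pg_vtx i).

Definition fc_edge (F : face) (i : 'I_(fc_size F)) : set 'rV[R]_3 :=
  seg (fc_vtx i) (fc_vtx (ordS i)).

Record polyhedron := Polyhedron {
  ph_body : set 'rV[R]_3;
  ph_size : nat;
  ph_face : 'I_ph_size -> face }.

Definition is_vertex (K : polyhedron) (x : 'rV[R]_3) : Prop :=
  exists (f : 'I_(ph_size K)) (i : 'I_(fc_size (ph_face f))), x = fc_vtx i.

Definition is_edge (K : polyhedron) (e : set 'rV[R]_3) : Prop :=
  exists (f : 'I_(ph_size K)) (i : 'I_(fc_size (ph_face f))), e = fc_edge i.

(* Faces meet only along common edges or at common vertices; adjacent faces may
   be coplanar. *)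
Definition is_polyhedron (K : polyhedron) : Prop :=
  [/\ compact (ph_body K),
      closure (interior (ph_body K)) = ph_body K,
      forall f : 'I_(ph_size K),
        isometric (fc_patch (ph_face f)) /\ is_polygon (fc_poly (ph_face f)),
      frontier (ph_body K) = \bigcup_(f in setT) fc_set (@ph_face K f)
    & forall (f g : 'I_(ph_size K)) x, f != g ->
        fc_set (ph_face f) x -> fc_set (ph_face g) x ->
        (exists (i : 'I_(fc_size (ph_face f))) (j : 'I_(fc_size (ph_face g))),
          x = fc_vtx i /\ x = fc_vtx j) \/
        (exists (i : 'I_(fc_size (ph_face f))) (j : 'I_(fc_size (ph_face g))),
          fc_edge i x /\ fc_edge i = fc_edge j)].

Definition mesh_assumptions (rho : R) (K : polyhedron) : Prop :=
  [/\ exists2 r, 0 < r /\ rho * diam (ph_body K) <= r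
        & star_shaped_ball (ph_body K) r,
      forall (f : 'I_(ph_size K)) (i : 'I_(fc_size (ph_face f))),
        rho * diam (ph_body K) <= enorm (fc_vtx (ordS i) - fc_vtx i)
    & forall f : 'I_(ph_size K), let P := pg_reg (fc_poly (ph_face f)) in
        exists2 r, 0 < r /\ rho * diam P <= r & star_shaped_ball P r].

(* Simplices are given by the matrix X whose rows are the vertices; hull X s is
   the closed subsimplex spanned by the rows in s. *)
Definition hull m n (X : 'M[R]_(m, n)) (s : {set 'I_m}) : set 'rV[R]_n :=
  [set x | exists l : 'rV[R]_m,
     [/\ forall i, 0 <= l 0 i, forall i, i \notin s -> l 0 i = 0,
         \sum_i l 0 i = 1 & x = l *m X]].

Definition facet (X : 'M[R]_(4, 3)) (i : 'I_4) : set 'rV[R]_3 :=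
  hull X (~: [set i])%SET.

Definition tet_set (X : 'M[R]_(4, 3)) : set 'rV[R]_3 := hull X [set: 'I_4]%SET.

Definition homog_mx (X : 'M[R]_(4, 3)) : 'M[R]_4 :=
  row_mx (const_mx 1 : 'cV[R]_4) X : 'M[R]_(4, 1 + 3).

Definition nondegenerate (X : 'M[R]_(4, 3)) : Prop := homog_mx X \in unitmx.

(* The barycentric coordinates l of x solve \sum_i l_i = 1, l *m X = x. *)
Definition bary (X : 'M[R]_(4, 3)) (x : 'rV[R]_3) : 'rV[R]_4 :=
  (row_mx (1%:M : 'M[R]_1) x : 'rV[R]_(1 + 3)) *m invmx (homog_mx X).

Record tet_mesh := TetMesh {
  tm_size : nat;
  tm_tet : 'I_tm_size -> 'M[R]_(4, 3) }.

Definition common_vertices (X Y : 'M[R]_(4, 3)) : {set 'I_4} :=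
  [set i | [exists j, row i X == row j Y]]%SET.

(* gamma is the shape-regularity constant; the other half of comparability,
   diam T <= diam K, is automatic. *)
Definition is_subdivision (gamma : R) (K : polyhedron) (T : tet_mesh) : Prop :=
  let tet := @tm_tet T in
  [/\ ph_body K = \bigcup_j tet_set (tet j),
      (forall j, nondegenerate (tet j)) /\
      (forall i j, i != j -> tet_set (tet i) <> tet_set (tet j) /\
        tet_set (tet i) `&` tet_set (tet j) =
        hull (tet i) (common_vertices (tet i) (tet j))),
      forall j, gamma * diam (ph_body K) <= diam (tet_set (tet j)) /\
        (exists2 r, gamma * diam (tet_set (tet j)) <= r & exists c,
          forall y, enorm (y - c) < r -> tet_set (tet j) y),
      forall e, is_edge K e -> exists j i1 i2,
        i1 != i2 /\ e = seg (row i1 (tet j)) (row i2 (tet j))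
    & (forall (f : 'I_(ph_size K)) x, fc_set (ph_face f) x -> exists j i,
        facet (tet j) i x /\ facet (tet j) i `<=` fc_set (ph_face f)) /\
      (forall j i, facet (tet j) i `<=` frontier (ph_body K) ->
        exists f : 'I_(ph_size K), facet (tet j) i `<=` fc_set (ph_face f))].

End geometry.

Arguments patch : clear implicits.
Arguments polygon : clear implicits.
Arguments face : clear implicits.
Arguments polyhedron : clear implicits.
Arguments tet_mesh : clear implicits.

Section spaces.
Context {R : realType}.
Local Notation fn n := ('rV[R]_n -> R).

Definition ip n (S : set 'rV[R]_n) (f g : fn n) : R :=
  \int[leb n]_(x in S) (f x * g x).

Definition ipv n (S : set 'rV[R]_n) (f g : 'rV[R]_n -> 'rV[R]_n) : R :=
  \sum_i ip S (fun x => f x 0 i) (fun x => g x 0 i).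

Definition L2 n (S : set 'rV[R]_n) (f : fn n) : Prop :=
  measurable_fun S f /\ (leb n).-integrable S (fun x => (f x ^+ 2)%:E).

Definition grad n (f : fn n) (x : 'rV[R]_n) : 'rV[R]_n :=
  \row_i 'D_(delta_mx 0 i) f x.

Definition C1 n (f : fn n) : Prop :=
  (forall x, differentiable f x) /\
  forall i : 'I_n, continuous (fun x => grad f x 0 i).

(* C1 test functions suffice, only first derivatives being moved onto them. *)
Definition test_fun n (S : set 'rV[R]_n) (f : fn n) : Prop :=
  let supp := closure [set x | f x != 0] in
  [/\ C1 f, compact supp & supp `<=` interior S].

Definition is_wgrad n (S : set 'rV[R]_n) (v : fn n)
    (G : 'rV[R]_n -> 'rV[R]_n) : Prop :=
  forall i : 'I_n, L2 S (fun x => G x 0 i) /\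
    forall phi, test_fun S phi ->
      ip S v (fun x => grad phi x 0 i) = - ip S (fun x => G x 0 i) phi.

Definition H1 n (S : set 'rV[R]_n) (v : fn n) : Prop :=
  L2 S v /\ exists G, is_wgrad S v G.

(* Well defined up to null sets for v in H1 S. *)
Definition wgrad n (S : set 'rV[R]_n) (v : fn n) : 'rV[R]_n -> 'rV[R]_n :=
  xget (fun=> 0) [set G | is_wgrad S v G].

(* p is the distributional Laplacian of v in H1 S. *)
Definition is_laplacian n (S : set 'rV[R]_n) (v p : fn n) : Prop :=
  forall phi, test_fun S phi -> ipv S (wgrad S v) (grad phi) = - ip S p phi.

Definition bint N m n (c : 'I_N -> patch R m n) (f : fn n) : R :=
  \sum_i \int[leb m]_(t in dom (c i)) f (emb (c i) t).

(* g is the trace of v on the part of the boundary of S made of the patches c: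
   the restriction map on C1 functions is closed in H1 x L2. *)
Definition is_trace N m n (S : set 'rV[R]_n) (c : 'I_N -> patch R m n)
    (v g : fn n) : Prop :=
  (forall i, L2 (dom (c i)) (g \o emb (c i))) /\
  exists phi : nat -> fn n,
    [/\ forall j, C1 (phi j),
        (fun j => ip S (phi j \- v) (phi j \- v)) @ \oo --> (0 : R),
        (fun j => ipv S (grad (phi j) \- wgrad S v)
                        (grad (phi j) \- wgrad S v)) @ \oo --> (0 : R)
      & (fun j => bint c (fun x => (phi j x - g x) ^+ 2)) @ \oo --> (0 : R)].

Definition mono n (b : 'I_n -> nat) (x : 'rV[R]_n) : R :=
  \prod_i x 0 i ^+ b i.

Definition Pol n (m : int) : set (fn n) :=
  if m is Posz m then
    [set p | exists c : {ffun 'I_n -> 'I_m.+1} -> R,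
       p = fun x => \sum_(b : {ffun 'I_n -> 'I_m.+1} | (\sum_i b i <= m)%N)
                      c b * mono (fun i => b i) x]
  else [set fun=> 0].

(* Homogeneous of degree m in x - a. *)
Definition HPol n (m : int) (a : 'rV[R]_n) : set (fn n) :=
  if m is Posz m then
    [set p | exists c : {ffun 'I_n -> 'I_m.+1} -> R,
       p = fun x => \sum_(b : {ffun 'I_n -> 'I_m.+1} | (\sum_i b i)%N == m)
                      c b * mono (fun i => b i) (x - a)]
  else [set fun=> 0].

Definition barycenter n (S : set 'rV[R]_n) : 'rV[R]_n :=
  \row_i ((\int[leb n]_(x in S) x 0 i) / \int[leb n]_(x in S) (1 : R)).

Definition SMono n (m : int) (S : set 'rV[R]_n) : set (fn n) :=
  if m is Posz m then
    [set q | exists2 b : 'I_n -> nat, (\sum_i b i <= m)%N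
       & q = fun x => mono b ((diam S)^-1 *: (x - barycenter S))]
  else set0.

Definition Qproj n (k : nat) (S : set 'rV[R]_n) (v : fn n) : fn n :=
  xget (fun=> 0) [set p | Pol k p /\ forall q, Pol k q -> ip S p q = ip S v q].

(* c lists the pieces of the boundary of S, and g is the trace of v on it. *)
Definition Piproj N m n (k : nat) (S : set 'rV[R]_n) (c : 'I_N -> patch R m n)
    (v g : fn n) : fn n :=
  xget (fun=> 0) [set p | [/\ Pol k p,
    forall q, Pol k q -> ipv S (grad p) (grad q) = ipv S (wgrad S v) (grad q)
    & bint c p = bint c g]].

Definition enhanced N m n (k : nat) (S : set 'rV[R]_n)
    (c : 'I_N -> patch R m n) (v g : fn n) : Prop :=
  forall q1 q2, HPol k (barycenter S) q1 -> HPol (k%:Z - 1) (barycenter S) q2 ->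
    ip S v (q1 \+ q2) = ip S (Piproj k S c v g) (q1 \+ q2).

Definition Bk2 (k : nat) (P : polygon R) (b : fn 2) : Prop :=
  {within pg_bdry P, continuous b} /\
  forall i, exists2 p : fn 1, Pol k p &
    forall t, dom (@pg_edge R P i) t -> b (emb (pg_edge i) t) = p t.

(* v belongs to V_k^c(F) and b is its continuous trace on the boundary of F. *)
Definition Vc2 (k : nat) (P : polygon R) (v b : fn 2) : Prop :=
  [/\ H1 (pg_reg P) v,
      exists2 p, Pol k p & is_laplacian (pg_reg P) v p,
      is_trace (pg_reg P) (@pg_edge R P) v b, Bk2 k P b
    & enhanced k (pg_reg P) (@pg_edge R P) v b].

Definition bd_patch (K : polyhedron R) (f : 'I_(ph_size K)) : patch R 2 3 :=
  fc_patch (ph_face f).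

(* g belongs to B_k(bd K) and b gives its values on the edges of K. As g is in
   H^1 of every face, it is in H^1(bd K) exactly when its traces from the two
   faces sharing an edge agree; this is the existence of a single b for all
   faces. *)
Definition Bk3 (k : nat) (K : polyhedron R) (g b : fn 3) : Prop :=
  forall f : 'I_(ph_size K),
    Vc2 k (fc_poly (ph_face f)) (g \o emb (bd_patch f)) (b \o emb (bd_patch f)).

(* v belongs to V_k^c(K), g is its trace on the boundary of K and b gives the
   values of g on the edges of K. *)
Definition Vc3 (k : nat) (K : polyhedron R) (v g b : fn 3) : Prop :=
  [/\ H1 (ph_body K) v,
      exists2 p, Pol k p & is_laplacian (ph_body K) v p,
      is_trace (ph_body K) (@bd_patch K) v g, Bk3 k K g b
    & enhanced k (ph_body K) (@bd_patch K) v g].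

Definition bubble (X : 'M[R]_(4, 3)) (x : 'rV[R]_3) : R :=
  \prod_i bary X x 0 i.

Definition face_bubble (X : 'M[R]_(4, 3)) (i : 'I_4) (x : 'rV[R]_3) : R :=
  \prod_(j | j != i) bary X x 0 j.

(* The extensions to the tetrahedron, through the Bernstein form of degree m, of
   the polynomials of the facet opposite to vertex i which are homogeneous of
   degree m about the barycenter of that facet. *)
Definition face_ext (m : int) (X : 'M[R]_(4, 3)) (i : 'I_4) : set (fn 3) :=
  if m is Posz m' then
    [set r | (exists c : {ffun 'I_4 -> 'I_m'.+1} -> R,
        r = fun x => \sum_(a : {ffun 'I_4 -> 'I_m'.+1} |
                            (a i == 0 :> nat) && ((\sum_j a j)%N == m'))
                       c a * \prod_j bary X x 0 j ^+ a j) /\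
      exists c : patch R 2 3,
        [/\ isometric c, patch_set c = facet X i
          & exists2 q, HPol m (barycenter (dom c)) q &
              forall t, dom c t -> r (emb c t) = q t]]
  else [set fun=> 0].

Definition Vtet (k : nat) (X : 'M[R]_(4, 3)) (v : fn 3) : Prop :=
  exists (p : fn 3) (r : 'I_4 -> fn 3) (s : 'I_4 -> 'I_3 -> fn 3),
    [/\ Pol k p,
        forall i : 'I_4, HPol (k%:Z - i%:Z) (barycenter (tet_set X)) (r i),
        forall (i : 'I_4) (l : 'I_3), face_ext (k%:Z - l%:Z) X i (s i l)
      & forall x, tet_set X x ->
          v x = p x + \sum_i bubble X x * r i x
                + \sum_i \sum_l face_bubble X i x * s i l x].

Definition Vmacro (k : nat) (K : polyhedron R) (T : tet_mesh R) (v : fn 3)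
    : Prop :=
  {within ph_body K, continuous v} /\ forall j, Vtet k (@tm_tet R T j) v.

Definition PiK (k : nat) (K : polyhedron R) (v g : fn 3) : fn 3 :=
  Piproj k (ph_body K) (@bd_patch K) v g.

(* The projections on a face F are functions of the intrinsic coordinates. *)
Definition PiF (k : nat) (F : face R) (g b : fn 3) : fn 2 :=
  Piproj k (pg_reg (fc_poly F)) (@pg_edge R (fc_poly F))
    (g \o emb (fc_patch F)) (b \o emb (fc_patch F)).

Definition QF (k : nat) (F : face R) (g : fn 3) : fn 2 :=
  Qproj k (pg_reg (fc_poly F)) (g \o emb (fc_patch F)).

(* w is the interpolant of v; g and b are as in Vc3. Closed simplices of the
   mesh that are not contained in the boundary of K are the interior ones. *)
Definition interpolant (k : nat) (K : polyhedron R) (T : tet_mesh R)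
    (v g b w : fn 3) : Prop :=
  let bdK := frontier (ph_body K) in
  let tet := @tm_tet R T in
  [/\ Vmacro k K T w,
      forall j i, let d := row i (tet j) in
        [/\ is_vertex K d -> w d = b d,
            forall f : 'I_(ph_size K),
              fc_set (ph_face f) d -> ~ is_vertex K d ->
              w d = PiF k (ph_face f) g b (coord (bd_patch f) d)
          & interior (ph_body K) d -> w d = PiK k K v g d],
      forall j i1 i2, i1 != i2 ->
        let c := edge_patch (row i1 (tet j)) (row i2 (tet j)) in
        let e := seg (row i1 (tet j)) (row i2 (tet j)) in
        forall q, SMono (k%:Z - 2) (dom c) q ->
        [/\ is_edge K e -> ip (dom c) ((w \- b) \o emb c) q = 0,
            forall f : 'I_(ph_size K),
              e `<=` fc_set (ph_face f) -> ~ is_edge K e ->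
              ip (dom c)
                ((w \- (PiF k (ph_face f) g b \o coord (bd_patch f))) \o emb c)
                q = 0
          & ~ (e `<=` bdK) -> ip (dom c) ((w \- PiK k K v g) \o emb c) q = 0],
      forall j i, let F := facet (tet j) i in
        (forall f : 'I_(ph_size K), F `<=` fc_set (ph_face f) ->
           let S := emb (bd_patch f) @^-1` F in
           forall q, SMono k S q ->
             ip S ((w \o emb (bd_patch f)) \- QF k (ph_face f) g) q = 0) /\
        (~ (F `<=` bdK) ->
           forall c : patch R 2 3, isometric c -> patch_set c = F ->
           forall q, SMono k (dom c) q ->
             ip (dom c) ((w \- PiK k K v g) \o emb c) q = 0)
    & forall j q, SMono k (tet_set (tet j)) q ->
        ip (tet_set (tet j)) (w \- Qproj k (ph_body K) v) q = 0].

End spaces.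

(* Main.v *)
Require Import Defs.
From mathcomp Require Import all_boot all_order all_algebra.
From mathcomp Require Import all_classical all_reals all_analysis.
From mathcomp Require Import measurable_realfun ring lra.
Import Order.TTheory GRing.Theory Num.Theory.
Import numFieldNormedType.Exports.
Local Open Scope classical_set_scope.
Local Open Scope ring_scope.

Set Implicit Arguments.
Unset Strict Implicit.
Unset Printing Implicit Defensive.

(* The conditions on tetrahedra and on boundary facets say that w and v have the
   same moments against P_k on K, and w and the trace of v on every face. The
   first of these is the second claim. For the first claim, integration by parts
   moves the derivative onto the gradient of q, whose components and their
   derivatives are in P_k, so that volume and boundary terms agree for w and v.
   Green's formula for the continuous, piecewise C^1 function w is obtained one
   coordinate direction at a time. Almost every line parallel to the axis meets
   the faces transversally, in finitely many interior points, and as K is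
   star-shaped it lies, near such a point, on exactly one side of the face; the
   fundamental theorem of calculus on the line and Fubini's theorem then give the
   formula. For v it follows from the C^1 functions approximating v in the
   definition of the trace. *)

(** * Slicing and affine changes of variables for the Lebesgue measure *)

Section slicing.
Context {R : realType}.

(** The polyhedron is given by its frontier and its faces, so no definition says on which side of a
    face the body lies, and no outward normal is at hand. The centre [c] of the ball supplies both:
    seen from [c] the body ends at each face, and the sign of the height of the plane of the face
    orients the normal [nu]. Two features of the definitions shape the rest. [wgrad] is a choice
    among weak gradients, so replacing it by the piecewise gradient of w takes a uniqueness
    statement; as the gradient of q need not vanish near the frontier, this must hold against C^1
    functions without compact support. And the moments are taken with scaled monomials on cells:
    these span P_k because the diameter of a cell is nonzero, and summing over cells requires
    overlaps to be null sets, which comes from the conformity of the mesh. The normals serve only as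
    common coefficients: the formula for v is a limit of the formula for C^1 functions, so the same
    [nu] occurs for w and for v and the boundary terms are compared face by face. *)

Definition ins n (i : 'I_n.+1) (s : R) (y : 'rV[R]_n) : 'rV[R]_n.+1 :=
  \row_j (if unlift i j is Some j' then y 0 j' else s).

Lemma measurable_ins n (i : 'I_n.+1) :
  measurable_fun setT (fun p : measurableTypeR R * 'rV[R]_n => ins i p.1 p.2).
Proof.
apply: measurable_rVP => j.
case: (unliftP i j) => [j'|] ji.
  rewrite (_ : _ \o _ = @rV_coord R n j' \o snd); last first.
    by apply/funext => p /=; rewrite /rV_coord /ins mxE ji liftK.
  by apply: measurableT_comp => //; exact: measurable_rV_coord.
rewrite (_ : _ \o _ = fst) ?measurable_fst//.
by apply/funext => p /=; rewrite /rV_coord /ins mxE ji unlift_none.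
Qed.

Lemma ins0 n (s : R) (y : 'rV[R]_n) : ins ord0 s y = rV_cons (s, y).
Proof.
apply/rowP => j; rewrite /ins mxE /rV_cons.
case: (@split_ordP 1 n j) => j' ->.
  rewrite (@row_mxEl _ 1 1 n) ord1 mxE eqxx mulr1n.
  by rewrite (_ : lshift n 0 = ord0) ?unlift_none//; exact: val_inj.
rewrite (@row_mxEr _ 1 1 n) (_ : rshift 1 j' = lift ord0 j') ?liftK//.
exact: val_inj.
Qed.

Lemma ins_lift n (i : 'I_n.+1) (s z : R) (y : 'rV[R]_n) :
  ins (lift ord0 i) s (rV_cons (z, y)) = rV_cons (z, ins i s y).
Proof.
rewrite -!ins0; apply/rowP => j; rewrite /ins !mxE.
case: (unliftP (lift ord0 i) j) => [j'|] ->.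
  rewrite mxE; case: (unliftP ord0 j') => [j2|] ->.
    rewrite (_ : lift (lift _ _) (lift _ _) = lift ord0 (lift i j2)).
      by rewrite liftK mxE liftK.
    by apply: val_inj; rewrite /= /bump /= !add1n ltnS addnS.
  rewrite (_ : lift _ _ = ord0) ?unlift_none//.
  exact: val_inj.
by rewrite liftK mxE unlift_none.
Qed.

Local Open Scope ereal_scope.

Lemma ge0_integral_leb_cons n (F : 'rV[R]_n.+1 -> \bar R) :
  measurable_fun setT F -> (forall x, 0 <= F x) ->
  \int[leb n.+1]_x F x =
  \int[(@lebesgue_measure R \x leb n)%E]_p F (rV_cons p).
Proof.
move=> mF F0.
exact: (@ge0_integral_pushforward _ _ _ _ R (@rV_cons R n)
  (@measurable_rV_cons R n) (@lebesgue_measure R \x leb n)%E setT F).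
Qed.

(** [leb] splits off the first coordinate only. For a later one, the first coordinate is frozen by
    Tonelli, the induction hypothesis is applied in the slice, and [ins_lift] lets the two
    insertions commute. *)
Lemma ge0_integral_leb_ins n (i : 'I_n.+1) (F : 'rV[R]_n.+1 -> \bar R) :
  measurable_fun setT F -> (forall x, 0 <= F x) ->
  \int[leb n.+1]_x F x = \int[leb n]_y \int[@lebesgue_measure R]_s F (ins i s y).
Proof.
elim: n i F => [|n IH] i F mF F0.
  rewrite ge0_integral_leb_cons// fubini_tonelli2//=.
    rewrite /fubini_G; apply: eq_integral => y _; apply: eq_integral => s _.
    by rewrite (ord1 i) ins0.
  by apply: measurableT_comp => //; exact: measurable_rV_cons.
have mFc : measurable_fun setT (fun p => F (rV_cons p)).
  by apply: measurableT_comp => //; exact: measurable_rV_cons.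
rewrite ge0_integral_leb_cons//.
case: (unliftP ord0 i) => [i'|] ->; last first.
  rewrite fubini_tonelli2//= /fubini_G.
  by apply: eq_integral => y _; apply: eq_integral => s _; rewrite ins0.
have mFi : measurable_fun setT
    (fun p : measurableTypeR R * 'rV[R]_n.+1 => F (ins (lift ord0 i') p.1 p.2)).
  by apply: measurableT_comp => //; exact: measurable_ins.
pose G (y : 'rV[R]_n.+1) := \int[@lebesgue_measure R]_s F (ins (lift ord0 i') s y).
have mG : measurable_fun [set: 'rV[R]_n.+1] G.
  exact: (@measurable_fun_fubini_tonelli_G _ _ _ _ _ (@lebesgue_measure R) _ mFi).
have G0 y : 0 <= G y by apply: integral_ge0.
have mGc : measurable_fun setT (fun p => G (rV_cons p)).
  by apply: measurableT_comp => //; exact: measurable_rV_cons.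
rewrite [RHS]ge0_integral_leb_cons// fubini_tonelli1//= fubini_tonelli1//=.
apply: eq_integral => z _; rewrite /fubini_F (IH i').
- by apply: eq_integral => y _; apply: eq_integral => s _; rewrite ins_lift.
- exact: (measurableT_comp mFc (pair1_measurable z)).
- by [].
- by move=> x; exact: G0.
Qed.

(** Positive and negative parts are treated separately; their line integrals are integrable in [y],
    so the difference may be taken under the outer integral. *)
Lemma integral_leb_ins n (i : 'I_n.+1) (F : 'rV[R]_n.+1 -> \bar R) :
  (leb n.+1).-integrable setT F ->
  \int[leb n.+1]_x F x = \int[leb n]_y \int[@lebesgue_measure R]_s F (ins i s y).
Proof.
move=> iF; have mF := measurable_int _ iF.
have aux (G : 'rV[R]_n.+1 -> \bar R) : measurable_fun setT G ->
    (forall x, 0 <= G x) -> (leb n.+1).-integrable setT G ->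
    (leb n).-integrable setT
      (fun y => \int[@lebesgue_measure R]_s G (ins i s y)).
  move=> mG G0 /integrableP[_ iG]; apply/integrableP; split.
    have mGi : measurable_fun setT
        (fun p : measurableTypeR R * 'rV[R]_n => G (ins i p.1 p.2)).
      by apply: measurableT_comp => //; exact: measurable_ins.
    exact: (@measurable_fun_fubini_tonelli_G _ _ _ _ _ (@lebesgue_measure R) _ mGi).
  under eq_integral do rewrite gee0_abs ?integral_ge0//.
  rewrite -ge0_integral_leb_ins//; apply: le_lt_trans iG.
  by apply: ge0_le_integral => //; [exact: measurableT_comp|
    move=> x _; rewrite gee0_abs].
rewrite integralE (ge0_integral_leb_ins i)//; last exact: measurable_funepos.
rewrite (ge0_integral_leb_ins i)//; last exact: measurable_funeneg.
rewrite -integralB//; last 2 first.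
- by apply: aux => //; [exact: measurable_funepos|exact: integrable_funepos].
- by apply: aux => //; [exact: measurable_funeneg|exact: integrable_funeneg].
apply: eq_integral => y _; rewrite [in RHS]integralE.
  by congr (_ - _); apply: eq_integral => s _; rewrite !(funeposE, funenegE).
Qed.

End slicing.

Section affine1.
Context {R : realType}.
Local Notation mu := (@lebesgue_measure R).

Lemma measurable_affine1 (a b : R) :
  measurable_fun setT (fun s : measurableTypeR R => a * s + b : measurableTypeR R).
Proof.
apply: (@measurable_funD _ _ R setT (fun s => a * s) (fun=> b)) => //.
by apply: (@measurable_funM _ _ R setT (fun=> a) id).
Qed.

Lemma measurable_comp_pair (k : measurableTypeR R * measurableTypeR R -> \bar R)
    (f g : measurableTypeR R * measurableTypeR R -> measurableTypeR R) :
  measurable_fun setT k -> measurable_fun setT f -> measurable_fun setT g ->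
  measurable_fun setT (fun p => k (f p, g p)).
Proof.
move=> mk mf mg.
have mfg : measurable_fun setT (fun p => (f p, g p)).
  by apply/measurable_fun_pairP; split.
exact: (measurableT_comp mk mfg).
Qed.

Lemma measurable_affine2 (a b c : R) :
  measurable_fun setT (fun p : measurableTypeR R * measurableTypeR R =>
    a * p.1 + b * p.2 + c : measurableTypeR R).
Proof.
have mM (r : R) (f : measurableTypeR R * measurableTypeR R -> R) :
    measurable_fun setT f -> measurable_fun setT (fun p => r * f p).
  by move=> mf; apply: (@measurable_funM _ _ R setT (fun=> r) f).
apply: (@measurable_funD _ _ R setT (fun p => a * p.1 + b * p.2) (fun=> c));
  last exact: measurable_cst.
apply: (@measurable_funD _ _ R setT (fun p => a * p.1) (fun p => b * p.2)).
  by apply: mM; exact: measurable_fst.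
by apply: mM; exact: measurable_snd.
Qed.

Local Open Scope ereal_scope.

(** Uniqueness of Lebesgue measure: [|a|] times the pushforward agrees with [mu] on half-open
    intervals. For negative [a] the preimage is half-open on the other side, which does not change
    its length. *)
Lemma lebesgue_measure_affine (a b : R) (A : set (measurableTypeR R)) :
  (a != 0)%R -> measurable A ->
  mu ((fun s => a * s + b)%R @^-1` A) = (`|a|^-1)%:E * mu A.
Proof.
move=> a0 mA.
have na0 : (0 < `|a|)%R by rewrite normr_gt0.
pose phi : measurableTypeR R -> measurableTypeR R := fun s => (a * s + b)%R.
have mphi : measurable_fun setT phi := measurable_affine1 a b.
pose nu : {measure set (measurableTypeR R) -> \bar R} :=
  mscale (NngNum (ltW na0))
    (measure_function_pushforward__canonical__measure_function_Measure mu mphi).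
have E : mu A = nu A.
  apply: lebesgue_measure_unique => // X /ocitvP[->|[[c d] /= cd ->]].
    by rewrite !measure0.
  rewrite /nu /= /mscale /= /pushforward.
  have [ap|an|a00] := ltgtP a 0%R; last by rewrite a00 eqxx in a0.
  - rewrite (_ : phi @^-1` _ = `[(d - b) / a, (c - b) / a[%classic)%R; last first.
      apply/seteqP; split => s /=; rewrite !in_itv /phi /=.
        by rewrite ler_ndivrMr// ltr_ndivlMr// => /andP[? ?]; apply/andP; split; lra.
      by rewrite ler_ndivrMr// ltr_ndivlMr// => /andP[? ?]; apply/andP; split; lra.
    rewrite !lebesgue_measure_itv/= !lte_fin cd ltr_nM2r ?invr_lt0// ltrD2r cd.
    rewrite -!EFinB -EFinM ltr0_norm//; congr EFin.
    by field; rewrite lt_eqF.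
  - rewrite (_ : phi @^-1` _ = `](c - b) / a, (d - b) / a]%classic)%R; last first.
      apply/seteqP; split => s /=; rewrite !in_itv /phi /=.
        by rewrite ltr_pdivrMr// ler_pdivlMr// => /andP[? ?]; apply/andP; split; lra.
      by rewrite ltr_pdivrMr// ler_pdivlMr// => /andP[? ?]; apply/andP; split; lra.
    rewrite !lebesgue_measure_itv/= !lte_fin cd ltr_pM2r ?invr_gt0// ltrD2r cd.
    rewrite -!EFinB -EFinM gtr0_norm//; congr EFin.
    by field; rewrite gt_eqF.
rewrite E /nu /= /mscale /= /pushforward muleA -EFinM mulVf ?mul1e//.
by rewrite normr_eq0.
Qed.

Lemma ge0_integral_affine1 (a b : R) (h : measurableTypeR R -> \bar R) :
  (a != 0)%R -> measurable_fun setT h -> (forall s, 0 <= h s) ->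
  \int[mu]_s h (a * s + b)%R = (`|a|^-1)%:E * \int[mu]_s h s.
Proof.
move=> a0 mh h0.
have na0 : (0 <= `|a|^-1)%R by rewrite invr_ge0.
pose phi : measurableTypeR R -> measurableTypeR R := fun s => (a * s + b)%R.
have mphi : measurable_fun setT phi := measurable_affine1 a b.
have <- := @ge0_integral_pushforward _ _ _ _ R phi mphi mu setT h measurableT mh
  (fun s _ => h0 s).
pose m1 : {measure set (measurableTypeR R) -> \bar R} :=
  measure_function_pushforward__canonical__measure_function_Measure mu mphi.
pose m2 : {measure set (measurableTypeR R) -> \bar R} := mscale (NngNum na0) mu.
rewrite -(ge0_integral_mscale mu measurableT (NngNum na0))// -/m1 -/m2.
apply: eq_measure_integral => A mA _ /=.
by rewrite /mscale/= /pushforward lebesgue_measure_affine.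
Qed.

(** Gaussian elimination with pivot [a]: a substitution in [x] at fixed [y] and, after exchanging
    the integrals, one in [y] at fixed [x]. The second factor is the Schur complement [e], and
    [a * e] is the determinant. *)
Let affine2_step (k : measurableTypeR R * measurableTypeR R -> \bar R)
    (a b c d x0 y0 : R) :
  measurable_fun setT k -> (forall p, 0 <= k p) ->
  (a != 0)%R -> (a * d - b * c != 0)%R ->
  \int[mu]_y \int[mu]_x k (a * x + c * y + x0, b * x + d * y + y0)%R =
  (`|a * d - b * c|^-1)%:E * \int[mu]_x \int[mu]_y k (x, y).
Proof.
move=> mk k0 a0 D0.
pose e := (d - b * c / a)%R.
have e0 : (e != 0)%R.
  have -> : e = ((a * d - b * c) / a)%R by rewrite /e; field.
  by rewrite mulf_neq0// invr_eq0.
have E (x y : R) : (b * x + d * y + y0 =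
    b / a * (a * x + (c * y + x0)) + e * y + (y0 - b / a * x0))%R.
  by rewrite /e; field.
pose g (p : measurableTypeR R * measurableTypeR R) :=
  k (p.1, b / a * p.1 + e * p.2 + (y0 - b / a * x0))%R.
have mg : measurable_fun setT g.
  exact: (measurable_comp_pair mk (@measurable_fst _ _ _ _) (measurable_affine2 _ _ _)).
transitivity (\int[mu]_y ((`|a|^-1)%:E * \int[mu]_x g (x, y))).
  apply: eq_integral => y _.
  rewrite -(ge0_integral_affine1 (c * y + x0)%R a0); last 2 first.
  - exact: (measurable_fun_pair1 (T1 := measurableTypeR R) (T2 := measurableTypeR R)).
  - by move=> s; exact: k0.
  apply: eq_integral => x _; rewrite /g /=; congr (k (_, _)); first by rewrite addrA.
  exact: E.
rewrite ge0_integralZl//; last 2 first.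
- exact: (@measurable_fun_fubini_tonelli_G _ _ _ _ _ mu g mg (fun=> k0 _)).
- by move=> y _; apply: integral_ge0 => x _; exact: k0.
have <- := @fubini_tonelli _ _ _ _ _ mu mu g mg (fun=> k0 _).
rewrite /fubini_F.
transitivity ((`|a|^-1)%:E * \int[mu]_x ((`|e|^-1)%:E * \int[mu]_y k (x, y))).
  congr (_ * _); apply: eq_integral => x _; rewrite /g/=.
  rewrite -(ge0_integral_affine1 (b / a * x + (y0 - b / a * x0))%R e0 (h := fun y => k (x, y)))//.
    by apply: eq_integral => y _; rewrite addrAC addrC addrA.
  exact: (measurable_fun_pair2 (T1 := measurableTypeR R) (T2 := measurableTypeR R)).
rewrite ge0_integralZl//; last 2 first.
- exact: (@measurable_fun_fubini_tonelli_F _ _ _ _ _ mu k mk k0).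
- by move=> y _; apply: integral_ge0 => x _; exact: k0.
rewrite muleA -EFinM -invfM -normrM; congr ((`|_|^-1)%:E * _).
by rewrite /e; field.
Qed.

(** If [a] vanishes then [c] does not, and the two variables are exchanged; the determinant changes
    sign, which its absolute value does not see. *)
Lemma ge0_integral_affine2 (k : measurableTypeR R * measurableTypeR R -> \bar R)
    (a b c d x0 y0 : R) :
  measurable_fun setT k -> (forall p, 0 <= k p) -> (a * d - b * c != 0)%R ->
  \int[mu]_x \int[mu]_y k (a * x + c * y + x0, b * x + d * y + y0)%R =
  (`|a * d - b * c|^-1)%:E * \int[mu]_x \int[mu]_y k (x, y).
Proof.
move=> mk k0 D0.
have [a0|a0] := eqVneq a 0%R; last first.
  rewrite -(affine2_step x0 y0 mk k0 a0 D0).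
  pose g (p : measurableTypeR R * measurableTypeR R) :=
    k (a * p.1 + c * p.2 + x0, b * p.1 + d * p.2 + y0)%R.
  have mg : measurable_fun setT g.
    exact: (measurable_comp_pair mk (measurable_affine2 _ _ _) (measurable_affine2 _ _ _)).
  exact: (@fubini_tonelli _ _ _ _ _ mu mu g mg (fun=> k0 _)).
have c0 : (c != 0)%R.
  by apply: contra D0 => /eqP ->; rewrite a0 mul0r mulr0 subrr.
have D0' : (c * b - d * a != 0)%R.
  by apply: contra D0; rewrite -[(c * b - _)%R]opprB oppr_eq0 mulrC (mulrC c).
rewrite (_ : (a * d - b * c)%R = - (c * b - d * a))%R; last by ring.
rewrite normrN -(affine2_step x0 y0 mk k0 c0 D0').
by apply: eq_integral => x _; apply: eq_integral => y _; congr (k (_ + _, _ + _))%R;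
  rewrite addrC.
Qed.

End affine1.

Section leb_facts.
Context {R : realType}.
Local Notation mu := (@lebesgue_measure R).

Lemma measurable_coord n (i : 'I_n) :
  measurable_fun [set: 'rV[R]_n] (fun x : 'rV[R]_n => x 0 i).
Proof. exact: measurable_rV_coord. Qed.

Lemma measurable_affine m n (A : 'M[R]_(m, n)) (a : 'rV[R]_n) :
  measurable_fun [set: 'rV[R]_m] (fun x : 'rV[R]_m => x *m A + a : 'rV[R]_n).
Proof.
apply: measurable_rVP => j.
rewrite (_ : _ \o _ = fun x : 'rV[R]_m => (\sum_i x 0 i * A i j) + a 0 j); last first.
  by apply/funext => x; rewrite /rV_coord /= !mxE.
apply: measurable_funD; last exact: measurable_cst.
apply: measurable_sum => i; apply: measurable_funM; last exact: measurable_cst.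
exact: measurable_coord.
Qed.

Lemma nbhs_rVP n (x : 'rV[R]_n) (A : set 'rV[R]_n) :
  nbhs x A <-> exists2 e : R, 0 < e &
    forall y : 'rV[R]_n, (forall i, `|y 0 i - x 0 i| < e) -> A y.
Proof.
split => [/nbhs_ballP[e /= e0 xA]|[e e0 xA]].
  exists e => // y xy; apply: xA; split => // i j.
  by rewrite (ord1 i) /ball /= distrC.
apply/nbhs_ballP; exists e => //= y [_ xy]; apply: xA => i.
by rewrite distrC; exact: (xy 0 i).
Qed.

(** The sigma-algebra is generated by the coordinates, so [A] is written as a countable union of
    boxes: those with rational centre and half-width [1 / (m + 1)] that lie in [A]. *)
Lemma open_measurable_rV n (A : set 'rV[R]_n) : open A -> measurable A.
Proof.
move=> oA.
pose B (p : 'rV[rat]_n * nat) : set 'rV[R]_n :=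
  [set y | forall i, `|y 0 i - ratr (p.1 0 i)| < p.2.+1%:R^-1].
pose F p := if `[< B p `<=` A >] then B p else set0.
have -> : A = \bigcup_p F p.
  apply/seteqP; split => [x Ax|x [p _]]; last first.
    by rewrite /F; case: asboolP => // BA Bx; exact: BA.
  have /nbhs_rVP[e e0 xA] : nbhs x A by exact: open_nbhs_nbhs.
  (* The half-width is less than [e / 2], so a cube of this size that contains [x] stays within
     distance [e] of [x]. *)
  pose m := Num.trunc (2 / e).
  have me : m.+1%:R^-1 < e / 2.
    rewrite invf_plt ?posrE ?divr_gt0// invf_div.
    by apply: truncnS_gt.
  have mp : 0 < m.+1%:R^-1 :> R by rewrite invr_gt0.
  have /choice[q xq] : forall i : 'I_n, exists q : rat, `|x 0 i - ratr q| < m.+1%:R^-1.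
    move=> i.
    have [||z [xz [r _ rz]]] := @dense_rat R (ball (x 0 i) m.+1%:R^-1).
    - by exists (x 0 i); exact: ballxx.
    - exact: ball_open.
    by exists r; rewrite rz.
  exists (\row_i q i, m) => //.
  rewrite /F asboolT; first by move=> i /=; rewrite mxE.
  move=> y /= Hy; apply: xA => i.
  have := Hy i; rewrite mxE => yi; have xi := xq i.
  rewrite (_ : _ - _ = (y 0 i - ratr (q i)) - (x 0 i - ratr (q i))); last by ring.
  rewrite (le_lt_trans (ler_normB _ _))// [ltRHS]splitr.
  by rewrite ltrD// (lt_trans _ me).
apply: countable_bigcupT_measurable; first exact: countableP.
move=> p; rewrite /F; case: ifP => // _.
rewrite (_ : B p = \bigcap_(i in [set: 'I_n])
    ((fun x : 'rV[R]_n => x 0 i) @^-1` ball (ratr (p.1 0 i) : R) p.2.+1%:R^-1)); last first.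
  apply/seteqP; split => [y By i _|y By i] /=.
    by rewrite /ball /= distrC; exact: By.
  by have := By i I; rewrite /= /ball /= distrC.
apply: fin_bigcap_measurable => // i _.
by rewrite -[X in measurable X]setTI; apply: measurable_coord => //; exact: measurable_ball.
Qed.

Lemma continuous_measurable_rV n (f : 'rV[R]_n -> R) :
  continuous f -> measurable_fun [set: 'rV[R]_n] f.
Proof.
move=> cf; apply: (measurability _ (RGenOpens.measurableE R)).
move=> _ [_ [a [b ->] <-]]; rewrite setTI.
by apply: open_measurable_rV; apply: open_comp => // + _; exact: cf.
Qed.

Lemma leb_box n (M : R) :
  (leb n [set x : 'rV[R]_n | forall i, (`|x ord0 i| <= M)%R] < +oo)%E.
Proof.
elim: n => [|n IH] /=; first by rewrite diracE; case: (_ \in _); rewrite ltry.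
rewrite /leb_step /pushforward.
rewrite (_ : _ @^-1` _ = `[(- M)%R, M]%classic `*`
    [set x : 'rV[R]_n | forall i, `|x ord0 i| <= M]); last first.
  apply/seteqP; split => [[s y]|[s y] [/= sM yM]] /=.
    rewrite -ins0 => H; split => /=.
      by have := H ord0; rewrite mxE unlift_none in_itv/= ler_norml.
    by move=> i; have := H (lift ord0 i); rewrite mxE liftK.
  move=> i; rewrite -ins0 mxE; case: unliftP => [j _|_]; first exact: yM.
  by move: sM; rewrite in_itv/= ler_norml.
rewrite product_measure1E//; last first.
  rewrite (_ : mkset _ = \bigcap_(i in [set: 'I_n])
      ((fun x : 'rV[R]_n => x 0 i) @^-1` `[(- M)%R, M]%classic)); last first.
    apply/seteqP; split => [y By i _|y By i] /=.
      by rewrite in_itv/= -ler_norml; exact: By.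
    by have := By i I; rewrite /= in_itv/= -ler_norml.
  apply: fin_bigcap_measurable => // i _.
  by rewrite -[X in measurable X]setTI; exact: measurable_coord.
apply: lte_mul_pinfty; [exact: measure_ge0| |exact: IH].
apply/fin_numPlt; rewrite (lt_le_trans _ (measure_ge0 _ _)) ?ltNy0//=.
have := @lebesgue_measure_itv R `[(- M), M]; rewrite /= => ->.
by case: ifPn => // _; rewrite -EFinD ltry.
Qed.

Lemma measurable_hyperplane n (a : 'I_n -> R) (c : R) :
  measurable [set x : 'rV[R]_n | \sum_i a i * x 0 i = c].
Proof.
rewrite (_ : mkset _ = (fun x : 'rV[R]_n => \sum_i a i * x 0 i) @^-1` [set c]) //.
rewrite -[X in measurable X]setTI.
have mf : measurable_fun [set: 'rV[R]_n] (fun x : 'rV[R]_n => \sum_i a i * x 0 i).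
  apply: measurable_sum => i; apply: measurable_funM; first exact: measurable_cst.
  exact: measurable_coord.
exact: mf.
Qed.

(** Slicing in direction [i]: as [a i] is nonzero, each line meets the hyperplane in the single
    point [r]. *)
Lemma leb_hyperplane n (a : 'I_n -> R) (c : R) (i : 'I_n) : a i != 0 ->
  leb n [set x : 'rV[R]_n | \sum_i a i * x 0 i = c] = 0%E.
Proof.
case: n a i => [a []//|n] a i ai0.
set A := mkset _.
have mA : measurable A := measurable_hyperplane a c.
rewrite -[A in LHS]setIT -(integral_indic _ measurableT mA).
rewrite (ge0_integral_leb_ins i); last 2 first.
- by apply/measurable_EFinP; exact: measurable_indic.
- by move=> x; rewrite lee_fin.
apply: integral0_eq => y _.
set r := (c - \sum_j a (lift i j) * y 0 j) / a i.
rewrite (eq_integral (fun s : measurableTypeR R => (\1_[set r] s)%:E)); last first.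
  move=> s _; congr EFin; rewrite !indicE; congr ((nat_of_bool _)%:R); apply: asbool_equiv_eq.
  rewrite /A /= (bigD1_ord i)//= mxE unlift_none.
  rewrite (eq_bigr (fun j => a (lift i j) * y 0 j)); last first.
    by move=> j _; rewrite mxE liftK.
  split => [H|->]; first by rewrite /r -H addrK mulrC mulKf.
  by rewrite /r mulrC divfK// subrK.
rewrite integral_indic// setIT; exact: lebesgue_measure_set1.
Qed.

Lemma det2 (M : 'M[R]_2) : \det M = M 0 0 * M 1 1 - M 0 1 * M 1 0.
Proof.
rewrite (expand_det_row _ 0) !big_ord_recl big_ord0 /cofactor !det_mx11 !mxE /=.
rewrite (_ : lift ord0 0 = 1); last exact: val_inj.
rewrite (_ : lift 1 0 = 0); last exact: val_inj.
by rewrite /bump /= expr0 expr1 mul1r addr0 mulN1r mulrN.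
Qed.

Definition row2 (p : measurableTypeR R * measurableTypeR R) : 'rV[R]_2 :=
  rV_cons (p.1, rV_cons (p.2, 0)).

Lemma row2E (x y : R) : row2 (x, y) = \row_j [tuple x; y]`_j.
Proof.
rewrite /row2 -!ins0; apply/rowP => j; rewrite !mxE.
case: (unliftP ord0 j) => [j'|] ->; last by [].
by rewrite mxE (ord1 j') unlift_none.
Qed.

Lemma measurable_row2 : measurable_fun setT row2.
Proof.
have m1 : measurable_fun setT (fun p : measurableTypeR R * measurableTypeR R =>
    (p.2, 0 : 'rV[R]_0)).
  by apply/measurable_fun_pairP; split; [exact: measurable_snd|exact: measurable_cst].
have m2 := measurableT_comp (@measurable_rV_cons R 0) m1.
have m3 : measurable_fun setT (fun p : measurableTypeR R * measurableTypeR R =>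
    (p.1, rV_cons (p.2, 0 : 'rV[R]_0))).
  by apply/measurable_fun_pairP; split; [exact: measurable_fst|exact: m2].
exact: (measurableT_comp (@measurable_rV_cons R 1) m3).
Qed.

Local Open Scope ereal_scope.

Lemma ge0_integral_leb2 (F : 'rV[R]_2 -> \bar R) :
  measurable_fun [set: 'rV[R]_2] F -> (forall x, 0 <= F x) ->
  \int[leb 2]_x F x = \int[mu]_x \int[mu]_y F (row2 (x, y)).
Proof.
move=> mF F0.
have mFc : measurable_fun setT (fun p => F (rV_cons p)).
  by apply: measurableT_comp => //; exact: measurable_rV_cons.
rewrite ge0_integral_leb_cons// fubini_tonelli1//=.
apply: eq_integral => x _; rewrite /fubini_F.
have mFx : measurable_fun [set: 'rV[R]_1] (fun y => F (rV_cons (x, y))).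
  exact: (measurableT_comp mFc (pair1_measurable x)).
rewrite (ge0_integral_leb_cons (n := 0))//.
rewrite fubini_tonelli1//=; last first.
  exact: (measurableT_comp mFx (@measurable_rV_cons R 0)).
(* The recursion of [leb] ends in the Dirac mass on ['rV_0], which evaluates the innermost
   integral. *)
apply: eq_integral => y _; rewrite /fubini_F/= integral_dirac//.
  by rewrite diracT mul1e.
exact: (measurableT_comp (measurableT_comp mFx (@measurable_rV_cons R 0))
  (pair1_measurable y)).
Qed.

Lemma ge0_integral_leb2_affine (F : 'rV[R]_2 -> \bar R) (M : 'M[R]_2) (a : 'rV[R]_2) :
  measurable_fun [set: 'rV[R]_2] F -> (forall x, 0 <= F x) -> (\det M != 0)%R ->
  \int[leb 2]_x F (x *m M + a)%R = (`|\det M|^-1)%:E * \int[leb 2]_x F x.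
Proof.
move=> mF F0 dM.
have mFa : measurable_fun [set: 'rV[R]_2] (fun x : 'rV[R]_2 => F (x *m M + a)%R).
  exact: (measurableT_comp mF (measurable_affine M a)).
rewrite !ge0_integral_leb2//.
have detE : \det M = (M 0 0 * M 1 1 - M 0 1 * M 1 0)%R by exact: det2.
rewrite detE in dM *.
rewrite -(ge0_integral_affine2 (k := F \o row2) (a 0 0)%R (a 0 1)%R
  (measurableT_comp mF measurable_row2) (fun=> F0 _) dM).
apply: eq_integral => x _; apply: eq_integral => y _; congr F.
rewrite !row2E; apply/rowP => j; rewrite !mxE !big_ord_recl big_ord0 !mxE /= addr0.
have [->|->] : j = 0%R \/ j = 1%R.
  by case: j => -[|[|//]] ?; [left|right]; exact: val_inj.
- by rewrite /= mulrC (mulrC y) (_ : lift _ _ = 1%R)//; exact: val_inj.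
- by rewrite /= mulrC (mulrC y) (_ : lift _ _ = 1%R)//; exact: val_inj.
Qed.

Lemma integral_leb2_affine (F : 'rV[R]_2 -> \bar R) (M : 'M[R]_2) (a : 'rV[R]_2) :
  (leb 2).-integrable setT F -> (\det M != 0)%R ->
  \int[leb 2]_x F (x *m M + a)%R = (`|\det M|^-1)%:E * \int[leb 2]_x F x.
Proof.
move=> iF dM; have mF : measurable_fun [set: 'rV[R]_2] F := measurable_int _ iF.
rewrite integralE [in RHS]integralE.
rewrite muleBr; [|by []|]; last first.
  by apply: fin_num_adde_defl; rewrite fin_numN; exact: integrable_neg_fin_num.
rewrite -(ge0_integral_leb2_affine a (measurable_funepos mF))//.
rewrite -(ge0_integral_leb2_affine a (measurable_funeneg mF))//.
by congr (_ - _); apply: eq_integral => x _; rewrite !(funeposE, funenegE).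
Qed.

Lemma integrable_leb2_affine (F : 'rV[R]_2 -> \bar R) (M : 'M[R]_2) (a : 'rV[R]_2) :
  (leb 2).-integrable setT F -> (\det M != 0)%R ->
  (leb 2).-integrable setT (fun x => F (x *m M + a)%R).
Proof.
move=> iF dM; have mF : measurable_fun [set: 'rV[R]_2] F := measurable_int _ iF.
apply/integrableP; split.
  exact: (measurableT_comp mF (measurable_affine M a)).
rewrite (ge0_integral_leb2_affine (F := fun x => `|F x|) a)//; last exact: measurableT_comp.
by apply: lte_mul_pinfty => //; have /integrableP[] := iF.
Qed.

End leb_facts.

(** * The fundamental theorem of calculus on a line crossing the boundary *)

Section line.
Context {R : realType}.
Local Notation mu := (@lebesgue_measure R).

(** Induction on the exceptional points: the interval is split at each of them, continuity carrying
    the constant across. Without any, this is the mean value theorem. *)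
Lemma derive0_const (E : seq R) (f : R -> R) (a b : R) : a <= b ->
  {within `[a, b], continuous f} ->
  (forall x, a < x < b -> x \notin E -> is_derive x 1 f 0) -> f a = f b.
Proof.
elim: E a b => [|e E IH] a b; rewrite le_eqVlt => /predU1P[->//|ab] cf df.
  have [x _ /eqP] := MVT ab (fun x xab => df x xab isT) cf.
  by rewrite mul0r subr_eq0 => /eqP.
have sub c d : a <= c -> c <= d -> d <= b ->
    (forall x, c < x < d -> x != e) -> f c = f d.
  move=> ac cd db xe; apply: IH => //.
    apply: continuous_subspaceW cf => x /=; rewrite !in_itv/= => /andP[cx xd].
    by rewrite (le_trans ac)// (le_trans xd).
  move=> x /andP[cx xd] xE; apply: df; first by rewrite (le_lt_trans ac)// (lt_le_trans xd).
  by rewrite inE negb_or xE xe// cx.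
have [/andP[ae eb]|eab] := boolP (a <= e <= b).
  rewrite (sub a e)// ?(sub e b)//; last first.
    by move=> x /andP[_ xe]; rewrite lt_eqF.
  by move=> x /andP[xe _]; rewrite gt_eqF.
apply: sub => //; first exact: ltW.
by move=> x /andP[ax xb]; apply: contra eab => /eqP <-; rewrite !ltW.
Qed.

(** [H] and the primitive [F] of [D] have the same derivative off [E], so their difference is
    constant. The interval is prolonged to [u] because an integral is differentiated at an endpoint
    inside a larger interval of integrability. *)
Lemma FTC_finite (E : seq R) (H D : R -> R) (a b u : R) : a < b -> b < u ->
  mu.-integrable `[a, u] (EFin \o D) ->
  {within `[a, b], continuous H} ->
  (forall x, a < x < b -> x \notin E ->
    is_derive x 1 H (D x) /\ {for x, continuous D}) ->
  \int[mu]_(x in `[a, b]) D x = H b - H a.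
Proof.
move=> ab bu iD cH dH.
pose F y := \int[mu]_(x in `[a, y]) D x.
have iDb : mu.-integrable `[a, b] (EFin \o D).
  apply: integrableS iD => //; apply: subset_itvl; rewrite bnd_simp; exact: ltW.
have cF : {within `[a, b], continuous F}.
  by apply: parameterized_integral_continuous iDb; exact: ltW.
have /derive0_const-/(_ E) FH : {within `[a, b], continuous (fun x => F x - H x)}.
  by move=> x; apply: continuousB; [exact: cF|exact: cH].
have : F a - H a = F b - H b.
  apply: FH; first exact: ltW.
  move=> x xab xE; have [dHx cDx] := dH _ xab xE; move: xab => /andP[ax xb].
  have iDx : mu.-integrable [set` Interval (BLeft a) (BRight u)] (EFin \o D) by [].
  have [dFx F'x] := continuous_FTC1 (lt_trans xb bu) iDx ax cDx.
  have dF : is_derive x 1 F (D x).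
    by apply: DeriveDef => //; rewrite -F'x derive1E.
  have := is_deriveB dF dHx; by rewrite subrr.
have -> : F a = 0 by rewrite /F set_itv1 Rintegral_set1.
rewrite -/(F b); lra.
Qed.

Section crossing.
Variables (N : nat) (P : pred 'I_N) (c : 'I_N -> R) (o : 'I_N -> bool).
Variables (K : set R) (U D : R -> R) (E : seq R) (M : R).
Hypothesis Kopen : forall s, ~ K s -> \forall t \near s, ~ K t.
Hypothesis KM : forall s, K s -> `|s| < M.
Hypothesis Ucont : forall s, K s -> forall e, 0 < e ->
  \forall t \near s, K t -> `|U t - U s| < e.
Hypothesis cinj : {in P &, injective c}.
Hypothesis Kint : forall s, K s -> (forall f, P f -> c f != s) ->
  \forall t \near s, K t.
Hypothesis Kc : forall f, P f -> K (c f).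
Hypothesis Kcross : forall f, P f ->
  \forall t \near c f, K t <-> if o f then t <= c f else c f <= t.
Hypothesis cE : forall f, P f -> c f \in E.
Hypothesis UD : forall s, s \notin E -> K s -> is_derive s 1 U (D s).
Hypothesis D0 : forall s, ~ K s -> D s = 0.
Hypothesis Dcont : forall s, s \notin E -> {for s, continuous D}.
Hypothesis Dint : forall a b, mu.-integrable `[a, b] (EFin \o D).

(** The comparison is strict for an exit and weak for an entry because the crossing point itself
    belongs to [K]: there [U] still counts in the first case and already counts in the second. *)
Let J f s := if o f then (if c f < s then U (c f) else 0)
             else (if c f <= s then - U (c f) else 0).

(* Adding the jumps J to U on K yields a continuous function on the whole line,
   whose derivative is D off a finite set. *)
Let H s := (if `[< K s >] then U s else 0) + \sum_(f | P f) J f s.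

Let J_const f s : c f != s -> \forall t \near s, J f t = J f s.
Proof.
rewrite /J neq_lt => /orP[cs|sc].
  near=> t; have ct : c f < t by near: t; exact: lt_nbhsr.
  by rewrite cs ct !ltW.
near=> t; have ct : t < c f by near: t; exact: lt_nbhsl.
by rewrite !(ltNge (c f)) !(ltW sc) !(ltW ct) !leNgt sc ct.
Unshelve. all: by end_near. Qed.

Let H_cont : continuous H.
Proof.
move=> s; apply/cvgrPdist_lt => e e0.
(* Three cases: [s] is a crossing, for a single index [f0] by [cinj]; or it is interior to [K]; or
   it lies in the open complement. *)
have [f0 /andP[Pf0 /eqP cf0]|no] := pickP (fun f => P f && (c f == s)).
  have Ks : K s by rewrite -cf0; exact: Kc.
  have Jn : \forall t \near s, forall f, P f && (f != f0) -> J f t = J f s.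
    apply: (@filter_forall R 'I_N (fun f t => P f && (f != f0) -> J f t = J f s)
      (nbhs s) _) => f.
    have [/andP[Pf ff0]|_] := boolP (P f && (f != f0)); last by apply: nearW.
    apply: filterS (J_const (f := f) (s := s) _) => [t -> //|].
    by apply: contra ff0 => /eqP cfs; apply/eqP/cinj => //; rewrite cf0.
  have Kn := Kcross Pf0; rewrite cf0 in Kn.
  have Un := Ucont Ks e0.
  near=> t.
  have Ut : K t -> `|U t - U s| < e by near: t.
  have Kt : K t <-> if o f0 then t <= s else s <= t by near: t.
  have Jt : forall f, P f && (f != f0) -> J f t = J f s by near: t.
  rewrite /H (bigD1 f0)//= [in X in _ - X](bigD1 f0)//= asboolT//.
  rewrite (eq_bigr _ Jt) !addrA opprD addrACA subrr addr0 /J cf0 ltxx lexx.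
  case: ifP Kt => of0 Kt.
    case: (leP t s) => ts.
      rewrite asboolT; last exact/Kt.
      by rewrite !addr0 distrC; apply/Ut/Kt.
    rewrite asboolF; last by move/Kt; rewrite leNgt ts.
    by rewrite addr0 add0r subrr normr0.
  case: (leP s t) => ts.
    rewrite asboolT; last exact/Kt.
    by rewrite subrr sub0r normrN; apply/Ut/Kt.
  rewrite asboolF; last by move/Kt; rewrite leNgt ts.
  by rewrite addr0 !subrr normr0.
have cs f : P f -> c f != s by move=> Pf; have := no f; rewrite Pf/= => ->.
have Jn : \forall t \near s, forall f, P f -> J f t = J f s.
  apply: (@filter_forall R 'I_N (fun f t => P f -> J f t = J f s) (nbhs s) _) => f.
  have [Pf|_] := boolP (P f); last by apply: nearW.
  by apply: filterS (J_const (cs _ Pf)) => t ->.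
have [Ks|Ks] := pselect (K s).
  have Un := Ucont Ks e0; have Kn := Kint Ks cs.
  near=> t.
  have Ut : K t -> `|U t - U s| < e by near: t.
  have Kt : K t by near: t.
  have Jt : forall f, P f -> J f t = J f s by near: t.
  by rewrite /H (eq_bigr _ Jt) !asboolT// opprD addrACA subrr addr0 distrC; exact: Ut.
have Kn := Kopen Ks.
near=> t.
have Kt : ~ K t by near: t.
have Jt : forall f, P f -> J f t = J f s by near: t.
by rewrite /H (eq_bigr _ Jt) !asboolF// subrr normr0.
Unshelve. all: by end_near. Qed.

Let H_derive s : s \notin E -> is_derive s 1 H (D s).
Proof.
move=> sE.
have cs f : P f -> c f != s by move=> Pf; apply: contra sE => /eqP <-; exact: cE.
have Jn : \forall t \near s, forall f, P f -> J f t = J f s.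
  apply: (@filter_forall R 'I_N (fun f t => P f -> J f t = J f s) (nbhs s) _) => f.
  have [Pf|_] := boolP (P f); last by apply: nearW.
  by apply: filterS (J_const (cs _ Pf)) => t ->.
have [Ks|Ks] := pselect (K s).
  have dU := UD sE Ks; have Kn := Kint Ks cs.
  apply: (near_eq_is_derive (f := fun t => U t + \sum_(f | P f) J f s)).
  - near=> t; have Kt : K t by near: t.
    have Jt : forall f, P f -> J f t = J f s by near: t.
    by rewrite /H (eq_bigr _ Jt) asboolT.
  - rewrite -[D s]addr0; apply: is_deriveD.
have Kn := Kopen Ks.
apply: (near_eq_is_derive (f := fun t => \sum_(f | P f) J f s)).
- near=> t; have Kt : ~ K t by near: t.
  have Jt : forall f, P f -> J f t = J f s by near: t.
  by rewrite /H (eq_bigr _ Jt) asboolF// add0r.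
- by rewrite D0//; exact: is_derive_cst.
Unshelve. all: by end_near. Qed.

Lemma integral_crossing :
  \int[mu]_s D s = \sum_(f | P f) (if o f then 1 else -1) * U (c f).
Proof.
have KM' s : M <= `|s| -> ~ K s by move=> Ms /KM; rewrite ltNge Ms.
(* [K] lies strictly between [-L] and [L], and [L] is positive even if [K] is empty and [M]
   negative. So [H] vanishes at [-L] and is the sum of all jumps at [L]. *)
pose L := `|M| + 1.
have L0 : 0 < L by rewrite /L ltr_wpDl.
have ML : M <= L by rewrite /L (le_trans (ler_norm _))// lerDl.
rewrite (_ : \int[mu]_s D s = \int[mu]_(s in `[- L, L]) D s); last first.
  rewrite [RHS]Rintegral_mkcond; apply: eq_Rintegral => s _; rewrite patchE.
  case: ifPn => //; rewrite notin_setE /= in_itv/= -ler_norml => sL.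
  by rewrite D0//; apply: KM'; rewrite (le_trans ML)// ltW// ltNge; apply/negP.
rewrite (@FTC_finite E H D (- L) L (L + 1)) ?ltrDl//; last 3 first.
- by rewrite -subr_gt0 opprK addr_gt0.
- exact: continuous_subspaceT.
- by move=> x _ xE; split; [exact: H_derive|exact: Dcont].
have cL f : P f -> - L < c f < L.
  by move=> Pf; rewrite -ltr_norml (lt_le_trans (KM (Kc Pf))).
rewrite /H asboolF; last by apply: KM'; rewrite gtr0_norm.
rewrite asboolF; last by apply: KM'; rewrite normrN gtr0_norm.
rewrite !add0r -sumrB; apply: eq_bigr => f Pf; have /andP[cl cr] := cL f Pf.
rewrite /J cr (ltNge (c f)) (ltW cr) (ltW cl) leNgt cl /=.
by case: ifP => _; rewrite subr0 ?mul1r ?mulN1r.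
Qed.

End crossing.
End line.

(** * Local structure of a star-shaped polyhedron *)

Section vectors.
Context {R : realType}.

Definition dot n (u z : 'rV[R]_n) : R := \sum_j u 0 j * z 0 j.

Lemma dotDr n (u x y : 'rV[R]_n) : dot u (x + y) = dot u x + dot u y.
Proof. by rewrite /dot -big_split; apply: eq_bigr => j _; rewrite mxE mulrDr. Qed.

Lemma dotZr n (u x : 'rV[R]_n) a : dot u (a *: x) = a * dot u x.
Proof. by rewrite /dot mulr_sumr; apply: eq_bigr => j _; rewrite mxE mulrCA. Qed.

Lemma dotBr n (u x y : 'rV[R]_n) : dot u (x - y) = dot u x - dot u y.
Proof. by rewrite dotDr -scaleN1r dotZr mulN1r. Qed.

Lemma dotZl n (u x : 'rV[R]_n) a : dot (a *: u) x = a * dot u x.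
Proof. by rewrite /dot mulr_sumr; apply: eq_bigr => j _; rewrite mxE mulrA. Qed.

Lemma dotE n (u x : 'rV[R]_n) : dot u x = (x *m u^T) 0 0.
Proof. by rewrite mxE; apply: eq_bigr => j _; rewrite mxE mulrC. Qed.

Lemma continuous_sum (T : topologicalType) (I : Type) (r : seq I) (P : pred I)
    (F : I -> T -> R) :
  (forall i, continuous (F i)) -> continuous (fun x => \sum_(i <- r | P i) F i x).
Proof.
move=> cF x; apply: (cvg_big (U := R) (op := +%R)) => [|i _]; first exact: add_continuous.
exact: cF.
Qed.

Lemma dot_continuous n (u : 'rV[R]_n) : continuous (dot u).
Proof.
rewrite /dot; apply: (@continuous_sum 'rV[R]_n 'I_n _ _ (fun j x => u 0 j * x 0 j)).
move=> j x; apply: (@continuousM R 'rV[R]_n (fun=> u 0 j) (fun x => x 0 j)).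
  exact: cst_continuous.
exact: coord_continuous.
Qed.

(** The cross product of the two rows, written with signed minors: for a face, the [i]-th component
    of the normal is then, up to sign, the Jacobian of the projection along the [i]-th axis. *)
Definition cross (A : 'M[R]_(2, 3)) : 'rV[R]_3 :=
  \row_j ((-1) ^+ j * \det (col' j A)).

(** In the arithmetic of ['I_3] the last index 2 is [-1], which is how the formulas for [cross] name
    it. *)
Lemma sum3 (F : 'I_3 -> R) : \sum_j F j = F 0 + F 1 + F (-1).
Proof.
rewrite !big_ord_recl big_ord0 addr0 addrA; congr (_ + F _ + F _); exact: val_inj.
Qed.

Lemma crossE (A : 'M[R]_(2, 3)) :
  [/\ cross A 0 0 = A 0 1 * A 1 (-1) - A 0 (-1) * A 1 1,
      cross A 0 1 = A 0 (-1) * A 1 0 - A 0 0 * A 1 (-1)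
    & cross A 0 (-1) = A 0 0 * A 1 1 - A 0 1 * A 1 0].
Proof.
have l00 : lift (0 : 'I_3) (0 : 'I_2) = 1 by exact: val_inj.
have l01 : lift (0 : 'I_3) (1 : 'I_2) = -1 by exact: val_inj.
have l10 : lift (1 : 'I_3) (0 : 'I_2) = 0 by exact: val_inj.
have l11 : lift (1 : 'I_3) (1 : 'I_2) = -1 by exact: val_inj.
have l20 : lift (-1 : 'I_3) (0 : 'I_2) = 0 by exact: val_inj.
have l21 : lift (-1 : 'I_3) (1 : 'I_2) = 1 by exact: val_inj.
rewrite /cross; split; rewrite mxE det2 !mxE ?(l00, l01, l10, l11, l20, l21) /=.
- by rewrite expr0 mul1r.
- by rewrite expr1 mulN1r opprB.
- by rewrite /= expr2 mulN1r opprK mul1r.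
Qed.

Lemma cross_orth (A : 'M[R]_(2, 3)) : A *m (cross A)^T = 0.
Proof.
have tE k j : (cross A)^T k j = cross A 0 k by rewrite [LHS]mxE (ord1 j).
apply/matrixP => r j; rewrite [LHS]mxE [RHS]mxE sum3 !tE; have [-> -> ->] := crossE A.
have [->|->] : r = 0 \/ r = 1.
  by case: r => -[|[|//]] ?; [left|right]; exact: val_inj.
- by ring.
- by ring.
Qed.

Lemma cross_unit (A : 'M[R]_(2, 3)) : A *m A^T = 1%:M -> cross A *m (cross A)^T = 1%:M.
Proof.
have tE k j : (cross A)^T k j = cross A 0 k by rewrite [LHS]mxE (ord1 j).
move=> AA; apply/matrixP => i j.
rewrite [LHS]mxE [RHS]mxE sum3 !tE (ord1 i) (ord1 j) eqxx.
have [-> -> ->] := crossE A.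
have e00 : A 0 0 ^+ 2 + A 0 1 ^+ 2 + A 0 (-1) ^+ 2 = 1.
  by have /matrixP/(_ 0 0) := AA; rewrite !mxE sum3 !mxE eqxx -!expr2.
have e11 : A 1 0 ^+ 2 + A 1 1 ^+ 2 + A 1 (-1) ^+ 2 = 1.
  by have /matrixP/(_ 1 1) := AA; rewrite !mxE sum3 !mxE eqxx -!expr2.
have e01 : A 0 0 * A 1 0 + A 0 1 * A 1 1 + A 0 (-1) * A 1 (-1) = 0.
  by have /matrixP/(_ 0 1) := AA; rewrite !mxE sum3 !mxE.
(* Lagrange's identity: the squared norm of the cross product is the Gram determinant of the
   rows. *)
transitivity ((A 0 0 ^+ 2 + A 0 1 ^+ 2 + A 0 (-1) ^+ 2) *
    (A 1 0 ^+ 2 + A 1 1 ^+ 2 + A 1 (-1) ^+ 2) -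
    (A 0 0 * A 1 0 + A 0 1 * A 1 1 + A 0 (-1) * A 1 (-1)) ^+ 2); first by ring.
by rewrite e00 e11 e01 mulr1 expr0n subr0.
Qed.

(** With the unit normal appended, the orthonormal rows form a square matrix [B], so [B *m B^T = 1]
    gives [B^T *m B = 1], which is the decomposition. *)
Lemma cross_decomp (A : 'M[R]_(2, 3)) (d : 'rV[R]_3) : A *m A^T = 1%:M ->
  d = d *m A^T *m A + dot (cross A) d *: cross A.
Proof.
move=> AA.
pose B : 'M[R]_(2 + 1, 3) := col_mx A (cross A).
have BB : B *m B^T = 1%:M.
  rewrite /B tr_col_mx mul_col_row AA cross_orth cross_unit//.
  rewrite (_ : cross A *m A^T = 0); last first.
    by apply: trmx_inj; rewrite trmx_mul trmxK cross_orth trmx0.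
  by rewrite -scalar_mx_block.
have : d *m (B^T *m B) = d by rewrite (mulmx1C BB) mulmx1.
rewrite /B tr_col_mx mul_row_col mulmxDr !mulmxA => {1}<-; congr (_ + _).
rewrite [d *m (cross A)^T]mx11_scalar -dotE mul_scalar_mx.
by [].
Qed.

Lemma enormZ n a (x : 'rV[R]_n) : enorm (a *: x) = `|a| * enorm x.
Proof.
rewrite /enorm -sqrtr_sqr -sqrtrM ?sqr_ge0// mulr_sumr; congr Num.sqrt.
by apply: eq_bigr => i _; rewrite mxE exprMn.
Qed.

Lemma enorm_nbhs n (x : 'rV[R]_n) (rho : R) : 0 < rho ->
  nbhs x [set y | enorm (y - x) < rho].
Proof.
(* If every coordinate is below [rho / (n + 1)], the sum of squares is at most
   [n rho^2 / (n + 1)^2], strictly less than [rho^2] also for [n = 0]. *)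
move=> r0; apply/nbhs_rVP; exists (rho / n.+1%:R).
  by rewrite divr_gt0.
move=> y yx /=; rewrite /enorm -[ltRHS](ger0_norm (ltW r0)) -sqrtr_sqr.
rewrite ltr_sqrt ?exprn_gt0//.
apply: (@le_lt_trans _ _ (\sum_(i < n) (rho / n.+1%:R) ^+ 2)).
  apply: ler_sum => i _; rewrite !mxE -[leLHS]real_normK ?num_real//.
  by rewrite lerXn2r ?nnegrE// ltW// divr_gt0.
rewrite sumr_const card_ord -[ltLHS]mulr_natr expr_div_n -mulrA.
rewrite -[ltRHS]mulr1 ltr_pM2l ?exprn_gt0// mulrC.
rewrite ltr_pdivrMr ?exprn_gt0// mul1r -natrX ltr_nat.
by rewrite expnS expn1 (leq_trans (ltnSn n))// leq_pmull.
Qed.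

Section star.
Variables (n : nat) (S : set 'rV[R]_n) (c : 'rV[R]_n) (r : R).
Hypothesis r0 : 0 < r.
Hypothesis star : forall y, enorm (y - c) < r -> S y /\ forall x, S x -> seg y x `<=` S.

(** The homothety of centre [z] and ratio [1 - tau] sends the ball about [c] to a ball about this
    point, swept by segments that end in [z]. *)
Lemma star_interior z tau : S z -> 0 <= tau < 1 -> nbhs (c + tau *: (z - c)) S.
Proof.
move=> Sz /andP[t0 t1].
have t1' : 0 < 1 - tau by rewrite subr_gt0.
have := enorm_nbhs (c + tau *: (z - c)) (mulr_gt0 t1' r0); apply: filterS => y /= yr.
(* The preimage of [y] under the homothety: [y = w + tau (z - w)]. *)
pose w := c + (1 - tau)^-1 *: (y - (c + tau *: (z - c))).
have wr : enorm (w - c) < r.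
  rewrite /w addrC addKr enormZ gtr0_norm ?invr_gt0//.
  by rewrite mulrC ltr_pdivrMr// mulrC.
have [_ /(_ z Sz)] := star wr; apply; exists tau; first by rewrite t0 ltW.
rewrite /w; apply/rowP => i; rewrite !mxE; field.
by rewrite gt_eqF.
Qed.

End star.
End vectors.

Section row_vectors.
Context {R : realType}.

Lemma cvg_rV (T : Type) (F : set_system T) {FF : Filter F} n (f : T -> 'rV[R]_n) (l : 'rV[R]_n) :
  (forall i, (fun x => f x 0 i) @ F --> l 0 i) -> f @ F --> l.
Proof.
move=> fl A /nbhs_rVP[e e0 lA].
have : \forall x \near F, forall i, `|f x 0 i - l 0 i| < e.
  apply: (@filter_forall T 'I_n (fun i x => `|f x 0 i - l 0 i| < e) F _) => i.
  have /cvgrPdist_lt/(_ _ e0) := fl i.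
  by apply: filterS => x; rewrite distrC.
by apply: filterS => x; exact: lA.
Qed.

Lemma affine_continuous m n (A : 'M[R]_(m, n)) (a : 'rV[R]_n) :
  continuous (fun x : 'rV[R]_m => x *m A + a : 'rV[R]_n).
Proof.
move=> x; apply: (@cvg_rV _ (nbhs x) (nbhs_filter x)) => j.
rewrite (_ : (fun y => _) = fun y => dot (col j A)^T y + a 0 j); last first.
  by apply/funext => y; rewrite !mxE; congr (_ + _); apply: eq_bigr => k _; rewrite !mxE mulrC.
rewrite (_ : (x *m A + a) 0 j = dot (col j A)^T x + a 0 j); last first.
  by rewrite !mxE; congr (_ + _); apply: eq_bigr => k _; rewrite !mxE mulrC.
apply: cvgD; last exact: cvg_cst.
exact: dot_continuous.
Qed.

End row_vectors.

Section patches.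
Context {R : realType}.

Lemma emb_line m n (c : Defs.patch R m n) t u e :
  emb c (t + e *: (t - u)) = emb c t + e *: (emb c t - emb c u).
Proof.
by rewrite /emb mulmxDl -scalemxAl mulmxBl opprD addrACA subrr add0r addrA.
Qed.

Lemma emb_seg m n (c : Defs.patch R m n) p q e :
  emb c (p + e *: (q - p)) = emb c p + e *: (emb c q - emb c p).
Proof.
by rewrite /emb mulmxDl -scalemxAl mulmxBl opprD [in RHS]addrACA subrr add0r addrA.
Qed.

Lemma coord_emb (c : Defs.patch R 2 3) (t : 'rV[R]_2) : isometric c -> Defs.coord c (emb c t) = t.
Proof.
by move=> ic; rewrite /Defs.coord /emb addrC addKr -mulmxA ic mulmx1.
Qed.

Lemma dot_emb (c : Defs.patch R 2 3) t : dot (cross (frame c)) (emb c t - org c) = 0.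
Proof.
by rewrite /emb addrC addKr dotE -mulmxA cross_orth mulmx0 mxE.
Qed.

Lemma emb_coord (c : Defs.patch R 2 3) z : isometric c ->
  dot (cross (frame c)) (z - org c) = 0 -> emb c (Defs.coord c z) = z.
Proof.
move=> ic z0; rewrite /emb /Defs.coord.
have := cross_decomp (z - org c) ic; rewrite z0 scale0r addr0 => <-.
by rewrite addrC subrK.
Qed.

Lemma emb_continuous m n (c : Defs.patch R m n) : continuous (emb c).
Proof.
rewrite (_ : emb c = fun t => t *m frame c + org c); first exact: affine_continuous.
by apply/funext => t; rewrite /emb addrC.
Qed.

Lemma patch_coord_continuous m n (c : Defs.patch R m n) : continuous (Defs.coord c).
Proof.
rewrite (_ : Defs.coord c = fun x => x *m (frame c)^T + (- org c *m (frame c)^T)).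
  exact: affine_continuous.
by apply/funext => t; rewrite /Defs.coord mulmxDl.
Qed.

End patches.

Lemma negligible_bigcup_fin d (T : measurableType d) (R : realType)
    (mu : {measure set T -> \bar R}) (I : finType) (F : I -> set T) :
  (forall i, mu.-negligible (F i)) -> mu.-negligible (\bigcup_i F i).
Proof.
move=> nF.
rewrite (_ : \bigcup_i F i = \big[setU/set0]_(i <- enum I) F i); last first.
  by rewrite -bigcup_seq; apply: eq_bigcupl; split => i //= _; rewrite mem_enum.
by elim/big_ind : _ => [|A B|i _]; [exact: negligible_set0|exact: negligibleU|].
Qed.

Section face_structure.
Context {R : realType}.
Variables (K : polyhedron R) (c : 'rV[R]_3) (r : R).
Hypothesis r0 : 0 < r.
Hypothesis star : forall y, enorm (y - c) < r ->
  ph_body K y /\ forall x, ph_body K x -> seg y x `<=` ph_body K.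
Hypothesis Kp : is_polyhedron K.

Local Notation pt := (@bd_patch R K).

(* The signed distance from c to the plane of the face; its sign tells which of
   the two unit normals points outwards. *)
Definition height f := dot (cross (frame (pt f))) (org (pt f) - c).
Definition nu f : 'rV[R]_3 := Num.sg (height f) *: cross (frame (pt f)).

Lemma body_closed : closed (ph_body K).
Proof. by case: Kp => cK _ _ _ _; apply: compact_closed cK; exact: norm_hausdorff. Qed.

Lemma face_frontier f (t : 'rV[R]_2) : dom (pt f) t -> ph_body K (emb (pt f) t) /\
  ~ nbhs (emb (pt f) t) (ph_body K).
Proof.
move=> ft; have [_ _ _ fr _] := Kp.
have : frontier (ph_body K) (emb (pt f) t) by rewrite fr; exists f => //; exists t.
by case=> + ?; rewrite -(closure_id _).1//; exact: body_closed.
Qed.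

Lemma face_isometric f : isometric (pt f).
Proof. by have [_ _ /(_ f)[]] := Kp. Qed.

(** If the plane contained [c], one could move from an interior point of the face a little away from
    [c] within the face. The original point would then lie strictly between [c] and a point of [K],
    hence be interior to [K]. *)
Lemma height_neq0 f (t : 'rV[R]_2) : nbhs t (dom (pt f)) -> height f != 0.
Proof.
move=> ft; apply/eqP => h0.
have cE : emb (pt f) (Defs.coord (pt f) c) = c.
  apply: emb_coord; first exact: face_isometric.
  by rewrite -opprB -scaleN1r dotZr -/(height f) h0 mulr0.
pose g (e : R) := t + e *: (t - Defs.coord (pt f) c).
have gt : g e @[e --> 0] --> t.
  rewrite -[X in _ --> X]addr0 -(scale0r (t - Defs.coord (pt f) c)).
  by apply: cvgD; [exact: cvg_cst|apply: cvgZr_tmp; exact: cvg_id].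
have : \forall e \near 0^'+, dom (pt f) (g e).
  by apply: cvg_within; exact: gt.
move=> gn; have [e [e0 ge]] := filter_ex (filterI (nbhs_right_gt (0 : R)) gn).
have [Kg _] := face_frontier ge.
have [_] := face_frontier (nbhs_singleton ft); apply.
have e10 : 0 < 1 + e by rewrite addr_gt0.
have e1 : 0 <= (1 + e)^-1 < 1.
  by rewrite invr_ge0 (ltW e10) invf_lt1// ltrDl.
have := star_interior r0 star Kg e1.
rewrite emb_line cE (_ : c + _ = emb (pt f) t)//.
apply/rowP => i; rewrite !mxE; field.
by rewrite gt_eqF.
Qed.

Lemma nu_plane f t : dot (nu f) (emb (pt f) t - c) = `|height f|.
Proof.
rewrite (_ : _ - c = (emb (pt f) t - org (pt f)) + (org (pt f) - c)); last by rewrite addrA subrK.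
by rewrite dotDr !dotZl dot_emb mulr0 add0r -/(height f) -normrEsg.
Qed.

(* Along each ray from c, the points before the face are interior to K by
   star-shapedness, and those after it are not in K since otherwise the point of
   the face would be interior to K. *)
Lemma local_side f (t : 'rV[R]_2) : nbhs t (dom (pt f)) ->
  \forall z \near emb (pt f) t,
    ph_body K z <-> dot (nu f) (z - emb (pt f) t) <= 0.
Proof.
move=> ft; set x := emb (pt f) t; set h := `|height f|.
have hne := height_neq0 ft.
have h0 : 0 < h by rewrite normr_gt0.
have hx : dot (nu f) (x - c) = h by exact: nu_plane.
pose a z := dot (nu f) (z - c).
have aE z : a z = h + dot (nu f) (z - x).
  by rewrite -hx -dotDr addrC addrA subrK.
have ac : continuous a.
  rewrite (_ : a = fun z => dot (nu f) z - dot (nu f) c); last first.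
    by apply/funext => z; rewrite /a dotBr.
  move=> z; apply: (@cvgB _ _ _ (nbhs z) (nbhs_filter z)).
    exact: dot_continuous.
  exact: cvg_cst.
have ax : a x = h by [].
(* Central projection from [c] to the plane of the face. It fixes [x] and is continuous there, so
   for [z] near [x] it lands in the face itself and not just in its plane. *)
pose p z := c + (h / a z) *: (z - c).
have px : p x = x by rewrite /p ax divff ?gt_eqF// scale1r addrC subrK.
have pc : p z @[z --> x] --> x.
  rewrite -[X in _ --> X]px /p; have FF := nbhs_filter x.
  apply: (@cvgD _ _ _ _ FF); first exact: cvg_cst.
  apply: (@cvgZ _ _ _ (nbhs x) FF).
    apply: (@cvgM _ _ (nbhs x) FF); first exact: cvg_cst.
    by apply: (@cvgV _ _ (nbhs x) FF); [rewrite ax gt_eqF|exact: ac].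
  by apply: (@cvgB _ _ _ _ FF); [exact: cvg_id|exact: cvg_cst].
have near_dom : \forall z \near x, dom (pt f) (Defs.coord (pt f) (p z)).
  have cp : Defs.coord (pt f) (p z) @[z --> x] --> t.
    rewrite -[X in _ --> X](coord_emb t (face_isometric f)).
    by apply: cvg_comp pc _; exact: patch_coord_continuous.
  exact: cp.
have near_a : \forall z \near x, 0 < a z.
  have /cvgrPdist_lt/(_ _ h0) := ac x; apply: filterS => z.
  by rewrite ax ltr_norml => /andP[_]; rewrite ltrBlDl ltrDr.
near=> z.
have az : 0 < a z by near: z.
have dz : dom (pt f) (Defs.coord (pt f) (p z)) by near: z.
have pE : emb (pt f) (Defs.coord (pt f) (p z)) = p z.
  apply: emb_coord; first exact: face_isometric.
  have : dot (nu f) (p z - c) = h.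
    by rewrite /p addrC addKr dotZr divfK// gt_eqF.
  rewrite -hx => /eqP; rewrite -subr_eq0 -dotBr opprB addrA subrK dotZl.
  rewrite mulf_eq0 sgr_eq0 (negPf hne) /= => /eqP E.
  rewrite (_ : _ - _ = (p z - x) + (x - org (pt f))); last by rewrite addrA subrK.
  by rewrite dotDr E (dot_emb (pt f) t) addr0.
have [Kpz Ipz] := face_frontier dz; rewrite pE in Kpz Ipz.
have dE : dot (nu f) (z - x) = a z - h by rewrite aE [RHS]addrC addKr.
split => [Kz|].
  rewrite leNgt; apply/negP; rewrite dE subr_gt0 => ha; apply: Ipz.
  have hat : 0 <= h / a z < 1 by rewrite divr_ge0 ?ltW//= ltr_pdivrMr// mul1r.
  exact: (star_interior r0 star Kz hat).
rewrite dE subr_le0 => ha.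
have cc : enorm (c - c) < r.
  by rewrite subrr /enorm big1 ?sqrtr0// => i _; rewrite mxE expr0n.
have [_ /(_ _ Kpz)] := star cc; apply; exists (a z / h).
  by rewrite (divr_ge0 (ltW az) (ltW h0))/= ler_pdivrMr// mul1r.
have -> : p z - c = (h / a z) *: (z - c) by rewrite /p addrAC subrr add0r.
rewrite scalerA mulrA divfK ?gt_eqF// divff ?gt_eqF// scale1r.
by rewrite addrC subrK.
Unshelve. all: by end_near. Qed.

Variable i : 'I_3.

Definition seg_point f (e : 'I_(fc_size (ph_face f))) (t : 'rV[R]_2) : Prop :=
  seg (@pg_vtx R (fc_poly (@ph_face R K f)) e) (pg_vtx (ordS e)) t.

(* The lines parallel to the i-th axis that lie in the plane of a face or meet an
   edge, through their intersections with the orthogonal coordinate plane. *)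
Definition bad_line : set 'rV[R]_2 := [set y |
  (exists f, cross (frame (pt f)) 0 i = 0 /\ exists t, y = col' i (emb (pt f) t)) \/
  (exists f e t, @seg_point f e t /\ y = col' i (emb (pt f) t))].

(** In dimension at least two some nonzero vector is orthogonal to [q - p]. The case [p = q] is
    covered: an edge parallel to the axis projects to a point. *)
Lemma seg_line n (p q : 'rV[R]_n.+2) : exists2 a : 'rV[R]_n.+2, a != 0 &
  seg p q `<=` [set t | dot a t = dot a p].
Proof.
have /rowV0Pn[a + a0] : kermx (q - p)^T != 0.
  rewrite -mxrank_eq0 mxrank_ker -lt0n subn_gt0.
  by rewrite (leq_ltn_trans (rank_leq_col _)).
move=> /sub_kermxP ap; exists a => // t [s _ ->] /=.
rewrite dotDr dotZr [X in _ + s * X](_ : _ = 0) ?mulr0 ?addr0//.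
by rewrite dotE -[_ *m _]trmxK trmx_mul trmxK ap mxE mxE.
Qed.

Lemma col'D m n (j : 'I_n) (A B : 'M[R]_(m, n)) : col' j (A + B) = col' j A + col' j B.
Proof. by apply/matrixP => a b; rewrite !mxE. Qed.

Lemma col'M m n p (j : 'I_p) (A : 'M[R]_(m, n)) (B : 'M[R]_(n, p)) :
  col' j (A *m B) = A *m col' j B.
Proof. by apply/matrixP => a b; rewrite !mxE; apply: eq_bigr => k _; rewrite mxE. Qed.

Lemma col'_emb f t : col' i (emb (pt f) t) = col' i (org (pt f)) + t *m col' i (frame (pt f)).
Proof. by rewrite /emb col'D col'M. Qed.

Lemma hyperplane_negligible n (a : 'rV[R]_n) b : a != 0 ->
  (leb n).-negligible [set t | dot a t = b].
Proof.
move=> /rV0Pn[j aj].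
exists [set t | dot a t = b]; split => //; first exact: measurable_hyperplane.
exact: (leb_hyperplane b aj).
Qed.

(** The plane of a face parallel to the axis has a singular projected frame, so it projects into a
    line; an edge projects to a segment or a point. These are finitely many null sets. *)
Lemma bad_line_negligible : (leb 2).-negligible bad_line.
Proof.
pose B1 f : set 'rV[R]_2 := if cross (frame (pt f)) 0 i == 0
  then [set y | exists t, y = col' i (emb (pt f) t)] else set0.
pose B2 f (e : 'I_(fc_size (ph_face f))) : set 'rV[R]_2 :=
  [set y | exists t, @seg_point f e t /\ y = col' i (emb (pt f) t)].
have B1n f : (leb 2).-negligible (B1 f).
  rewrite /B1; case: eqP => [d0|_]; last exact: negligible_set0.
  have /det0P[a a0 aM] : \det (col' i (frame (pt f)))^T == 0.
    rewrite det_tr; move: d0; rewrite mxE => /eqP.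
    by rewrite mulf_eq0 expf_eq0 oppr_eq0 oner_eq0 andbF.
  have := hyperplane_negligible (dot a (col' i (org (pt f)))) a0.
  apply: negligibleS => y [t ->] /=; rewrite col'_emb dotDr.
  rewrite [X in _ + X](_ : _ = 0) ?addr0// dotE -mulmxA -[X in _ *m X]trmxK trmx_mul trmxK aM.
  by rewrite trmx0 mulmx0 mxE.
have B2n f e : (leb 2).-negligible (@B2 f e).
  have [a a0 sa] := seg_line
    (col' i (emb (pt f) (@pg_vtx R (fc_poly (@ph_face R K f)) e)))
    (col' i (emb (pt f) (@pg_vtx R (fc_poly (@ph_face R K f)) (ordS e)))).
  have := hyperplane_negligible (dot a (col' i (emb (pt f)
    (@pg_vtx R (fc_poly (@ph_face R K f)) e)))) a0.
  apply: negligibleS => y [t [[s s01 ->] ->]]; apply: sa; exists s => //.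
  by rewrite emb_seg; apply/matrixP => k l; rewrite !mxE.
suff : bad_line `<=` (\bigcup_f B1 f) `|` \bigcup_f \bigcup_e @B2 f e.
  move=> sub; apply: (negligibleS sub); apply: negligibleU.
    exact: negligible_bigcup_fin.
  by apply: negligible_bigcup_fin => f; exact: negligible_bigcup_fin.
move=> y [[f [d0 yf]]|[f [e [t te]]]]; [left|right].
  by exists f => //; rewrite /B1 d0 eqxx.
by exists f => //; exists e => //; exists t.
Qed.

End face_structure.

(** * Barycentric coordinates and piecewise functions *)

Section tets.
Context {R : realType}.

Implicit Types X : 'M[R]_(4, 3).

(** Its columns are the gradients of the barycentric coordinates. *)
Definition bary_slope (X : 'M[R]_(4, 3)) : 'M[R]_(3, 4) :=
  dsubmx (invmx (homog_mx X) : 'M[R]_(1 + 3, 4)).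

Definition bary_shift (X : 'M[R]_(4, 3)) : 'rV[R]_4 :=
  usubmx (invmx (homog_mx X) : 'M[R]_(1 + 3, 4)).

Lemma bary_affine X x : bary X x = x *m bary_slope X + bary_shift X.
Proof.
rewrite /bary -[invmx _](@vsubmxK _ 1 3) mul_row_col mul1mx addrC.
by rewrite /bary_slope /bary_shift.
Qed.

Lemma bary_unique X (l : 'rV[R]_4) : Defs.nondegenerate X ->
  \sum_i l 0 i = 1 -> bary X (l *m X) = l.
Proof.
move=> nX l1; rewrite /bary -[RHS](mulmxK nX); congr (_ *m _).
rewrite /homog_mx (@mul_mx_row _ 1 4 1 3); congr row_mx.
apply/matrixP => i j; rewrite !mxE (ord1 i) (ord1 j) eqxx /=.
transitivity (\sum_k l 0 k); first by rewrite l1.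
by apply: eq_bigr => k _; rewrite mxE mulr1.
Qed.

Lemma bary_sum X x : Defs.nondegenerate X -> \sum_i bary X x 0 i = 1 /\ bary X x *m X = x.
Proof.
move=> nX; have : bary X x *m homog_mx X = row_mx 1%:M x by rewrite /bary mulmxKV.
rewrite /homog_mx (@mul_mx_row _ 1 4 1 3) => E.
have [/matrixP/(_ 0 0) H ->] := @eq_row_mx _ 1 1 3 _ _ _ _ E; split => //.
move: H; rewrite [RHS]mxE eqxx /= [LHS]mxE => H; apply: etrans H.
by apply: eq_bigr => k _; rewrite [const_mx _ _ _]mxE mulr1.
Qed.

(** Uniqueness of barycentric coordinates replaces the existential weights by [bary X x], which
    makes a subsimplex a finite intersection of closed conditions. *)
Lemma hullE X (s : {set 'I_4}) : Defs.nondegenerate X ->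
  hull X s = [set x | forall i, 0 <= bary X x 0 i /\ (i \notin s -> bary X x 0 i = 0)].
Proof.
move=> nX; apply/seteqP; split => x /=.
  by move=> [l [l0 ls l1 ->]] i; rewrite bary_unique//; split; [exact: l0|exact: ls].
move=> H; exists (bary X x); have [? ?] := bary_sum x nX.
by split => // i; have [] := H i.
Qed.

Lemma tet_setE X : Defs.nondegenerate X -> tet_set X = [set x | forall i, 0 <= bary X x 0 i].
Proof.
move=> nX; rewrite /tet_set hullE//; apply/seteqP; split => x /= H i.
  by have [] := H i.
by split; [exact: H|rewrite finset.in_setT].
Qed.

Lemma bary_vertex X (l l' : 'I_4) : Defs.nondegenerate X -> bary X (row l X) 0 l' = (l == l')%:R.
Proof.
move=> nX; rewrite rowE bary_unique//; first by rewrite mxE eqxx eq_sym.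
by rewrite (bigD1 l)//= mxE !eqxx big1 ?addr0// => i il; rewrite mxE eqxx (negPf il).
Qed.

Lemma bary_continuous X l : continuous (fun x => bary X x 0 l).
Proof.
move=> x; have c1 : continuous (bary X).
  rewrite (_ : bary X = fun x => x *m bary_slope X + bary_shift X).
    exact: affine_continuous.
  by apply/funext => z; exact: bary_affine.
apply: (@continuous_comp _ _ _ (bary X) (fun v : 'rV[R]_4 => v 0 l) x); first exact: c1.
exact: coord_continuous.
Qed.

Lemma measurable_bary X l : measurable_fun [set: 'rV[R]_3] (fun x => bary X x 0 l).
Proof. by apply: continuous_measurable_rV; exact: bary_continuous. Qed.

Lemma measurable_hull X s : Defs.nondegenerate X -> measurable (hull X s).
Proof.
move=> nX; rewrite hullE//.
rewrite (_ : mkset _ = \bigcap_(i in [set: 'I_4])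
   ((fun x => bary X x 0 i) @^-1` [set r | 0 <= r /\ (i \notin s -> r = 0)])); last first.
  by apply/seteqP; split => x /= H i; [move=> _|]; exact: H.
apply: fin_bigcap_measurable => // i _.
rewrite -[X in measurable X]setTI; apply: measurable_bary => //.
have [si|si] := boolP (i \in s).
  rewrite (_ : mkset _ = `[0, +oo[%classic)//.
  apply/seteqP; split => r /=; rewrite in_itv/= andbT; first by case.
  by move=> r0; split.
rewrite (_ : mkset _ = [set 0])//; apply/seteqP; split => r /=.
  by case=> _; exact.
by move=> ->; split.
Qed.

End tets.

Section pieces.
Context {R : realType}.
Variable m : nat.
Variable tet : 'I_m -> set 'rV[R]_3.

(* On the overlap of several pieces the one of least index is selected. *)
Definition first_in (x : 'rV[R]_3) (j : 'I_m) : Prop :=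
  tet j x /\ forall l : 'I_m, (l < j)%N -> ~ tet l x.

(** At most one summand is nonzero. Off all pieces the value is 0, which allows integration over
    whole lines and over the whole space. *)
Definition pw (d : 'I_m -> 'rV[R]_3 -> R) (x : 'rV[R]_3) : R :=
  \sum_j (if `[< first_in x j >] then d j x else 0).

Lemma first_in_ex x j : tet j x -> exists j0, first_in x j0.
Proof.
move=> jx.
have ex : exists n, [exists l : 'I_m, (l == n :> nat) && `[< tet l x >]].
  by exists j; apply/existsP; exists j; rewrite eqxx; apply/asboolP.
case: (ex_minnP ex) => n /existsP[l /andP[/eqP ln /asboolP lx]] nmin.
exists l; split => // l' l'l l'x.
suff : (n <= l')%N by rewrite leqNgt -ln l'l.
by apply: nmin; apply/existsP; exists l'; rewrite eqxx; apply/asboolP.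
Qed.

Lemma pw_first d x j : first_in x j -> pw d x = d j x.
Proof.
move=> [jx jm]; rewrite /pw (bigD1 j)//= (asboolT (conj jx jm : first_in x j)).
rewrite big1 ?addr0// => l lj; rewrite asboolF// => -[lx lm].
have := neq_ltn l j; rewrite (_ : (l != j :> nat) = true) => [|//].
by move=> /esym/orP[/jm//|/lm].
Qed.

Lemma pw_out d x : (forall j, ~ tet j x) -> pw d x = 0.
Proof. by move=> H; rewrite /pw big1// => j _; rewrite asboolF// => -[/H]. Qed.

Lemma measurable_first j : (forall j, measurable (tet j)) -> measurable [set x | first_in x j].
Proof.
move=> mt; rewrite (_ : mkset _ = tet j `&` \bigcap_(l in [set l : 'I_m | (l < j)%N]) ~` tet l).
  apply: measurableI => //; apply: fin_bigcap_measurable => [|l _].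
    exact: finite_finset.
  exact: measurableC.
by apply/seteqP; split => x.
Qed.

Lemma measurable_pw d : (forall j, measurable (tet j)) ->
  (forall j, measurable_fun [set: 'rV[R]_3] (d j)) -> measurable_fun [set: 'rV[R]_3] (pw d).
Proof.
move=> mt md; apply: measurable_sum => j.
rewrite (_ : (fun x => _) = (d j) \_ [set x | first_in x j]); last first.
  apply/funext => x; rewrite patchE.
  by case: asboolP => fx; case: ifPn => //; rewrite ?notin_setE ?inE.
by apply/(measurable_restrictT _ (measurable_first _ mt)); apply: measurable_funS (md j).
Qed.

End pieces.

(** * Green's formula in a coordinate direction *)

Section lines.
Context {R : realType}.

Lemma insD n (i : 'I_n.+1) (s t : R) (y : 'rV[R]_n) :
  ins i (t + s) y = t *: delta_mx 0 i + ins i s y.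
Proof.
apply/rowP => j; rewrite !mxE; case: (unliftP i j) => [j'|] ->.
  by rewrite ?liftK eq_sym (negPf (neq_lift _ _)) andbF mulr0 add0r.
by rewrite ?unlift_none !eqxx mulr1.
Qed.

Lemma ins_line n (i : 'I_n.+1) (s t : R) (y : 'rV[R]_n) :
  ins i t y = (t - s) *: delta_mx 0 i + ins i s y.
Proof. by rewrite -insD subrK. Qed.

Lemma ins_continuous n (i : 'I_n.+1) (y : 'rV[R]_n) : continuous (fun s : R => ins i s y).
Proof.
move=> s; apply: cvg_rV => j; rewrite mxE.
rewrite (_ : (fun x => _) = fun x => if unlift i j is Some j' then y 0 j' else x).
  by case: (unlift i j) => [j'|]; [exact: cvg_cst|exact: cvg_id].
by apply/funext => x; rewrite mxE.
Qed.

Lemma is_derive_ins n (i : 'I_n.+1) (f : 'rV[R]_n.+1 -> R) (s : R) (y : 'rV[R]_n) :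
  differentiable f (ins i s y) ->
  is_derive s 1 (fun t => f (ins i t y)) ('D_(delta_mx 0 i) f (ins i s y)).
Proof.
move=> df; have dv := diff_derivable (v := delta_mx 0 i) df.
have E : (fun h : R => h^-1 *: (((fun t => f (ins i t y)) \o shift s) (h *: (1 : R)) - f (ins i s y)))
    = (fun h : R => h^-1 *: ((f \o shift (ins i s y)) (h *: delta_mx 0 i) - f (ins i s y))).
  by apply/funext => h; rewrite /= -insD; have -> : h *: (1 : R) = h := mulr1 h.
apply: DeriveDef; first by rewrite /derivable E.
by rewrite /derive E.
Qed.

Lemma compact_bound (T : topologicalType) (S : set T) (f : T -> R) :
  compact S -> continuous f -> exists B, forall x, S x -> `|f x| <= B.
Proof.
move=> cS cf; have : compact (f @` S).
  by apply: continuous_compact => //; exact: continuous_subspaceT.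
move=> /compact_bounded[M [Mr HM]]; exists (M + 1) => x Sx.
by apply: (HM (M + 1)); [rewrite ltrDl|exists x].
Qed.

Lemma dot_ins (v : 'rV[R]_3) (i : 'I_3) s t y :
  dot v (ins i t y - ins i s y) = v 0 i * (t - s).
Proof.
rewrite (ins_line i s t) addrK dotZr mulrC; congr (_ * _).
rewrite /dot (bigD1 i)//= mxE !eqxx mulr1 big1 ?addr0// => j ji.
by rewrite mxE (negPf ji) andbF mulr0.
Qed.

End lines.

Section green.
Context {R : realType}.
Variables (K : polyhedron R) (c : 'rV[R]_3) (r : R).
Hypothesis r0 : 0 < r.
Hypothesis star : forall y, enorm (y - c) < r ->
  ph_body K y /\ forall x, ph_body K x -> seg y x `<=` ph_body K.
Hypothesis Kp : is_polyhedron K.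
Variable T : tet_mesh R.
Local Notation tets := (fun j => tet_set (@tm_tet R T j)).
Hypothesis nd : forall j, Defs.nondegenerate (@tm_tet R T j).
Hypothesis cov : ph_body K = \bigcup_j tets j.

Local Notation pt := (@bd_patch R K).
Local Notation pw := (@pw R (tm_size T) tets).

Lemma tets_body j x : tets j x -> ph_body K x.
Proof. by move=> jx; rewrite cov; exists j. Qed.

Lemma body_compact : compact (ph_body K). Proof. by case: Kp. Qed.

Lemma measurable_tets j : measurable (tets j).
Proof. by apply: measurable_hull; exact: nd. Qed.

Lemma body_measurable : measurable (ph_body K).
Proof.
rewrite -[ph_body K]setCK; apply: measurableC; apply: open_measurable_rV.
by apply: closed_openC; exact: body_closed.
Qed.

Lemma body_bounded : exists M, forall x : 'rV[R]_3, ph_body K x -> forall i, `|x 0 i| < M.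
Proof.
have /choice[B HB] : forall i : 'I_3, exists B, forall x, ph_body K x -> `|x 0 i| <= B.
  move=> i.
  by apply: compact_bound; [exact: body_compact|exact: coord_continuous].
exists (\sum_i `|B i| + 1) => x Kx i; apply: (le_lt_trans (HB i x Kx)).
rewrite (le_lt_trans (ler_norm _))// (bigD1 i)//= -addrA ltrDl.
by rewrite ltr_pwDr// sumr_ge0.
Qed.

Lemma pw_bounded d : (forall j, continuous (d j)) -> exists B, forall x, `|pw d x| <= B.
Proof.
move=> cd; have /choice[B HB] : forall j, exists B, forall x, ph_body K x -> `|d j x| <= B.
  move=> j.
  by apply: compact_bound; [exact: body_compact|exact: cd].
exists (\sum_j `|B j|) => x.
have [Kx|Kx] := pselect (ph_body K x).
  move: (Kx); rewrite cov => -[j _ jx].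
  have [j0 fj] := @first_in_ex R _ tets x j jx.
  rewrite (pw_first d fj) (le_trans (HB j0 _ Kx))// (le_trans (ler_norm _))//.
  by rewrite (bigD1 j0)//= lerDl sumr_ge0.
by rewrite pw_out ?normr0 ?sumr_ge0// => j /tets_body.
Qed.

Section line.
Variables (i : 'I_3) (y : 'rV[R]_2).
Hypothesis good : ~ @bad_line R K i y.

Definition face_mx f : 'M[R]_2 := col' i (frame (pt f)).
(** Intrinsic coordinates of the point over [y'] in the plane of the face. They are meaningful when
    [face_mx f] is invertible, which [crosses] demands. *)
Definition face_pt f (y' : 'rV[R]_2) : 'rV[R]_2 :=
  (y' - col' i (org (pt f))) *m invmx (face_mx f).
Definition cross_at f : R := emb (pt f) (face_pt f y) 0 i.
Definition crosses f : bool := (\det (face_mx f) != 0) && `[< dom (pt f) (face_pt f y) >].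
Definition outward (f : 'I_(ph_size K)) : bool := 0 < @nu R K c f 0 i.

Lemma det_cross f : cross (frame (pt f)) 0 i = (-1) ^+ i * \det (face_mx f).
Proof. by rewrite mxE. Qed.

Lemma ins_cross f : \det (face_mx f) != 0 ->
  ins i (cross_at f) y = emb (pt f) (face_pt f y).
Proof.
move=> d0; apply/rowP => j; rewrite mxE; case: unliftP => [j'|] -> //.
have : col' i (emb (pt f) (face_pt f y)) = y.
  rewrite col'_emb -/(face_mx f) /face_pt mulmxKV ?unitmxE ?unitfE//.
  by rewrite addrC subrK.
by move=> /rowP/(_ j') <-; rewrite mxE.
Qed.

(** A good line that meets the plane of a face cannot be parallel to it, so the projected frame is
    invertible and the point is determined. *)
Lemma cross_uniq f s t : ins i s y = emb (pt f) t ->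
  [/\ \det (face_mx f) != 0, t = face_pt f y & s = cross_at f].
Proof.
move=> st; have yE : y = col' i (emb (pt f) t).
  by rewrite -st; apply/rowP => j; rewrite !mxE liftK.
have d0 : \det (face_mx f) != 0.
  apply/eqP => d0; apply: good; left; exists f; split; last by exists t.
  by rewrite det_cross d0 mulr0.
have tE : t = face_pt f y.
  by rewrite yE col'_emb /face_pt addrC addKr mulmxK// unitmxE unitfE.
split => //; rewrite /cross_at -tE -st mxE unlift_none.
by [].
Qed.

(** A point of the region that is not interior lies on the boundary polygon, hence on an edge, and
    the line would be bad. *)
Lemma crosses_interior f : crosses f -> nbhs (face_pt f y) (dom (pt f)).
Proof.
move=> /andP[d0 /asboolP fy]; apply: contrapT => nfy; apply: good; right.
have [_ _ /(_ f)[_ [_ _ _ [cp cl] fr]] _ _] := Kp.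
have : pg_bdry (fc_poly (ph_face f)) (face_pt f y).
  by rewrite -fr; split => //; exact: subset_closure.
move=> [e _ se]; exists f, e, (face_pt f y); split => //.
rewrite -ins_cross//; apply/rowP => j; rewrite !mxE liftK.
by [].
Qed.

(** Distinct faces share only points of edges and vertices, which a good line avoids. *)
Lemma crosses_inj f g : crosses f -> crosses g -> cross_at f = cross_at g -> f = g.
Proof.
move=> /andP[df /asboolP ff] /andP[dg /asboolP fg] E; apply/eqP; apply: contrapT => /negP fg'.
have xf : fc_set (ph_face f) (ins i (cross_at f) y).
  by exists (face_pt f y) => //; rewrite ins_cross.
have xg : fc_set (ph_face g) (ins i (cross_at f) y).
  by rewrite E; exists (face_pt g y) => //; rewrite ins_cross.
have yE z : ins i (cross_at f) y = z -> y = col' i z.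
  by move=> <-; apply/rowP => j; rewrite !mxE liftK.
have [_ _ _ _ /(_ f g _ fg' xf xg)[[a [b [xa _]]]|[a [b [xa _]]]]] := Kp; apply: good; right.
  exists f, a, (@pg_vtx R (fc_poly (@ph_face R K f)) a); split; last exact: yE.
  by exists 0; [rewrite lexx ler01|rewrite scale0r addr0].
case: xa => s s01 xE; exists f, a.
exists (@pg_vtx R (fc_poly (@ph_face R K f)) a + s *: (pg_vtx (ordS a) - pg_vtx a)).
by split; [exists s|apply: yE; rewrite xE emb_seg].
Qed.

(** On the line, the linear form of [local_side] is [t - cross_at f] times the [i]-th component of
    [nu f], which is nonzero because the crossing is transversal and the height is nonzero. *)
Lemma near_crossing f : crosses f -> \forall t \near cross_at f,
  ph_body K (ins i t y) <-> if outward f then t <= cross_at f else cross_at f <= t.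
Proof.
move=> fy; have [d0 _] := andP fy; have fi := crosses_interior fy.
have h0 := height_neq0 r0 star Kp fi.
have nu0 : @nu R K c f 0 i != 0.
  by rewrite mxE mulf_neq0 ?sgr_eq0// det_cross mulf_neq0// expf_neq0 ?oppr_eq0 ?oner_eq0.
have := local_side r0 star Kp fi; rewrite -ins_cross// => ln.
have : \forall t \near cross_at f, ph_body K (ins i t y) <->
    dot (@nu R K c f) (ins i t y - ins i (cross_at f) y) <= 0.
  exact: (@ins_continuous R 2 i y (cross_at f) _ ln).
apply: filterS => t; rewrite dot_ins /outward => ->.
case: ltP nu0 => [p _|]; first by rewrite pmulr_rle0// subr_le0.
by rewrite le_eqVlt => /orP[/eqP-> /eqP//|n _]; rewrite nmulr_rle0// subr_ge0.
Qed.

End line.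
End green.

Section green_identity.
Context {R : realType}.
Variables (K : polyhedron R) (c : 'rV[R]_3) (r : R).
Hypothesis r0 : 0 < r.
Hypothesis star : forall y, enorm (y - c) < r ->
  ph_body K y /\ forall x, ph_body K x -> seg y x `<=` ph_body K.
Hypothesis Kp : is_polyhedron K.
Variable T : tet_mesh R.
Local Notation tets := (fun j => tet_set (@tm_tet R T j)).
Hypothesis nd : forall j, Defs.nondegenerate (@tm_tet R T j).
Hypothesis cov : ph_body K = \bigcup_j tets j.

Local Notation pt := (@bd_patch R K).
Local Notation pw := (@pw R (tm_size T) tets).
Local Notation mu := (@lebesgue_measure R).

Variables (u : 'rV[R]_3 -> R) (uj : 'I_(tm_size T) -> 'rV[R]_3 -> R).
Hypothesis C1u : forall j, C1 (uj j).
Hypothesis uE : forall j x, tets j x -> u x = uj j x.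
Hypothesis cu : {within ph_body K, continuous u}.
Variable i : 'I_3.

Let d j := fun x => grad (uj j) x 0 i.

Let cd j : continuous (d j). Proof. by have [_] := C1u j; apply. Qed.

Lemma measurable_pw_d : measurable_fun [set: 'rV[R]_3] (pw d).
Proof.
apply: measurable_pw => j; first exact: measurable_tets.
exact: continuous_measurable_rV.
Qed.

Let mE t (y : 'rV[R]_2) j l :
  let a := bary (@tm_tet R T j) (ins i 0 y) 0 l in
  bary (@tm_tet R T j) (ins i t y) 0 l =
  a + t * (bary (@tm_tet R T j) (ins i 1 y) 0 l - a).
Proof.
move=> a; rewrite /a (ins_line i 0 t) (ins_line i 0 1) !bary_affine !mulmxDl -!scalemxAl !subr0.
by rewrite scale1r !mxE; ring.
Qed.

(* The parameters at which the line crosses a face of K or the plane of a facet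
   of the mesh. *)
Let excl (y : 'rV[R]_2) : seq R :=
  [seq cross_at i y f | f : 'I_(ph_size K)] ++
  [seq let a := bary (@tm_tet R T p.1) (ins i 0 y) 0 p.2 in
       - a / (bary (@tm_tet R T p.1) (ins i 1 y) 0 p.2 - a) | p : 'I_(tm_size T) * 'I_4].

Let tets_locally_const (y : 'rV[R]_2) s j : s \notin excl y ->
  \forall t \near s, tets j (ins i t y) <-> tets j (ins i s y).
Proof.
move=> sE.
have : \forall t \near s, forall l : 'I_4,
    (0 <= bary (@tm_tet R T j) (ins i t y) 0 l) = (0 <= bary (@tm_tet R T j) (ins i s y) 0 l).
  apply: (@filter_forall R 'I_4 (fun l t => (0 <= bary (@tm_tet R T j) (ins i t y) 0 l) =
    (0 <= bary (@tm_tet R T j) (ins i s y) 0 l)) (nbhs s) _) => l.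
  set a := bary (@tm_tet R T j) (ins i 0 y) 0 l.
  set b := bary (@tm_tet R T j) (ins i 1 y) 0 l - a.
  have bE t : bary (@tm_tet R T j) (ins i t y) 0 l = a + t * b by exact: mE.
  (* On a line parallel to the facet the coordinate is constant, and the division by zero merely
     puts a harmless parameter into [excl]. Otherwise its only zero is in [excl]. *)
  have [b0|b0] := eqVneq b 0.
    by apply: nearW => t; rewrite !bE b0 !mulr0.
  have abs : a + s * b != 0.
    apply: contra sE => /eqP abs; rewrite mem_cat; apply/orP; right.
    apply/mapP; exists (j, l); first by rewrite mem_enum.
    rewrite /= -/a -/b; apply: (mulIf b0); rewrite divfK//.
    by apply/eqP; rewrite -addr_eq0 addrC abs.
  have cab : (a + t * b) @[t --> s] --> a + s * b.
    by apply: cvgD; [exact: cvg_cst|apply: cvgM; [exact: cvg_id|exact: cvg_cst]].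
  have e0 : 0 < `|a + s * b| by rewrite normr_gt0.
  have /cvgrPdist_lt/(_ _ e0) := cab.
  apply: filterS => t; rewrite !bE; move: abs; rewrite neq_lt => /orP[n|p].
    rewrite (ltr0_norm n) ltr_norml => /andP[H1 H2].
    by rewrite !leNgt n; congr (~~ _); lra.
  rewrite (gtr0_norm p) ltr_norml => /andP[H1 H2].
  by rewrite !ltW//; lra.
apply: filterS => t H; rewrite !tet_setE//=; split => bx l; have := bx l; by rewrite H.
Qed.

(** Off [excl] membership in each tetrahedron is locally constant, hence so is the selected piece,
    and along the line the functions are as regular as that piece. *)
Let pw_locally (y : 'rV[R]_2) s : s \notin excl y ->
  (exists j0, tets j0 (ins i s y) /\ \forall t \near s, first_in tets (ins i t y) j0) \/
  (~ ph_body K (ins i s y) /\ \forall t \near s, ~ ph_body K (ins i t y)).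
Proof.
move=> sE.
have H : \forall t \near s, forall j, tets j (ins i t y) <-> tets j (ins i s y).
  apply: (@filter_forall R 'I_(tm_size T) (fun j t =>
    tets j (ins i t y) <-> tets j (ins i s y)) (nbhs s) _) => j.
  exact: tets_locally_const.
have [Ks|Ks] := pselect (ph_body K (ins i s y)); [left|right].
  move: Ks; rewrite cov => -[j _ jx].
  have [j0 [j0x fm]] := @first_in_ex R _ tets _ j jx.
  exists j0; split => //; apply: filterS H => t Ht.
  by split => [|l lj]; [apply/Ht|move=> /Ht; exact: fm].
split => //; apply: filterS H => t Ht; rewrite cov => -[j _ /Ht jx].
by apply: Ks; rewrite cov; exists j.
Qed.

Lemma line_integral (y : 'rV[R]_2) : ~ @bad_line R K i y ->
  \int[mu]_s pw d (ins i s y) =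
  \sum_(f | crosses i y f) (if @outward R K c i f then 1 else -1) *
    u (emb (pt f) (face_pt i f y)).
Proof.
move=> good.
have [M HM] := body_bounded Kp.
have [B HB] := @pw_bounded R K Kp T cov d cd.
have HD := @integral_crossing R (ph_size K) (crosses i y) (cross_at i y) (@outward R K c i)
  [set s | ph_body K (ins i s y)] (fun s => u (ins i s y)) (fun s => pw d (ins i s y))
  (excl y) M.
apply: etrans; first apply: HD.
- move=> s Ks; have oK : open (~` ph_body K) by apply: closed_openC; exact: body_closed.
  exact: (@ins_continuous R 2 i y s _ (open_nbhs_nbhs (conj oK Ks))).
- move=> s Ks; have := HM _ Ks i; rewrite mxE unlift_none.
  by [].
- move=> s Ks e e0.
  have /subspace_continuousP/(_ _ Ks)/cvgrPdist_lt/(_ _ e0) := cu.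
  rewrite near_withinE => un.
  have un' : \forall t \near s, ph_body K (ins i t y) -> `|u (ins i s y) - u (ins i t y)| < e.
    exact: (@ins_continuous R 2 i y s _ un).
  apply: filterS un' => t ut Kt.
  by rewrite distrC; exact: ut.
- by move=> f g fy gy; exact: (crosses_inj Kp good fy gy).
- move=> s Ks nc.
  (* A point of [K] that is not interior is on the frontier, so on a face; on a good line it is a
     crossing, contrary to [nc]. *)
  have : nbhs (ins i s y) (ph_body K).
    apply: contrapT => nK.
    have [_ _ _ fr _] := Kp.
    have : frontier (ph_body K) (ins i s y) by split => //; exact: subset_closure.
    rewrite fr => -[f _ [t ft tE]].
    have [d0 tE' sE] := cross_uniq good (esym tE).
    have : crosses i y f by rewrite /crosses d0 -tE'; apply/asboolP.
    by move=> /nc; rewrite -sE eqxx.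
  by move=> nK; exact: (@ins_continuous R 2 i y s _ nK).
- move=> f /andP[d0 /asboolP fy] /=; rewrite ins_cross//.
  by have [] := face_frontier Kp fy.
- by move=> f fy; exact: (near_crossing r0 star Kp good fy).
- by move=> f _; rewrite mem_cat; apply/orP; left; apply/mapP; exists f; rewrite ?mem_enum.
- move=> s sE Ks; have [[j0 [jx fn]]|[]//] := pw_locally sE.
  rewrite (pw_first _ (nbhs_singleton fn)) /d mxE.
  apply: (near_eq_is_derive (f := fun t => uj j0 (ins i t y))).
    by apply: filterS fn => t [jt _]; rewrite (uE jt).
  by apply: is_derive_ins; have [] := C1u j0.
- by move=> s Ks; rewrite pw_out// => j jx; apply: Ks; rewrite /= cov; exists j.
- move=> s sE; have [[j0 [jx fn]]|[Ks Kn]] := pw_locally sE.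
    have cdi : {for s, continuous (fun t => d j0 (ins i t y))}.
      by apply: continuous_comp; [exact: ins_continuous|exact: cd].
    rewrite /prop_for /continuous_at (pw_first _ (nbhs_singleton fn)).
    apply: cvg_trans cdi; apply: near_eq_cvg.
    by apply: filterS fn => t ft; rewrite (pw_first d ft).
  rewrite /prop_for /continuous_at.
  have p0 t : ~ ph_body K (ins i t y) -> pw d (ins i t y) = 0.
    by move=> Kt; rewrite pw_out// => j jx; apply: Kt; rewrite cov; exists j.
  rewrite p0//; apply: cvg_near_cst.
  by apply: filterS Kn => t Kt; rewrite p0.
- move=> a b; apply: measurable_bounded_integrable => //.
  + have := @lebesgue_measure_itv R `[a, b]; rewrite /= => ->.
    by case: ifPn => // _; rewrite -EFinD ltry.
  + apply: (@measurable_funS _ _ _ _ setT) => //.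
    apply: (measurableT_comp measurable_pw_d).
    exact: (measurable_fun_pair1 (T1 := measurableTypeR R) y (measurable_ins i)).
  + exists B; split; first exact: num_real.
    by move=> B' BB' s _ /=; rewrite (le_trans (HB _))// ltW.
- apply: eq_bigr => f /andP[df _]; congr (_ * u _).
  exact: ins_cross.
Qed.

End green_identity.

Section compact_sets.
Context {R : realType}.

Lemma compact_measurable_rV n (S : set 'rV[R]_n) : compact S -> measurable S.
Proof.
move=> cS; rewrite -[S]setCK; apply: measurableC; apply: open_measurable_rV.
by apply: closed_openC; apply: compact_closed cS; exact: norm_hausdorff.
Qed.

Lemma compact_coord_bound n (S : set 'rV[R]_n) : compact S ->
  exists M, forall x : 'rV[R]_n, S x -> forall i, `|x 0 i| <= M.
Proof.
move=> cS; have /choice[B HB] : forall i : 'I_n, exists B, forall x, S x -> `|x 0 i| <= B.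
  by move=> i; apply: compact_bound => //; exact: coord_continuous.
exists (\sum_i `|B i|) => x Sx i; apply: (le_trans (HB i x Sx)).
by rewrite (le_trans (ler_norm _))// (bigD1 i)//= lerDl sumr_ge0.
Qed.

Lemma compact_finite_leb n (S : set 'rV[R]_n) : compact S -> (leb n S < +oo)%E.
Proof.
move=> cS; have [M HM] := compact_coord_bound cS.
apply: le_lt_trans (leb_box n M); apply: le_measure; rewrite ?inE.
- exact: compact_measurable_rV.
- rewrite (_ : mkset _ = \bigcap_(i in [set: 'I_n])
      ((fun x : 'rV[R]_n => x 0 i) @^-1` [set r | `|r| <= M])); last first.
    by apply/seteqP; split => x /= H i; [move=> _|]; exact: H.
  apply: fin_bigcap_measurable => // i _.
  rewrite -[X in measurable X]setTI; apply: measurable_coord => //.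
  rewrite (_ : mkset _ = `[(- M), M]%classic)//.
  by apply/seteqP; split => r /=; rewrite in_itv/= ler_norml.
- by move=> x Sx i; exact: HM.
Qed.

Lemma bounded_integrable n (S : set 'rV[R]_n) (f : 'rV[R]_n -> R) (B : R) :
  compact S -> measurable_fun S f -> (forall x, S x -> `|f x| <= B) ->
  (leb n).-integrable S (EFin \o f).
Proof.
move=> cS mf fB; apply: measurable_bounded_integrable => //.
- exact: compact_measurable_rV.
- exact: compact_finite_leb.
exists B; split; first exact: num_real.
by move=> B' BB' x Sx /=; rewrite (le_trans (fB x Sx))// ltW.
Qed.

Lemma measurable_leb_slice n (i : 'I_n.+1) (F : 'rV[R]_n.+1 -> \bar R) :
  measurable_fun [set: 'rV[R]_n.+1] F ->
  measurable_fun [set: 'rV[R]_n] (fun y => \int[@lebesgue_measure R]_s F (ins i s y))%E.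
Proof.
move=> mF.
have aux (G : 'rV[R]_n.+1 -> \bar R) : measurable_fun [set: 'rV[R]_n.+1] G ->
    (forall x, 0 <= G x)%E -> measurable_fun [set: 'rV[R]_n]
      (fun y => \int[@lebesgue_measure R]_s G (ins i s y))%E.
  move=> mG G0.
  have mGi : measurable_fun setT
      (fun p : measurableTypeR R * 'rV[R]_n => G (ins i p.1 p.2)).
    exact: (measurableT_comp mG (measurable_ins i)).
  exact: (@measurable_fun_fubini_tonelli_G _ _ _ _ _ (@lebesgue_measure R) _ mGi (fun=> G0 _)).
rewrite (_ : (fun y => _) = (fun y => \int[@lebesgue_measure R]_s F^\+ (ins i s y) -
    \int[@lebesgue_measure R]_s F^\- (ins i s y))%E); last first.
  apply/funext => y; rewrite integralE.
  by congr (_ - _)%E; apply: eq_integral => s _; rewrite !(funeposE, funenegE).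
apply: emeasurable_funB; apply: aux => //.
  exact: measurable_funepos.
exact: measurable_funeneg.
Qed.

End compact_sets.

Section green_dir.
Context {R : realType}.
Variables (K : polyhedron R) (c : 'rV[R]_3) (r : R).
Hypothesis r0 : 0 < r.
Hypothesis star : forall y, enorm (y - c) < r ->
  ph_body K y /\ forall x, ph_body K x -> seg y x `<=` ph_body K.
Hypothesis Kp : is_polyhedron K.
Variable T : tet_mesh R.
Local Notation tets := (fun j => tet_set (@tm_tet R T j)).
Hypothesis nd : forall j, Defs.nondegenerate (@tm_tet R T j).
Hypothesis cov : ph_body K = \bigcup_j tets j.

Local Notation pt := (@bd_patch R K).
Local Notation pw := (@pw R (tm_size T) tets).
Local Notation mu := (@lebesgue_measure R).

Lemma face_compact f : compact (dom (pt f)).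
Proof. by have [_ _ /(_ f)[_ [_ _ _ []]]] := Kp. Qed.

Lemma pw_outside (d : 'I_(tm_size T) -> 'rV[R]_3 -> R) x : ~ ph_body K x -> pw d x = 0.
Proof. by move=> Kx; rewrite pw_out// => j jx; apply: Kx; rewrite cov; exists j. Qed.

Lemma pw_eq (u : 'rV[R]_3 -> R) (d : 'I_(tm_size T) -> 'rV[R]_3 -> R) x :
  (forall j, tets j x -> u x = d j x) -> ph_body K x -> pw d x = u x.
Proof.
move=> ud; rewrite cov => -[j _ jx].
have [j0 fj] := @first_in_ex R _ tets x j jx.
by rewrite (pw_first d fj) (ud j0)//; case: fj.
Qed.

Lemma pw_integrable (d : 'I_(tm_size T) -> 'rV[R]_3 -> R) : (forall j, continuous (d j)) ->
  (leb 3).-integrable setT (EFin \o pw d).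
Proof.
move=> cd; have [B HB] := pw_bounded Kp cov cd.
have mp : measurable_fun [set: 'rV[R]_3] (pw d).
  apply: measurable_pw => j; first exact: measurable_tets.
  exact: continuous_measurable_rV.
rewrite (_ : EFin \o pw d = (EFin \o pw d) \_ (ph_body K)); last first.
  apply/funext => x; rewrite patchE; case: ifPn => //; rewrite notin_setE => Kx /=.
  by rewrite pw_outside.
apply/(integrable_mkcond _ (body_measurable Kp)).
apply: (bounded_integrable (B := B)) => //; first exact: body_compact.
exact: measurable_funS mp.
Qed.

Lemma face_pw_integrable (d : 'I_(tm_size T) -> 'rV[R]_3 -> R) f : (forall j, continuous (d j)) ->
  (leb 2).-integrable (dom (pt f)) (EFin \o (pw d \o emb (pt f))).
Proof.
move=> cd; have [B HB] := pw_bounded Kp cov cd.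
apply: (bounded_integrable (B := B)) => [||t _]; [exact: face_compact| |exact: HB].
apply: (@measurable_funS _ _ _ _ setT) => //.
have mp : measurable_fun [set: 'rV[R]_3] (pw d).
  apply: measurable_pw => j; first exact: measurable_tets.
  exact: continuous_measurable_rV.
apply: (measurableT_comp mp).
rewrite (_ : emb (pt f) = fun t => t *m frame (pt f) + org (pt f)).
  exact: measurable_affine.
by apply/funext => t; rewrite /emb addrC.
Qed.

Variables (u : 'rV[R]_3 -> R) (uj : 'I_(tm_size T) -> 'rV[R]_3 -> R).
Hypothesis C1u : forall j, C1 (uj j).
Hypothesis uE : forall j x, tets j x -> u x = uj j x.
Hypothesis cu : {within ph_body K, continuous u}.
Variable i : 'I_3.

Let d j := fun x => grad (uj j) x 0 i.

Let cd j : continuous (d j). Proof. by have [_] := C1u j; apply. Qed.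

Let cuj j : continuous (uj j).
Proof. by move=> x; apply: differentiable_continuous; have [] := C1u j. Qed.

(** Built from [pw uj], measurable on the whole space, and not from [u], about which nothing is
    known off [K]; the two agree on the face. *)
Let h f : 'rV[R]_2 -> R := (pw uj \o emb (pt f)) \_ (dom (pt f)).

Let hE f t : h f t = if `[< dom (pt f) t >] then u (emb (pt f) t) else 0.
Proof.
rewrite /h patchE; case: asboolP => ft; case: ifPn => //; rewrite ?notin_setE ?inE//.
move=> _ /=; apply: pw_eq => [j|]; first exact: uE.
by have [] := face_frontier Kp ft.
Qed.

Let ih f : (leb 2).-integrable setT (EFin \o h f).
Proof.
rewrite (_ : EFin \o h f = (EFin \o (pw uj \o emb (pt f))) \_ (dom (pt f))).
  have mD := compact_measurable_rV (@face_compact f).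
  exact: (iffLR (integrable_mkcond _ mD) (face_pw_integrable f cuj)).
by apply/funext => t; rewrite /h /= !patchE; case: ifP.
Qed.

Let sgn f : R := if @outward R K c i f then 1 else -1.

(** The share of the face in the integral along the line over [y], defined for every [y] so that it
    can be integrated. *)
Let H f (y : 'rV[R]_2) : \bar R :=
  if \det (face_mx i f) == 0 then 0%E else ((sgn f)%:E * (h f (face_pt i f y))%:E)%E.

Let face_ptE f y : face_pt i f y = y *m invmx (face_mx i f) + (- col' i (org (pt f)) *m invmx (face_mx i f)).
Proof. by rewrite /face_pt mulmxDl. Qed.

Let iH f : (leb 2).-integrable setT (H f).
Proof.
rewrite /H; case: eqP => [_|/eqP d0]; first exact: integrable0.
apply: integrableZl => //.
rewrite (_ : (fun y => _) = fun y => (EFin \o h f) (y *m invmx (face_mx i f) +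
    (- col' i (org (pt f)) *m invmx (face_mx i f)))).
  by apply: integrable_leb2_affine => //; rewrite det_inv invr_eq0.
by apply/funext => y; rewrite face_ptE.
Qed.

(** By [height_neq0] such a face has no interior point, and its region is the closure of its
    interior. This settles the value 0 of the sign in [nu]. *)
Let height0_dom f : height c f = 0 -> dom (pt f) = set0.
Proof.
move=> h0; have [_ _ /(_ f)[_ [_ _ _ [_ cl] _]] _ _] := Kp.
rewrite /= -cl (_ : interior _ = set0) ?closure0//.
apply/seteqP; split => // t ft.
by have := height_neq0 r0 star Kp (ft : nbhs t (dom (pt f))); rewrite h0 eqxx.
Qed.

(** Change of variables from the projection to intrinsic coordinates: the Jacobian is the absolute
    value of the [i]-th component of [nu f], and the sign of the crossing restores the component
    itself. *)
Let integral_H f : (\int[leb 2]_y H f y = (@nu R K c f 0 i *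
  \int[leb 2]_(t in dom (pt f)) u (emb (pt f) t))%:E)%E.
Proof.
rewrite /H; case: eqP => [d0|/eqP d0].
  by rewrite integral0 mxE det_cross d0 mulr0 mulr0 mul0r.
have hR : (\int[leb 2]_t (h f t)%:E = (\int[leb 2]_(t in dom (pt f)) u (emb (pt f) t))%:E)%E.
  rewrite -[LHS]fineK; last exact: (integrable_fin_num measurableT (ih f)).
  congr EFin; rewrite [RHS]Rintegral_mkcond; apply: eq_Rintegral => t _.
  rewrite hE patchE; case: asboolP => ft; case: ifPn => //; by rewrite ?notin_setE ?inE.
rewrite integralZl//; last first.
  rewrite (_ : (fun y => _) = fun y => (EFin \o h f) (y *m invmx (face_mx i f) +
      (- col' i (org (pt f)) *m invmx (face_mx i f)))).
    by apply: integrable_leb2_affine => //; rewrite det_inv invr_eq0.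
  by apply/funext => y; rewrite face_ptE.
rewrite (eq_integral (fun y => (EFin \o h f) (y *m invmx (face_mx i f) +
      (- col' i (org (pt f)) *m invmx (face_mx i f))))); last first.
  by move=> y _; rewrite face_ptE.
rewrite integral_leb2_affine//; last by rewrite det_inv invr_eq0.
rewrite hR -!EFinM; congr EFin.
have [h0|h0] := eqVneq (height c f) 0.
  by rewrite height0_dom// Rintegral_set0 !mulr0.
rewrite mulrA det_inv normfV invrK; congr (_ * _).
have : `|@nu R K c f 0 i| = `|\det (face_mx i f)|.
  by rewrite mxE det_cross !normrM normr_sg h0 mul1r normrX normrN1 expr1n mul1r.
move=> <-; rewrite /sgn /outward; case: ltP => [p|n].
  by rewrite gtr0_norm// mul1r.
by rewrite ler0_norm// mulN1r opprK.
Qed.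

Lemma green_dir :
  \int[leb 3]_(x in ph_body K) pw d x =
  \sum_f @nu R K c f 0 i * \int[leb 2]_(t in dom (pt f)) u (emb (pt f) t).
Proof.
have ip := pw_integrable cd.
have [B HB] := pw_bounded Kp cov cd.
have [M HM] := body_bounded Kp.
have mp : measurable_fun [set: 'rV[R]_3] (pw d) by apply: measurable_pw_d.
have -> : \int[leb 3]_(x in ph_body K) pw d x = \int[leb 3]_x pw d x.
  rewrite Rintegral_mkcond; apply: eq_Rintegral => x _; rewrite patchE.
  by case: ifPn => //; rewrite notin_setE => Kx; rewrite pw_outside.
apply: EFin_inj; rewrite /Rintegral fineK; last exact: integrable_fin_num ip.
rewrite (integral_leb_ins i ip) /=.
rewrite -sumEFin (eq_bigr _ (fun f _ => esym (integral_H f))).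
rewrite -integral_sum//.
apply: ae_eq_integral => //.
- exact: (measurable_leb_slice i (F := EFin \o pw d) (measurable_int _ ip)).
- by apply: emeasurable_sum => f; exact: (measurable_int _ (iH f)).
have [N [mN N0 sub]] := @bad_line_negligible R K i.
exists N; split => // y /= H1; apply: sub.
apply: contrapT => good; apply: H1 => _.
(* The integrand along the line is bounded and vanishes off [[-M, M]], so the extended integral is
   finite and the real-valued [line_integral] applies. *)
rewrite -[LHS]fineK; last first.
  apply: integrable_fin_num => //.
  rewrite (_ : (fun s => _) =
      (EFin \o (fun s : measurableTypeR R => pw d (ins i s y))) \_ `[(- M), M]%classic).
    have mI : measurable (`[(- M), M]%classic : set (measurableTypeR R)) by exact: measurable_itv.
    apply: (iffLR (integrable_mkcond _ mI)); apply: measurable_bounded_integrable => //.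
    + have := @lebesgue_measure_itv R `[(- M), M]; rewrite /= => ->.
      by case: ifPn => // _; rewrite -EFinD ltry.
    + apply: (@measurable_funS _ _ _ _ setT) => //.
      apply: (measurableT_comp mp).
      exact: (measurable_fun_pair1 (T1 := measurableTypeR R) y (measurable_ins i)).
    + exists B; split; first exact: num_real.
      by move=> B' BB' s _ /=; rewrite (le_trans (HB _))// ltW.
  apply/funext => s; rewrite patchE; case: ifPn => //.
  rewrite notin_setE /= in_itv/= -ler_norml => sM.
  rewrite pw_outside// => /HM/(_ i); rewrite mxE unlift_none => /ltW.
  exact: sM.
have := line_integral r0 star Kp nd cov C1u uE cu good.
rewrite /Rintegral => -> ; rewrite big_mkcond -sumEFin; apply: eq_bigr => f _.
rewrite /H /crosses hE; case: eqP => //= d0.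
by case: asboolP => fy; rewrite ?mule0.
Qed.

End green_dir.

(** * Polynomials and L^2 projections *)

Section smooth.
Context {R : realType}.

Lemma gradE n (f : 'rV[R]_n -> R) x i : grad f x 0 i = 'D_(delta_mx 0 i) f x.
Proof. by rewrite mxE. Qed.

Lemma C1_derivable n (f : 'rV[R]_n -> R) x v : C1 f -> derivable f x v.
Proof. by move=> [df _]; apply: diff_derivable. Qed.

Lemma C1_continuous n (f : 'rV[R]_n -> R) : C1 f -> continuous f.
Proof. by move=> [df _] x; apply: differentiable_continuous. Qed.

Lemma grad_cst n (c : R) x i : grad (fun _ : 'rV[R]_n => c) x 0 i = 0.
Proof. by rewrite gradE derive_cst. Qed.

Lemma C1_cst n (c : R) : C1 (fun _ : 'rV[R]_n => c).
Proof.
split => [x|i]; first exact: differentiable_cst.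
rewrite (_ : (fun x => grad _ x 0 i) = fun=> 0); first exact: cst_continuous.
by apply/funext => x; exact: grad_cst.
Qed.

Lemma gradD n (f g : 'rV[R]_n -> R) x i : C1 f -> C1 g ->
  grad (fun x => f x + g x) x 0 i = grad f x 0 i + grad g x 0 i.
Proof.
move=> cf cg; rewrite !gradE.
by rewrite -(deriveD (@C1_derivable n f x _ cf) (@C1_derivable n g x _ cg)).
Qed.

Lemma C1D n (f g : 'rV[R]_n -> R) : C1 f -> C1 g -> C1 (fun x => f x + g x).
Proof.
move=> cf cg; split => [x|i]; first by apply: differentiableD; [exact: cf.1|exact: cg.1].
rewrite (_ : (fun x => grad _ x 0 i) = fun x => grad f x 0 i + grad g x 0 i).
  move=> x; apply: (@cvgD R R _ (nbhs x) (nbhs_filter x)).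
    exact: (cf.2 i x).
  exact: (cg.2 i x).
by apply/funext => x; rewrite gradD.
Qed.

Lemma gradM n (f g : 'rV[R]_n -> R) x i : C1 f -> C1 g ->
  grad (fun x => f x * g x) x 0 i = f x * grad g x 0 i + g x * grad f x 0 i.
Proof.
move=> cf cg; rewrite !gradE.
by rewrite (deriveM (@C1_derivable n f x _ cf) (@C1_derivable n g x _ cg)).
Qed.

Lemma C1M n (f g : 'rV[R]_n -> R) : C1 f -> C1 g -> C1 (fun x => f x * g x).
Proof.
move=> cf cg; split => [x|i]; first by apply: differentiableM; [exact: cf.1|exact: cg.1].
rewrite (_ : (fun x => grad _ x 0 i) = fun x => f x * grad g x 0 i + g x * grad f x 0 i).
  move=> x; apply: (@cvgD R R _ (nbhs x) (nbhs_filter x)).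
    apply: (@cvgM R _ (nbhs x) (nbhs_filter x) f); last exact: (cg.2 i x).
    by apply: C1_continuous.
  apply: (@cvgM R _ (nbhs x) (nbhs_filter x) g); last exact: (cf.2 i x).
  by apply: C1_continuous.
by apply/funext => x; rewrite gradM.
Qed.

Lemma grad_coord n (j : 'I_n) (x : 'rV[R]_n) i :
  grad (fun x : 'rV[R]_n => x 0 j) x 0 i = (j == i)%:R.
Proof.
rewrite gradE /derive; apply: cvg_lim => //; apply: cvg_near_cst.
near=> h; have h0 : h != 0 by near: h; exact: nbhs_dnbhs_neq.
rewrite /= !mxE eqxx /= addrK; have -> : forall a b : R, a *: b = a * b by [].
by rewrite mulKf.
Unshelve. all: by end_near. Qed.

Lemma C1_coord n (j : 'I_n) : C1 (fun x : 'rV[R]_n => x 0 j).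
Proof.
split => [x|i]; first exact: differentiable_coord.
rewrite (_ : (fun x => grad _ x 0 i) = fun=> (j == i)%:R); first exact: cst_continuous.
by apply/funext => x; exact: grad_coord.
Qed.

(** Degree at most [k] by generation and not by coefficients: closure under affine substitution and
    differentiation becomes an induction. [Pol_polyf] and [polyf_Pol] identify it with [Pol k]. *)
Inductive polyf n : nat -> ('rV[R]_n -> R) -> Prop :=
| polyf_cst c : polyf 0 (fun=> c)
| polyf_coord i : polyf 1 (fun x => x 0 i)
| polyf_add k f g : polyf k f -> polyf k g -> polyf k (fun x => f x + g x)
| polyf_mul k l f g : polyf k f -> polyf l g -> polyf (k + l) (fun x => f x * g x)
| polyf_le k l f : (k <= l)%N -> polyf k f -> polyf l f.

Lemma polyf_cst_le n k c : polyf k (fun _ : 'rV[R]_n => c).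
Proof. by apply: (@polyf_le n 0 k) => //; exact: polyf_cst. Qed.

Lemma polyf_scale n k c (f : 'rV[R]_n -> R) : polyf k f -> polyf k (fun x => c * f x).
Proof. by move=> pf; rewrite -[k]add0n; apply: polyf_mul => //; exact: polyf_cst. Qed.

Lemma polyf_sum n k (I : Type) (r : seq I) (P : pred I) (F : I -> 'rV[R]_n -> R) :
  (forall i, P i -> polyf k (F i)) -> polyf k (fun x => \sum_(i <- r | P i) F i x).
Proof.
move=> pF; elim: r => [|i r IH].
  rewrite (_ : (fun x => _) = fun=> 0); first exact: polyf_cst_le.
  by apply/funext => x; rewrite big_nil.
case Pi: (P i); last first.
  rewrite (_ : (fun x => _) = fun x => \sum_(i <- r | P i) F i x)//.
  by apply/funext => x; rewrite big_cons Pi.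
rewrite (_ : (fun x => _) = fun x => F i x + \sum_(i <- r | P i) F i x).
  by apply: polyf_add => //; exact: pF.
by apply/funext => x; rewrite big_cons Pi.
Qed.

Lemma polyf_prod n (I : Type) (r : seq I) (P : pred I) (d : I -> nat) (F : I -> 'rV[R]_n -> R) :
  (forall i, P i -> polyf (d i) (F i)) ->
  polyf (\sum_(i <- r | P i) d i) (fun x => \prod_(i <- r | P i) F i x).
Proof.
move=> pF; elim: r => [|i r IH].
  rewrite (_ : (fun x => _) = fun=> 1); first exact: polyf_cst_le.
  by apply/funext => x; rewrite big_nil.
case Pi: (P i); last first.
  rewrite (_ : (fun x => _) = fun x => \prod_(i <- r | P i) F i x) ?big_cons ?Pi//.
  by apply/funext => x; rewrite big_cons Pi.
rewrite (_ : (fun x => _) = fun x => F i x * \prod_(i <- r | P i) F i x) ?big_cons ?Pi//.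
  by apply: polyf_mul => //; exact: pF.
by apply/funext => x; rewrite big_cons Pi.
Qed.

Lemma polyf_exp n k d (f : 'rV[R]_n -> R) : polyf d f -> polyf (k * d) (fun x => f x ^+ k).
Proof.
move=> pf; elim: k => [|k IH].
  by rewrite mul0n (_ : (fun x => _) = fun=> 1)//; exact: polyf_cst.
rewrite mulSn (_ : (fun x => _) = fun x => f x * f x ^+ k); first exact: polyf_mul.
by apply/funext => x; rewrite exprS.
Qed.

Lemma polyf_affine m n (A : 'M[R]_(m, n)) (a : 'rV[R]_n) j :
  polyf 1 (fun x : 'rV[R]_m => (x *m A + a) 0 j).
Proof.
have -> : (fun x : 'rV[R]_m => (x *m A + a) 0 j) = fun x => (\sum_i A i j * x 0 i) + a 0 j.
  by apply/funext => x; rewrite !mxE; congr (_ + _); apply: eq_bigr => i _; rewrite mulrC.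
apply: polyf_add; last exact: polyf_cst_le.
by apply: polyf_sum => i _; apply: polyf_scale; exact: polyf_coord.
Qed.

Lemma polyf_comp m n k (f : 'rV[R]_n -> R) (A : 'M[R]_(m, n)) (a : 'rV[R]_n) :
  polyf k f -> polyf k (fun x => f (x *m A + a)).
Proof.
elim=> {k f} [c|i|k f g _ IHf _ IHg|k l f g _ IHf _ IHg|k l f kl _ IHf].
- exact: polyf_cst.
- exact: polyf_affine.
- exact: polyf_add.
- exact: polyf_mul.
- exact: polyf_le kl IHf.
Qed.

Lemma polyf_C1 n k (f : 'rV[R]_n -> R) : polyf k f -> C1 f.
Proof.
elim=> {k f} [c|i|k f g _ IHf _ IHg|k l f g _ IHf _ IHg|k l f kl _ IHf].
- exact: C1_cst.
- exact: C1_coord.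
- exact: C1D.
- exact: C1M.
- exact: IHf.
Qed.

(** The bound [k] is kept, not lowered: the moments of degree [k] absorb the gradient of q and its
    derivatives as they are. *)
Lemma polyf_grad n k (f : 'rV[R]_n -> R) i : polyf k f -> polyf k (fun x => grad f x 0 i).
Proof.
elim=> {k f} [c|j|k f g pf IHf pg IHg|k l f g pf IHf pg IHg|k l f kl _ IHf].
- rewrite (_ : (fun x => grad _ x 0 i) = fun=> 0); first exact: polyf_cst.
  by apply/funext => x; exact: grad_cst.
- rewrite (_ : (fun x => grad _ x 0 i) = fun=> (j == i)%:R); first exact: polyf_cst_le.
  by apply/funext => x; exact: grad_coord.
- rewrite (_ : (fun x => grad _ x 0 i) = fun x => grad f x 0 i + grad g x 0 i); first exact: polyf_add.
  by apply/funext => x; rewrite gradD//; [exact: polyf_C1 pf|exact: polyf_C1 pg].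
- rewrite (_ : (fun x => grad _ x 0 i) = fun x => f x * grad g x 0 i + g x * grad f x 0 i).
    by apply: polyf_add; [exact: polyf_mul|rewrite addnC; exact: polyf_mul].
  by apply/funext => x; rewrite gradM//; [exact: polyf_C1 pf|exact: polyf_C1 pg].
- exact: polyf_le kl IHf.
Qed.

Lemma polyf_mono n (b : 'I_n -> nat) : polyf (\sum_i b i) (mono b : 'rV[R]_n -> R).
Proof.
apply: polyf_prod => i _; rewrite -[X in polyf X]muln1.
by apply: polyf_exp; exact: polyf_coord.
Qed.

Lemma Pol_polyf n (k : nat) (f : 'rV[R]_n -> R) : Pol k f -> polyf k f.
Proof.
move=> [c ->]; apply: polyf_sum => b bk; apply: polyf_scale.
by apply: polyf_le bk _; exact: polyf_mono.
Qed.

Lemma HPol_polyf n (m : int) a (f : 'rV[R]_n -> R) : HPol m a f -> exists k, polyf k f.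
Proof.
case: m => [m|m] /=; last by move=> ->; exists 0%N; exact: polyf_cst.
move=> [c ->]; exists m; apply: polyf_sum => b /eqP bm; apply: polyf_scale.
have := @polyf_comp n n _ _ 1%:M (- a) (polyf_mono (fun i => b i : nat)).
by rewrite bm; under [X in polyf _ X]funext do rewrite mulmx1.
Qed.

Lemma in_allpairs (A B C : Type) (h : A -> B -> C) (s : seq A) (t : seq B) z :
  List.In z [seq h a b | a <- s, b <- t] ->
  exists a b, [/\ List.In a s, List.In b t & z = h a b].
Proof.
elim: s => [//|a s IH] /=; rewrite List.in_app_iff => -[|/IH[a' [b [? ? ->]]]].
  elim: t {IH} => [//|b t IHt] /= [<-|/IHt[a' [b' [[->|?] ? ->]]]].
  - by exists a, b; split; [left|left|].
  - by exists a', b'; split; [left|right|].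
  - by exists a', b'; split; [right|right|].
by exists a', b; split => //; right.
Qed.

(** Between [polyf] and [Pol]: a list of terms with repetitions allowed, so that sums are
    concatenations, products are lists of pairs, and nothing has to be collected. *)
Definition span_mono n (k : nat) (f : 'rV[R]_n -> R) : Prop :=
  exists2 s : seq (R * ('I_n -> nat)), (forall p, List.In p s -> (\sum_i p.2 i <= k)%N) &
    f = fun x => \sum_(p <- s) p.1 * mono p.2 x.

Lemma polyf_span n k (f : 'rV[R]_n -> R) : polyf k f -> span_mono k f.
Proof.
elim=> {k f} [c|j|k f g _ [s1 d1 ->] _ [s2 d2 ->]|k l f g _ [s1 d1 ->] _ [s2 d2 ->]|k l f kl _ [s d ->]].
- exists [:: (c, fun=> 0%N)]; first by move=> p [<-|//]; rewrite big1.
  apply/funext => x; rewrite big_seq1 /mono big1 ?mulr1// => i _; exact: expr0.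
- exists [:: (1, fun i => (i == j) : nat)].
    move=> p [<-|//] /=; rewrite (bigD1 j)//= eqxx big1 ?addn0// => i ij.
    by rewrite (negPf ij).
  apply/funext => x; rewrite big_seq1 /mono mul1r (bigD1 j)//= eqxx expr1 big1 ?mulr1// => i ij.
  by rewrite (negPf ij) expr0.
- exists (s1 ++ s2); last by apply/funext => x; rewrite big_cat.
  by move=> p /List.in_app_iff[/d1|/d2].
- exists [seq (p.1 * q.1, fun i => (p.2 i + q.2 i)%N) | p <- s1, q <- s2].
    move=> p pin; have [p1 [p2 [H1 H2 ->]]] := in_allpairs pin.
    by rewrite /= big_split leq_add// ?d1 ?d2.
  apply/funext => x; rewrite big_allpairs_dep big_distrl; apply: eq_bigr => p _.
  rewrite big_distrr; apply: eq_bigr => q _ /=.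
  rewrite mulrACA; congr (_ * _); rewrite /mono -big_split; apply: eq_bigr => i _.
  by rewrite exprD.
- by exists s => // p /d H; exact: leq_trans H kl.
Qed.

Lemma Pol0 n (k : nat) : Pol k (fun _ : 'rV[R]_n => 0).
Proof.
exists (fun=> 0); apply/funext => x; rewrite big1// => b _; exact: mul0r.
Qed.

Lemma PolD n (k : nat) (f g : 'rV[R]_n -> R) : Pol k f -> Pol k g -> Pol k (fun x => f x + g x).
Proof.
move=> [a ->] [b ->]; exists (fun i => a i + b i); apply/funext => x.
by rewrite -big_split; apply: eq_bigr => i _; rewrite mulrDl.
Qed.

Lemma Pol_mono n (k : nat) c (b : 'I_n -> nat) : (\sum_i b i <= k)%N ->
  Pol k (fun x : 'rV[R]_n => c * mono b x).
Proof.
move=> bk; have bi i : (b i < k.+1)%N by rewrite ltnS (leq_trans _ bk)// (bigD1 i)//= leq_addr.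
pose b' : {ffun 'I_n -> 'I_k.+1} := [ffun i => Ordinal (bi i)].
have b'E i : b' i = b i :> nat by rewrite ffunE.
exists (fun d => if d == b' then c else 0); apply/funext => x.
rewrite (bigD1 b') /=; last by rewrite (eq_bigr _ (fun i _ => b'E i)).
rewrite eqxx big1 ?addr0; last by move=> d /andP[_ /negPf ->]; rewrite mul0r.
by congr (_ * _); rewrite /mono; apply: eq_bigr => i _; rewrite b'E.
Qed.

Lemma polyf_Pol n (k : nat) (f : 'rV[R]_n -> R) : polyf k f -> Pol k f.
Proof.
move=> /polyf_span[s sk ->]; elim: s sk => [|p s IH] sk.
  rewrite (_ : (fun x => _) = fun=> 0); first exact: Pol0.
  by apply/funext => x; rewrite big_nil.
rewrite (_ : (fun x => _) = fun x => p.1 * mono p.2 x + \sum_(p <- s) p.1 * mono p.2 x).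
  apply: PolD; first by apply: Pol_mono; apply: sk; left.
  by apply: IH => q qs; apply: sk; right.
by apply/funext => x; rewrite big_cons.
Qed.

End smooth.

Section L2_theory.
Context {R : realType}.
Variables (n : nat) (S : set 'rV[R]_n).
Hypothesis mS : measurable S.
Implicit Types f g h : 'rV[R]_n -> R.

Lemma L2_integrableM f g : L2 S f -> L2 S g ->
  (leb n).-integrable S (fun x => (f x * g x)%:E).
Proof.
move=> [mf iF] [mg ig].
apply: (@le_integrable _ _ _ (leb n) S mS _
  (fun x => (f x ^+ 2)%:E + (g x ^+ 2)%:E)%E); last exact: integrableD.
- by apply/measurable_EFinP; exact: measurable_funM.
- move=> x Sx; rewrite /= lee_fin [leRHS]ger0_norm ?addr_ge0 ?sqr_ge0// normrM.
  rewrite -[f x ^+ 2]real_normK ?num_real// -[g x ^+ 2]real_normK ?num_real//.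
  have := sqr_ge0 (`|f x| - `|g x|); have := normr_ge0 (f x); have := normr_ge0 (g x).
  by move=> *; nra.
Qed.

Lemma L2D f g : L2 S f -> L2 S g -> L2 S (fun x => f x + g x).
Proof.
move=> Lf Lg; have [mf iF] := Lf; have [mg ig] := Lg; split; first exact: measurable_funD.
have iFg := L2_integrableM Lf Lg.
rewrite (_ : (fun x => _) = fun x => ((f x ^+ 2)%:E + ((f x * g x)%:E + (f x * g x)%:E) + (g x ^+ 2)%:E)%E).
  apply: integrableD => //; apply: integrableD => //.
  exact: integrableD.
by apply/funext => x; rewrite -!EFinD sqrrD mulr2n.
Qed.

Lemma L2Z a f : L2 S f -> L2 S (fun x => a * f x).
Proof.
move=> [mf iF]; split; first by apply: measurable_funM => //; exact: measurable_cst.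
rewrite (_ : (fun x => _) = fun x => ((a ^+ 2)%:E * (f x ^+ 2)%:E)%E); first exact: integrableZl.
by apply/funext => x; rewrite exprMn.
Qed.

Lemma L2B f g : L2 S f -> L2 S g -> L2 S (fun x => f x - g x).
Proof.
move=> Lf Lg; rewrite (_ : (fun x => _) = fun x => f x + -1 * g x).
  by apply: L2D => //; exact: L2Z.
by apply/funext => x; rewrite mulN1r.
Qed.

Lemma L2_cst0 : L2 S (fun=> 0).
Proof.
split; first exact: measurable_cst.
rewrite (_ : (fun x => _) = fun=> 0%E); first exact: integrable0.
by apply/funext => x; rewrite expr0n.
Qed.

Lemma L2_sum (I : Type) (s : seq I) (F : I -> 'rV[R]_n -> R) :
  (forall i, L2 S (F i)) -> L2 S (fun x => \sum_(i <- s) F i x).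
Proof.
move=> LF; elim: s => [|i s IH].
  rewrite (_ : (fun x => _) = fun=> 0); first exact: L2_cst0.
  by apply/funext => x; rewrite big_nil.
rewrite (_ : (fun x => _) = fun x => F i x + \sum_(i <- s) F i x); first exact: L2D.
by apply/funext => x; rewrite big_cons.
Qed.

Lemma ipC f g : ip S f g = ip S g f.
Proof. by apply: eq_Rintegral => x _; rewrite mulrC. Qed.

Lemma ip_eql f g h : (forall x, S x -> f x = g x) -> ip S f h = ip S g h.
Proof. by move=> fg; apply: eq_Rintegral => x; rewrite inE => Sx; rewrite fg. Qed.

Lemma ipDl f g h : L2 S f -> L2 S g -> L2 S h ->
  ip S (fun x => f x + g x) h = ip S f h + ip S g h.
Proof.
move=> Lf Lg Lh; rewrite /ip -RintegralD//; try exact: L2_integrableM.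
by apply: eq_Rintegral => x _; rewrite mulrDl.
Qed.

Lemma ipZl a f h : L2 S f -> L2 S h -> ip S (fun x => a * f x) h = a * ip S f h.
Proof.
move=> Lf Lh; rewrite /ip -RintegralZl//; last exact: L2_integrableM.
by apply: eq_Rintegral => x _; rewrite mulrA.
Qed.

Lemma ipBl f g h : L2 S f -> L2 S g -> L2 S h ->
  ip S (fun x => f x - g x) h = ip S f h - ip S g h.
Proof.
move=> Lf Lg Lh; rewrite /ip -RintegralB//; try exact: L2_integrableM.
by apply: eq_Rintegral => x _; rewrite mulrBl.
Qed.

Lemma ip0l h : ip S (fun=> 0) h = 0.
Proof.
have -> : ip S (fun=> 0) h = \int[leb n]_(x in S) (0 : R).
  by apply: eq_Rintegral => x _; rewrite mul0r.
by rewrite /Rintegral integral0.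
Qed.

Lemma ip_suml (I : Type) (s : seq I) (F : I -> 'rV[R]_n -> R) h :
  (forall i, L2 S (F i)) -> L2 S h ->
  ip S (fun x => \sum_(i <- s) F i x) h = \sum_(i <- s) ip S (F i) h.
Proof.
move=> LF Lh; elim: s => [|i s IH].
  rewrite big_nil -[RHS](ip0l h); congr (ip S _ h).
  by apply/funext => x; rewrite big_nil.
rewrite big_cons -IH -ipDl//; last exact: L2_sum.
by congr (ip S _ h); apply/funext => x; rewrite big_cons.
Qed.

Lemma ip_ge0 f : 0 <= ip S f f.
Proof. by apply: Rintegral_ge0 => x _; rewrite -expr2 sqr_ge0. Qed.

Lemma cauchy_schwarz f g : L2 S f -> L2 S g -> ip S f g ^+ 2 <= ip S f f * ip S g g.
Proof.
move=> Lf Lg.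
have H t : 0 <= ip S f f + t * (2 * ip S f g) + t ^+ 2 * ip S g g.
  have := ip_ge0 (fun x => f x + t * g x); congr (_ <= _).
  have Ltg := L2Z t Lg; have Lfg := L2D Lf Ltg.
  rewrite ipDl// ipZl// (ipC f (fun x => f x + _)) (ipC g (fun x => f x + _)).
  by rewrite !ipDl// !ipZl// (ipC g f); ring.
have A0 := ip_ge0 f; have C0 := ip_ge0 g.
have [C00|Cn0] := eqVneq (ip S g g) 0.
  rewrite C00 mulr0; suff -> : ip S f g = 0 by rewrite expr0n.
  apply/eqP; apply: contraT => B0.
  (* An affine function of [t] that is never negative has slope zero; otherwise its value at this
     [t] would be [-1]. *)
  have := H (- (ip S f f + 1) / (2 * ip S f g)).
  rewrite C00 mulr0 addr0 divfK ?mulf_neq0 ?pnatr_eq0//.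
  by rewrite opprD addrA subrr sub0r ler0N1.
have Cp : 0 < ip S g g by rewrite lt_def Cn0.
(* The minimizer of the quadratic in [t]. *)
have := H (- ip S f g / ip S g g).
rewrite (_ : _ + _ = ip S f f - ip S f g ^+ 2 / ip S g g); last by field.
by rewrite subr_ge0 ler_pdivrMr.
Qed.

Lemma ip_null f g : L2 S f -> L2 S g -> ip S f f = 0 -> ip S f g = 0.
Proof.
move=> Lf Lg f0; have := cauchy_schwarz Lf Lg; rewrite f0 mul0r => H.
by apply/eqP; rewrite -sqrf_eq0 eq_le H sqr_ge0.
Qed.

(** The normal equations are solvable even if the Gram matrix [G] is singular: a vector of its
    cokernel gives a combination of norm zero, orthogonal to [v] by Cauchy-Schwarz, so [d] lies in
    the row space of [G]. *)
Lemma L2_projection (I : finType) (e : I -> 'rV[R]_n -> R) v :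
  (forall i, L2 S (e i)) -> L2 S v ->
  exists c : I -> R, forall i, ip S (fun x => \sum_j c j * e j x) (e i) = ip S v (e i).
Proof.
move=> Le Lv.
pose E (i : 'I_#|I|) := e (enum_val i).
pose G : 'M[R]_#|I| := \matrix_(i, j) ip S (E i) (E j).
pose d : 'rV[R]_#|I| := \row_i ip S v (E i).
have comb (z : 'I_#|I| -> R) h : L2 S h ->
    ip S (fun x => \sum_j z j * E j x) h = \sum_j z j * ip S (E j) h.
  move=> Lh; rewrite (ip_suml _ (F := fun j x => z j * E j x))//; last first.
    by move=> j; apply: L2Z; exact: Le.
  by apply: eq_bigr => j _; rewrite ipZl//; exact: Le.
have /submxP[a da] : (d <= G)%MS.
  rewrite submxE; apply/eqP/rowP => l; rewrite [LHS]mxE [RHS]mxE.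
  pose z j := cokermx G j l.
  pose p x := \sum_j z j * E j x.
  have Lp : L2 S p by apply: L2_sum => j; apply: L2Z; exact: Le.
  have Ep i : ip S (E i) p = 0.
    rewrite ipC comb; last exact: Le.
    have E0 : \sum_j G i j * cokermx G j l = 0.
      have /matrixP/(_ i l) := mulmx_coker G; rewrite mxE => ->; exact: mxE.
    by rewrite -[RHS]E0; apply: eq_bigr => j _; rewrite mxE mulrC ipC.
  have pp : ip S p p = 0 by rewrite [LHS]comb// big1// => j _; rewrite Ep mulr0.
  have Z := ip_null Lp Lv pp; rewrite -[RHS]Z [RHS]comb//.
  by apply: eq_bigr => j _; rewrite mxE mulrC ipC.
exists (fun i => a 0 (enum_rank i)) => i.
have := congr1 (fun M : 'rV[R]_#|I| => M 0 (enum_rank i)) da; rewrite !mxE /E enum_rankK => ->.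
rewrite (_ : (fun x => _) = fun x => \sum_j a 0 j * E j x); last first.
  apply/funext => x; rewrite (reindex (@enum_val I predT))/=; last first.
    exact: (onW_bij _ (@enum_val_bij I)).
  by apply: eq_bigr => j _; rewrite enum_valK.
by rewrite comb; [apply: eq_bigr => j _; rewrite mxE /E enum_rankK|exact: Le].
Qed.

End L2_theory.

Section L2_poly.
Context {R : realType}.
Variables (n : nat) (S : set 'rV[R]_n).
Hypothesis cS : compact S.

Let mS : measurable S := compact_measurable_rV cS.

Lemma continuous_L2 f : continuous f -> L2 S f.
Proof.
move=> cf; have [B HB] := compact_bound cS cf; split.
  by apply: measurable_funS (continuous_measurable_rV cf).
apply: (bounded_integrable (B := B ^+ 2)) => //.
  by apply: measurable_funX; apply: measurable_funS (continuous_measurable_rV cf).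
by move=> x Sx; rewrite normrX lerXn2r ?nnegrE ?HB// (le_trans _ (HB x Sx)).
Qed.

Lemma polyf_L2 k f : polyf k f -> L2 S f.
Proof. by move=> /polyf_C1/C1_continuous/continuous_L2. Qed.

Lemma Pol_L2 (k : nat) f : Pol k f -> L2 S f.
Proof. by move=> /Pol_polyf/polyf_L2. Qed.

Lemma QprojP (k : nat) v : L2 S v -> Pol k (Qproj k S v) /\
  forall q, Pol k q -> ip S (Qproj k S v) q = ip S v q.
Proof.
move=> Lv; pose A := [set p : 'rV[R]_n -> R | Pol k p /\ forall q, Pol k q -> ip S p q = ip S v q].
suff [p Ap] : exists p, A p by exact: (xgetPex (fun=> 0) (ex_intro _ p Ap)).
pose I := {ffun 'I_n -> 'I_k.+1}.
(* Exponents of total degree above [k] get the zero function, to keep a plain finite index type; the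
   Gram matrix may thus be singular, as [L2_projection] permits. *)
pose e (b : I) : 'rV[R]_n -> R := if (\sum_i b i <= k)%N then mono (fun i => b i) else fun=> 0.
have Le b : L2 S (e b).
  rewrite /e; case: ifP => _; last exact: L2_cst0.
  exact: polyf_L2 (polyf_mono _).
have eE (c : I -> R) x : \sum_b c b * e b x =
    \sum_(b : I | (\sum_i b i <= k)%N) c b * mono (fun i => b i) x.
  by rewrite [RHS]big_mkcond; apply: eq_bigr => b _; rewrite /e; case: ifP => //; rewrite mulr0.
have [c Hc] := L2_projection mS Le Lv.
pose p x := \sum_b c b * e b x.
have Pp : Pol k p by exists c; apply/funext => x; exact: eE.
have Lp := Pol_L2 Pp.
exists p; split => // q [a ->].
rewrite (_ : (fun x => _) = fun x => \sum_b a b * e b x); last first.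
  by apply/funext => x; rewrite eE.
have Lae b : L2 S (fun x => a b * e b x) by exact: L2Z.
rewrite ipC [RHS]ipC.
rewrite !(@ip_suml R n S mS I (index_enum I) (fun b x => a b * e b x))//.
apply: eq_bigr => b _; rewrite !ipZl//; congr (_ * _); rewrite ipC [RHS]ipC; exact: Hc.
Qed.

Lemma SMono_orth (k : nat) h (D : set 'rV[R]_n) : L2 S h -> diam D != 0 ->
  (forall q, SMono k D q -> ip S h q = 0) -> forall q, polyf k q -> ip S h q = 0.
Proof.
move=> Lh d0 H q pq.
pose d := diam D; pose b := barycenter D.
(* With [x = d y + b], the polynomial [q] has degree at most [k] in [y], and the monomials in [y]
   are the scaled monomials in [x]. A nonzero diameter makes the substitution invertible. *)
have := polyf_comp (d%:M) b pq => /polyf_span[s sk sE].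
have qE : q = fun x => \sum_(p <- s) p.1 * mono p.2 (d^-1 *: (x - b)).
  apply/funext => x; have := congr1 (fun F => F (d^-1 *: (x - b))) sE.
  rewrite /= mul_mx_scalar scalerA divff// scale1r subrK => ->.
  by [].
have Lm p : L2 S (fun x => mono p.2 (d^-1 *: (x - b)) : R).
  have := polyf_comp (d^-1%:M) (- (d^-1 *: b)) (@polyf_mono R n p.2) => /polyf_L2.
  by congr L2; apply/funext => x; rewrite mul_mx_scalar -scalerBr.
rewrite qE ipC {pq sE qE}; elim: s sk => [|p s IH] sk.
  rewrite -[RHS](ip0l S h); congr (ip S _ h); apply/funext => x; rewrite big_nil.
  by [].
rewrite (_ : (fun x => _) = fun x => p.1 * mono p.2 (d^-1 *: (x - b)) +
    \sum_(p <- s) p.1 * mono p.2 (d^-1 *: (x - b))); last first.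
  by apply/funext => x; rewrite big_cons.
rewrite ipDl//; last 2 first.
- exact: L2Z.
- by apply: (@L2_sum _ _ S mS _ s (fun p x => p.1 * mono p.2 (d^-1 *: (x - b)))) => p'; exact: L2Z.
rewrite IH ?addr0; last by move=> p' p's; apply: sk; right.
rewrite ipZl// ipC H ?mulr0//.
by exists p.2 => //; apply: sk; left.
Qed.

End L2_poly.

(** * Uniqueness of the weak gradient *)

Section null_covers.
Context {R : realType}.

Lemma affine_zero_null n (a : 'rV[R]_n) (b : R) (x y : 'rV[R]_n) :
  dot a x != dot a y -> (leb n).-negligible [set z | dot a z + b = 0].
Proof.
move=> xy; have a0 : a != 0.
  by apply: contra xy => /eqP ->; rewrite /dot !big1// => i _; rewrite mxE mul0r.
have := hyperplane_negligible (- b) a0; apply: negligibleS => z /= H.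
by apply/eqP; rewrite -addr_eq0 H.
Qed.

Lemma Rintegral_setU_null n (A B : set 'rV[R]_n) (f : 'rV[R]_n -> R) :
  measurable A -> measurable B -> (leb n).-integrable (A `|` B) (EFin \o f) ->
  (leb n).-negligible (A `&` B) ->
  \int[leb n]_(x in A `|` B) f x = \int[leb n]_(x in A) f x + \int[leb n]_(x in B) f x.
Proof.
move=> mA mB iF nAB.
have iB : (leb n).-integrable B (EFin \o f).
  by apply: integrableS iF => //; exact: measurableU.
have mAB : measurable (A `&` B) by exact: measurableI.
have -> : \int[leb n]_(x in B) f x = \int[leb n]_(x in B `\` A) f x.
  rewrite /Rintegral (negligible_integral mAB)//; last exact/negligibleP.
  congr (fine (\int[_]_(x in _) _)%E); apply/seteqP; split => x /= [Bx H]; split => //.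
    by move=> Ax; apply: H.
  by case.
rewrite -Rintegral_setU//.
- congr (\int[_]_(x in _) _); apply/seteqP; split => x /= [Ax|]; [by left| |by left|].
    by move=> Bx; have [Ax|Ax] := pselect (A x); [left|right].
  by case; right.
- exact: measurableD.
- apply: integrableS iF; [exact: measurableU|by apply: measurableU => //; exact: measurableD|].
  by move=> x [?|[? _]]; [left|right].
- by apply/disj_setPS => x [Ax []].
Qed.

(** The list may repeat a set, since two indices may give the same facet; a repeated member adds
    nothing to the union. *)
Lemma cover_zero n (s : seq (set 'rV[R]_n)) (f : 'rV[R]_n -> R) :
  (forall A, List.In A s -> measurable A) ->
  (forall A B, List.In A s -> List.In B s -> A = B \/ (leb n).-negligible (A `&` B)) ->
  (forall A, List.In A s -> \int[leb n]_(x in A) f x = 0) ->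
  (leb n).-integrable (\big[setU/set0]_(A <- s) A) (EFin \o f) ->
  \int[leb n]_(x in \big[setU/set0]_(A <- s) A) f x = 0.
Proof.
elim: s => [|A s IH] mA dA fA; first by rewrite big_nil Rintegral_set0.
rewrite big_cons => iF.
have sA B : List.In B s -> B `<=` \big[setU/set0]_(A <- s) A.
  elim: {IH mA dA fA iF} s => [//|C s IHs] /= [->|/IHs H]; rewrite big_cons.
    exact: subsetUl.
  by move=> x /H; right.
have mU : measurable (\big[setU/set0]_(A <- s) A).
  have : forall B, List.In B s -> measurable B by move=> B Bs; apply: mA; right.
  elim: {IH mA dA fA iF sA} s => [|C s IHs] H; first by rewrite big_nil.
  by rewrite big_cons; apply: measurableU; [apply: H; left|apply: IHs => B Bs; apply: H; right].
have mA0 : measurable A by apply: mA; left.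
have iU : (leb n).-integrable (\big[setU/set0]_(A <- s) A) (EFin \o f).
  by apply: integrableS iF => //; exact: measurableU.
have U0 : \int[leb n]_(x in \big[setU/set0]_(A <- s) A) f x = 0.
  apply: IH => //.
  - by move=> B Bs; apply: mA; right.
  - by move=> B C Bs Cs; apply: dA; right.
  - by move=> B Bs; apply: fA; right.
have [As|As] := pselect (List.In A s).
  by rewrite setUidr//; exact: sA.
rewrite Rintegral_setU_null// ?U0 ?addr0; first by apply: fA; left.
have : forall B, List.In B s -> (leb n).-negligible (A `&` B).
  move=> B Bs; have [AB|//] := dA A B (or_introl erefl) (or_intror Bs).
  by move: As; rewrite AB.
elim: {IH mA dA fA iF sA mU iU U0 As} s => [|C s IHs] H.
  by rewrite big_nil setI0; exact: negligible_set0.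
rewrite big_cons setIUr; apply: negligibleU; first by apply: H; left.
by apply: IHs => B Bs; apply: H; right.
Qed.

End null_covers.

Section cutoff.
Context {R : realType}.

Definition pos (x : R) : R := (x + `|x|) / 2.

Lemma pos_le0 x : x <= 0 -> pos x = 0.
Proof. by move=> x0; rewrite /pos ler0_norm// subrr mul0r. Qed.

Lemma pos_ge0 x : 0 <= x -> pos x = x.
Proof. by move=> x0; rewrite /pos ger0_norm//; field. Qed.

Lemma pos_continuous : continuous pos.
Proof.
move=> x; apply: cvgM; last exact: cvg_cst.
by apply: cvgD; [exact: cvg_id|exact: norm_continuous].
Qed.

(** The delicate point is 0, where the difference quotient is 0 or [h]. *)
Lemma is_derive_pos2 (x : R) : is_derive x 1 (fun x : R => pos x ^+ 2) (2 * pos x).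
Proof.
have [x0|x0|->] := ltgtP x 0.
- rewrite pos_le0 ?ltW// mulr0; apply: (near_eq_is_derive (f := cst (0 : R))).
    near=> t; rewrite pos_le0 ?expr0n//; apply: ltW; near: t; exact: lt_nbhsl.
- rewrite pos_ge0 ?ltW//; apply: (near_eq_is_derive (f := fun x : R => x * x)).
    near=> t; rewrite pos_ge0 ?expr2//; apply: ltW; near: t; exact: lt_nbhsr.
  have H := is_deriveM (is_derive_id x (1 : R)) (is_derive_id x (1 : R)).
  apply: (is_derive_eq (f := fun x : R => x * x) H).
  have sE (a b : R) : a *: (b : R) = a * b by [].
  by rewrite !sE !mulr1 mulr_natl mulr2n.
have H : h^-1 *: (((fun x : R => pos x ^+ 2) \o shift 0) (h *: (1 : R)) - pos 0 ^+ 2)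
    @[h --> 0^'] --> (0 : R).
  apply/cvgrPdist_lt => e e0; near=> h.
  have h0 : h != 0 by near: h; exact: nbhs_dnbhs_neq.
  have he : `|h| < e by near: h; exact: dnbhs0_lt.
  rewrite /= (_ : h *: (1 : R) = h); last exact: mulr1.
  rewrite addr0 (pos_ge0 (lexx 0)) expr0n subr0 sub0r normrN.
  rewrite (_ : h^-1 *: (pos h ^+ 2 : R) = h^-1 * pos h ^+ 2)//.
  have [hn|hp] := leP h 0; first by rewrite pos_le0// expr0n mulr0 normr0.
  by rewrite pos_ge0 ?ltW// expr2 mulKf.
apply: DeriveDef; first by apply/cvg_ex; exists 0.
by rewrite pos_ge0// mulr0; exact: cvg_lim.
Unshelve. all: by end_near. Qed.

(* A C^1 function that vanishes for s <= e and tends to 1 for s > 0 as e -> 0. *)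
Definition step (e s : R) : R := pos (s - e) ^+ 2 / (pos (s - e) ^+ 2 + e).

Section step.
Variable e : R.
Hypothesis e0 : 0 < e.

Lemma step_den s : 0 < pos (s - e) ^+ 2 + e.
Proof. by rewrite ltr_wpDl// sqr_ge0. Qed.

Lemma is_derive_step (s : R) : is_derive s 1 (step e)
  (2 * pos (s - e) * e / (pos (s - e) ^+ 2 + e) ^+ 2).
Proof.
have d1 : is_derive s 1 (fun s : R => pos (s - e) ^+ 2) (2 * pos (s - e)).
  have ds : is_derive s 1 (fun s : R => s - e) 1.
    by apply: is_derive_eq; rewrite oppr0 addr0.
  have := @is_derive1_comp R (fun x => pos x ^+ 2) (fun s => s - e) s _ _ (is_derive_pos2 (s - e)) ds.
  by rewrite mulr1.
have d2 : is_derive s 1 (fun s : R => pos (s - e) ^+ 2 + e) (2 * pos (s - e)).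
  have := is_deriveD d1 (is_derive_cst e s 1); rewrite addr0.
  exact.
have ne := lt0r_neq0 (step_den s).
have d3 : is_derive s 1 (fun s : R => (pos (s - e) ^+ 2 + e)^-1)
    (- (pos (s - e) ^+ 2 + e) ^- 2 * (2 * pos (s - e))).
  have H := @is_deriveV R (fun s : R => pos (s - e) ^+ 2 + e) s _ 1 ne d2.
  exact: (is_derive_eq (f := fun s : R => (pos (s - e) ^+ 2 + e)^-1) H).
have H := is_deriveM d1 d3.
apply: (is_derive_eq (f := step e) H).
have sE (a b : R) : a *: (b : R) = a * b by [].
by rewrite !sE; field.
Qed.

Lemma step_derive_continuous : continuous (derive1 (step e)).
Proof.
have -> : (derive1 (step e)) = fun s => 2 * pos (s - e) * e / (pos (s - e) ^+ 2 + e) ^+ 2.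
  by apply/funext => s; rewrite derive1E; apply: derive_val; exact: is_derive_step.
have cp : continuous (fun s : R => pos (s - e)).
  move=> s; apply: (@continuous_comp _ _ _ (fun s : R => s - e) pos); last exact: pos_continuous.
  by apply: cvgB; [exact: cvg_id|exact: cvg_cst].
move=> s; apply: cvgM.
  by apply: cvgM; [apply: cvgM; [exact: cvg_cst|exact: cp]|exact: cvg_cst].
apply: cvgV; first by rewrite expf_neq0// lt0r_neq0// step_den.
have cq : (pos (x - e) ^+ 2 + e) @[x --> s] --> pos (s - e) ^+ 2 + e.
  by apply: cvgD; [apply: cvgM; exact: cp|exact: cvg_cst].
by apply: cvgM.
Qed.

Lemma step_bound s : 0 <= step e s <= 1.
Proof.
rewrite /step divr_ge0 ?sqr_ge0 ?(ltW (step_den s))//=.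
by rewrite ler_pdivrMr ?step_den// mul1r lerDl ltW.
Qed.

Lemma step_supp s : step e s != 0 -> e < s.
Proof.
by apply: contraNlt => se; rewrite /step pos_le0 ?subr_le0// expr0n mul0r.
Qed.

End step.

Lemma step_cvg (s : R) : 0 < s -> step (n.+1%:R^-1) s @[n --> \oo] --> (1 : R).
Proof.
move=> s0; have ch : (fun n => n.+1%:R^-1 : R) @ \oo --> (0 : R) by exact: cvg_harmonic.
have cp : pos (s - n.+1%:R^-1) ^+ 2 @[n --> \oo] --> s ^+ 2.
  have c1 : pos (s - n.+1%:R^-1) @[n --> \oo] --> s.
    rewrite -[X in _ --> X](pos_ge0 (ltW s0)).
    have c0 : s - n.+1%:R^-1 @[n --> \oo] --> s.
      by rewrite -[X in _ --> X]subr0; apply: cvgB; [exact: cvg_cst|exact: ch].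
    by apply: cvg_comp c0 _; exact: pos_continuous.
  by apply: cvgM.
have s2 : s ^+ 2 != 0 by rewrite expf_neq0// gt_eqF.
rewrite -[X in _ --> X](divff s2) -[X in _ / X]addr0.
apply: cvgM => //; apply: cvgV; first by rewrite addr0.
exact: cvgD.
Qed.

Lemma C1_comp1 n (th : R -> R) (f : 'rV[R]_n -> R) :
  (forall s, derivable th s 1) -> continuous (derive1 th) -> C1 f -> C1 (fun x => th (f x)).
Proof.
move=> dth cth cf.
have dd x : differentiable th (f x) by apply/derivable1_diffP.
have E : forall i x, grad (fun x => th (f x)) x 0 i = grad f x 0 i * (derive1 th) (f x).
  move=> i x; rewrite !gradE deriveE; last exact: (differentiable_comp (cf.1 x) (dd x)).
  rewrite (diff_comp (cf.1 x) (dd x)) /= (diff1E (dd x)) /= deriveE//; exact: cf.1.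
split => [x|i]; first exact: (differentiable_comp (cf.1 x) (dd x)).
have -> : (fun x => grad (fun x => th (f x)) x 0 i) = fun x => grad f x 0 i * (derive1 th) (f x).
  by apply/funext => x; rewrite E.
move=> x; apply: (@cvgM R _ (nbhs x) (nbhs_filter x) (fun x => grad f x 0 i)); first exact: (cf.2 i x).
apply: (@continuous_comp _ _ _ f (derive1 th) x); last exact: cth.
by apply: C1_continuous.
Qed.

Lemma C1_prod n (I : Type) (s : seq I) (F : I -> 'rV[R]_n -> R) :
  (forall i, C1 (F i)) -> C1 (fun x => \prod_(i <- s) F i x).
Proof.
move=> cF; elim: s => [|i s IH].
  have -> : (fun x => \prod_(i <- [::]) F i x) = fun=> 1 by apply/funext => x; rewrite big_nil.
  exact: C1_cst.
have -> : (fun x => \prod_(i <- i :: s) F i x) = fun x => F i x * \prod_(i <- s) F i x.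
  by apply/funext => x; rewrite big_cons.
exact: C1M.
Qed.

End cutoff.

Section simplices.
Context {R : realType}.
Implicit Types X Y : 'M[R]_(4, 3).

Lemma bary_dot X l x :
  bary X x 0 l = dot (col l (bary_slope X))^T x + bary_shift X 0 l.
Proof.
rewrite bary_affine !mxE /dot; congr (_ + _).
by apply: eq_bigr => k _; rewrite !mxE mulrC.
Qed.

Lemma other2 (l : 'I_4) : exists l', l' != l.
Proof.
by exists (if l == 0 then 1 else 0); case: (l =P 0) => [->|/eqP]; rewrite // eq_sym.
Qed.

Lemma other3 (i l : 'I_4) : exists l', (l' != l) && (l' != i).
Proof.
apply/existsP; apply: contraT; rewrite negb_exists => /forallP H.
have : [set: 'I_4]%SET \subset [set i; l]%SET.
  by apply/fintype.subsetP => x _; have := H x; rewrite negb_and !negbK !finset.inE orbC.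
move=> /subset_leq_card; rewrite cardsT card_ord => /leq_trans/(_ (leq_card_setU _ _)).
by rewrite !cards1.
Qed.

(** The coordinate is affine and not constant, as it takes the values 1 and 0 at two vertices. *)
Lemma bary_zero_null X l : Defs.nondegenerate X ->
  (leb 3).-negligible [set x | bary X x 0 l = 0].
Proof.
move=> nX; have [l' l'l] := other2 l.
have ne : dot (col l (bary_slope X))^T (row l X) != dot (col l (bary_slope X))^T (row l' X).
  rewrite -(inj_eq (addIr (bary_shift X 0 l))) -!bary_dot !bary_vertex//.
  by rewrite eqxx (negPf l'l) oner_eq0.
have := affine_zero_null (bary_shift X 0 l) ne.
by apply: negligibleS => x /=; rewrite bary_dot.
Qed.

(** [common_vertices] selects vertices of its first argument. If all four occur in [Y], the
    correspondence is injective between sets of four elements, hence onto. *)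
Lemma common_sym X Y : Defs.nondegenerate X -> Defs.nondegenerate Y ->
  common_vertices X Y = [set: 'I_4]%SET -> common_vertices Y X = [set: 'I_4]%SET.
Proof.
move=> nX nY XY.
have /choice[g gE] : forall i : 'I_4, exists j, row i X = row j Y.
  move=> i; have : i \in common_vertices X Y by rewrite XY finset.in_setT.
  by rewrite finset.inE => /existsP[j /eqP ij]; exists j.
have gi : injective g.
  move=> i i' gii; have := bary_vertex i i nX; have := bary_vertex i' i nX.
  rewrite gE -gii -gE => ->; rewrite eqxx => /eqP.
  by case: (i' =P i) => [->//|_] /=; rewrite eq_sym oner_eq0.
apply/setP => j; rewrite finset.in_setT finset.inE; apply/existsP.
have /codomP[i ji] := injF_onto gi j.
by exists i; rewrite ji gE.
Qed.

Lemma hull_closed X s : Defs.nondegenerate X -> closed (hull X s).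
Proof.
move=> nX; rewrite hullE//.
rewrite (_ : mkset _ = \bigcap_(i in [set: 'I_4])
   ((fun x => bary X x 0 i) @^-1` [set r | 0 <= r /\ (i \notin s -> r = 0)])); last first.
  by apply/seteqP; split => x /= H i; [move=> _|]; exact: H.
apply: closed_bigI => i _; apply: closed_comp => [x _|]; first exact: bary_continuous.
have [si|si] := boolP (i \in s).
  rewrite (_ : mkset _ = [set r | 0 <= r]); first exact: closed_ge.
  by apply/seteqP; split => r /=; [case|].
rewrite (_ : mkset _ = [set 0]); first exact: closed_eq.
apply/seteqP; split => r /=; first by case=> _; exact.
by move=> ->; split.
Qed.

Lemma enorm_gt0 n (x : 'rV[R]_n) : x != 0 -> 0 < enorm x.
Proof.
move=> /rV0Pn[i xi]; rewrite /enorm sqrtr_gt0 (bigD1 i)//=.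
rewrite ltr_pwDl//; first by rewrite exprn_even_gt0.
by apply: sumr_ge0 => j _; rewrite sqr_ge0.
Qed.

(** [diam] is a supremum, so a bound [M] is required before it dominates the distance of two
    points. *)
Lemma diam_neq0 n (S : set 'rV[R]_n) x y M : (forall x, S x -> forall i, `|x 0 i| <= M) ->
  S x -> S y -> x != y -> diam S != 0.
Proof.
move=> SM Sx Sy xy; apply: lt0r_neq0.
have : 0 < enorm (x - y) by rewrite enorm_gt0// subr_eq0.
move=> /lt_le_trans; apply; apply: ub_le_sup; last by exists x, y.
exists (Num.sqrt (\sum_(i < n) (2 * M) ^+ 2)) => _ [a [b [Sa Sb ->]]].
rewrite /enorm ler_wsqrtr//; apply: ler_sum => i _.
rewrite !mxE -[leLHS]real_normK ?num_real//.
have M0 : 0 <= M by exact: le_trans (SM a Sa i).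
rewrite lerXn2r ?nnegrE ?mulr_ge0// (le_trans (ler_normB _ _))//.
by have := SM a Sa i; have := SM b Sb i; lra.
Qed.

Lemma polyf_bary X l : polyf 1 (fun x => bary X x 0 l).
Proof.
rewrite (_ : (fun x => _) = fun x => (x *m bary_slope X + bary_shift X) 0 l).
  exact: polyf_affine.
by apply/funext => x; rewrite bary_affine.
Qed.

Definition ispoly (f : 'rV[R]_3 -> R) := exists d, polyf d f.

Lemma ispolyD f g : ispoly f -> ispoly g -> ispoly (fun x => f x + g x).
Proof.
move=> [d df] [e eg]; exists (maxn d e); apply: polyf_add.
  by apply: polyf_le df; exact: leq_maxl.
by apply: polyf_le eg; exact: leq_maxr.
Qed.

Lemma ispolyM f g : ispoly f -> ispoly g -> ispoly (fun x => f x * g x).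
Proof. by move=> [d df] [e eg]; exists (d + e)%N; exact: polyf_mul. Qed.

Lemma ispoly_sum (I : Type) (s : seq I) (F : I -> 'rV[R]_3 -> R) :
  (forall i, ispoly (F i)) -> ispoly (fun x => \sum_(i <- s) F i x).
Proof.
move=> pF; elim: s => [|i s IH].
  rewrite (_ : (fun x => _) = fun=> 0); first by exists 0%N; exact: polyf_cst.
  by apply/funext => x; rewrite big_nil.
rewrite (_ : (fun x => _) = fun x => F i x + \sum_(i <- s) F i x); first exact: ispolyD.
by apply/funext => x; rewrite big_cons.
Qed.

Lemma face_ext_poly m X i r : face_ext m X i r -> ispoly r.
Proof.
case: m => [m|m] /=; last by move=> ->; exists 0%N; exact: polyf_cst.
move=> [[c ->] _]; exists m; apply: polyf_sum => a /andP[_ /eqP am].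
apply: polyf_scale; apply: (@polyf_le _ _ (\sum_j a j)%N); first by rewrite am.
apply: polyf_prod => j _.
by rewrite -[X in polyf X]muln1; apply: polyf_exp; exact: polyf_bary.
Qed.

(** The bubbles raise the degree above [k], so the piece is recorded as a polynomial of unspecified
    degree; this yields the C^1 regularity for Green's formula. *)
Lemma Vtet_poly (k : nat) X v : Vtet k X v ->
  exists2 p, ispoly p & forall x, tet_set X x -> v x = p x.
Proof.
move=> [p [r [s [pp rr ss vE]]]].
exists (fun x => p x + \sum_i bubble X x * r i x + \sum_i \sum_l face_bubble X i x * s i l x) => //.
have pbary (I : Type) (e : seq I) (P : pred I) (F : I -> 'I_4) :
    ispoly (fun x => \prod_(i <- e | P i) bary X x 0 (F i)).
  by eexists; apply: polyf_prod => i _; exact: polyf_bary.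
apply: ispolyD; first apply: ispolyD.
- by exists k; exact: Pol_polyf.
- apply: ispoly_sum => i; apply: ispolyM; first exact: pbary.
  by have [d rd] := HPol_polyf (rr i); exists d.
- apply: (@ispoly_sum _ _ (fun i x => \sum_l face_bubble X i x * s i l x)) => i.
  apply: (@ispoly_sum _ _ (fun l x => face_bubble X i x * s i l x)) => l.
  apply: ispolyM; first exact: pbary.
  exact: face_ext_poly (ss i l).
Qed.

End simplices.

Section mesh.
Context {R : realType}.
Variables (K : polyhedron R).
Hypothesis Kp : is_polyhedron K.
Variable T : tet_mesh R.
Local Notation tet := (@tm_tet R T).
Local Notation tets := (fun j => tet_set (tet j)).
Hypothesis nd : forall j, Defs.nondegenerate (tet j).
Hypothesis cov : ph_body K = \bigcup_j tets j.
Hypothesis conf : forall i j, i != j -> tet_set (tet i) <> tet_set (tet j) /\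
  tet_set (tet i) `&` tet_set (tet j) = hull (tet i) (common_vertices (tet i) (tet j)).

Local Notation pt := (@bd_patch R K).

(** By conformity the overlap is spanned by the common vertices. If all four were common the
    tetrahedra would coincide; otherwise some barycentric coordinate vanishes on the overlap. *)
Lemma tets_overlap i j : i != j -> (leb 3).-negligible (tets i `&` tets j).
Proof.
move=> ij; have [ne E] := conf ij; rewrite /= E.
have [full|] := eqVneq (common_vertices (tet i) (tet j)) [set: 'I_4]%SET.
  have ji : j != i by rewrite eq_sym.
  have Ei : tet_set (tet i) `&` tet_set (tet j) = tet_set (tet i) by rewrite E full.
  have Ej : tet_set (tet j) `&` tet_set (tet i) = tet_set (tet j).
    by have [_ ->] := conf ji; rewrite (common_sym (nd i) (nd j) full).
  by case: ne; rewrite -Ei setIC.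
move=> full; have [l lc] : exists l, l \notin common_vertices (tet i) (tet j).
  apply/existsP; apply: contraNT full; rewrite negb_exists => /forallP H.
  by apply/eqP/setP => l; rewrite finset.in_setT; have := H l; rewrite negbK.
have := bary_zero_null l (nd i); apply: negligibleS => x.
by rewrite hullE// => /(_ l)[_]; apply.
Qed.

Lemma tets_compact j : compact (tets j).
Proof.
apply: subclosed_compact (body_compact Kp) _; first exact: hull_closed.
exact: tets_body.
Qed.

Lemma body_from_tets f : (leb 3).-integrable (ph_body K) (EFin \o f) ->
  (forall j, \int[leb 3]_(x in tets j) f x = 0) -> \int[leb 3]_(x in ph_body K) f x = 0.
Proof.
move=> iF f0.
have KE : ph_body K = \big[setU/set0]_(A <- [seq tets j | j <- enum 'I_(tm_size T)]) A.
  rewrite big_map cov -bigcup_seq; apply: eq_bigcupl.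
  by split => j //= _; rewrite mem_enum.
have memE A : List.In A [seq tets j | j <- enum 'I_(tm_size T)] -> exists j, A = tets j.
  by elim: (enum _) => [//|j s IH] /= [<-|/IH//]; exists j.
rewrite KE; apply: cover_zero; last by rewrite -KE.
- by move=> A /memE[j ->]; exact: measurable_tets.
- move=> A B /memE[i ->] /memE[j ->].
  by have [->|ij] := eqVneq i j; [left|right; exact: tets_overlap].
- by move=> A /memE[j ->].
Qed.

Lemma bary_pos_interior j x : (forall l, 0 < bary (tet j) x 0 l) -> nbhs x (ph_body K).
Proof.
move=> bx.
have : \forall z \near x, forall l, 0 < bary (tet j) z 0 l.
  apply: (@filter_forall 'rV[R]_3 'I_4 (fun l z => 0 < bary (tet j) z 0 l) (nbhs x) _) => l.
  have /cvgrPdist_lt/(_ _ (bx l)) := @bary_continuous R (tet j) l x.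
  by apply: filterS => z; rewrite ltr_norml => /andP[_]; rewrite ltrBlDl ltrDr.
apply: filterS => z bz; apply: (@tets_body R K T cov j).
by rewrite tet_setE//= => l; exact/ltW.
Qed.

Definition cutoff j (n : nat) (x : 'rV[R]_3) : R :=
  \prod_l step n.+1%:R^-1 (bary (tet j) x 0 l).

Let inv0 (n : nat) : 0 < n.+1%:R^-1 :> R. Proof. by rewrite invr_gt0. Qed.

Lemma cutoff_supp j n x : cutoff j n x != 0 -> forall l, n.+1%:R^-1 < bary (tet j) x 0 l.
Proof.
move=> c0 l; apply: step_supp; apply: contra c0 => /eqP s0.
by rewrite /cutoff (bigD1 l)//= s0 mul0r.
Qed.

Lemma cutoff_test j n psi : C1 psi -> test_fun (ph_body K) (fun x => cutoff j n x * psi x).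
Proof.
move=> cpsi.
(* This closed set catches the support, and the coordinates are positive on it, so it lies in the
   interior of [K]. *)
pose C : set 'rV[R]_3 := \bigcap_(l in [set: 'I_4])
  (fun x => bary (tet j) x 0 l) @^-1` [set r | n.+1%:R^-1 <= r].
have cC : closed C.
  apply: closed_bigI => l _; apply: closed_comp => [x _|]; first exact: bary_continuous.
  exact: closed_ge.
have sub : closure [set x | cutoff j n x * psi x != 0] `<=` C.
  rewrite [X in _ `<=` X]((closure_id C).1 cC); apply: closure_subset => x /= H l _ /=.
  apply/ltW/cutoff_supp; apply: contra H => /eqP ->; by rewrite mul0r.
have CK : C `<=` interior (ph_body K).
  by move=> x Cx; apply: bary_pos_interior => l; apply: lt_le_trans (inv0 n) (Cx l I).
split; last by move=> x /sub/CK.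
- apply: C1M => //; apply: C1_prod => l.
  apply: (C1_comp1 (f := fun x => bary (tet j) x 0 l)).
  + by move=> s; have [] := is_derive_step (inv0 n) s.
  + exact: step_derive_continuous.
  + exact: polyf_C1 (polyf_bary _ _).
- apply: subclosed_compact (body_compact Kp) _; first exact: closed_closure.
  by move=> x /sub/CK; exact: interior_subset.
Qed.

(* The test function psi is multiplied by cutoffs supported inside a tetrahedron
   and increasing to 1 in its interior. *)
Lemma wgrad_unique v G G' i psi : is_wgrad (ph_body K) v G -> is_wgrad (ph_body K) v G' ->
  C1 psi -> ip (ph_body K) (fun x => G x 0 i) psi = ip (ph_body K) (fun x => G' x 0 i) psi.
Proof.
move=> wG wG' cpsi; have [LG GE] := wG i; have [LG' GE'] := wG' i.
have mK := body_measurable Kp.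
have Lpsi : L2 (ph_body K) psi by apply: (continuous_L2 (body_compact Kp)); exact: C1_continuous.
apply/eqP; rewrite -subr_eq0 -ipBl//; apply/eqP.
pose E x := G x 0 i - G' x 0 i.
have LE : L2 (ph_body K) E by exact: L2B.
have iE := L2_integrableM mK LE Lpsi.
apply: body_from_tets => // j.
have mt := @measurable_tets R T nd j.
have sub : tets j `<=` ph_body K by exact: tets_body.
have iEt : (leb 3).-integrable (tets j) (fun x => (E x * psi x)%:E) by exact: integrableS iE.
have ctest n : C1 (fun x => cutoff j n x * psi x) by have [] := cutoff_test j n cpsi.
have Z n : \int[leb 3]_(x in tets j) (E x * (cutoff j n x * psi x)) = 0.
  have Lc : L2 (ph_body K) (fun x => cutoff j n x * psi x).
    by apply: (continuous_L2 (body_compact Kp)); apply: C1_continuous.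
  (* The cutoff vanishes off the tetrahedron, so the integral extends to [K], where the definition
     of a weak gradient applies. *)
  transitivity (ip (ph_body K) E (fun x => cutoff j n x * psi x)).
    rewrite /ip Rintegral_mkcond [RHS]Rintegral_mkcond; apply: eq_Rintegral => x _.
    rewrite !patchE; case: ifPn => [|nt].
      by rewrite inE => /sub Kx; rewrite mem_set.
    case: ifPn => // _; suff -> : cutoff j n x = 0 by rewrite mul0r mulr0.
    apply/eqP; apply: contraNT nt => /cutoff_supp H; rewrite inE tet_setE//= => l.
    by apply: ltW (lt_trans (inv0 n) (H l)).
  have t := cutoff_test j n cpsi.
  rewrite /E ipBl//; have := GE _ t; have := GE' _ t => -> /oppr_inj ->.
  by rewrite subrr.
have mEc n : measurable_fun (tets j) (fun x => (E x * (cutoff j n x * psi x))%:E).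
  have Lc : L2 (ph_body K) (fun x => cutoff j n x * psi x).
    by apply: (continuous_L2 (body_compact Kp)); apply: C1_continuous.
  by apply: measurable_funS (measurable_int _ (L2_integrableM mK LE Lc)).
have lim : {ae leb 3, forall x, tets j x ->
    (E x * (cutoff j n x * psi x))%:E @[n --> \oo] --> (E x * psi x)%:E}.
  (* In the tetrahedron and off the planes of its facets all coordinates are positive, and each
     factor of the cutoff tends to 1. *)
  have : (leb 3).-negligible (\bigcup_l [set x | bary (tet j) x 0 l = 0]).
    by apply: negligible_bigcup_fin => l; exact: bary_zero_null.
  apply: negligibleS => x /= H; apply: contrapT => nz; apply: H => tx.
  have bx l : 0 < bary (tet j) x 0 l.
    move: tx; rewrite tet_setE//= => /(_ l); rewrite le_eqVlt => /orP[/eqP b0|//].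
    by case: nz; exists l => //=; rewrite -b0.
  apply: cvg_EFin; first by apply: nearW.
  apply: cvgM; first exact: cvg_cst.
  rewrite -[X in _ --> X]mul1r; apply: cvgM; last exact: cvg_cst.
  rewrite /cutoff (_ : (fun n => _) = fun n : nat => step n.+1%:R^-1 (bary (tet j) x 0 ord0) *
     (step n.+1%:R^-1 (bary (tet j) x 0 (lift ord0 ord0)) *
     (step n.+1%:R^-1 (bary (tet j) x 0 (lift ord0 (lift ord0 ord0))) *
      (step n.+1%:R^-1 (bary (tet j) x 0 (lift ord0 (lift ord0 (lift ord0 ord0)))) * 1)))); last first.
    by apply/funext => n; rewrite !big_ord_recl big_ord0.
  rewrite -[X in _ --> X](_ : 1 * (1 * (1 * (1 * 1))) = 1 :> R); last by rewrite !mulr1.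
  do 4 (apply: cvgM; [exact: step_cvg|]); exact: cvg_cst.
have dom : {ae leb 3, forall x (n : nat), tets j x ->
    (`|(E x * (cutoff j n x * psi x))%:E| <= `|(E x * psi x)%:E|)%E}.
  apply: aeW => x n _; rewrite lee_fin !normrM ler_wpM2l//.
  rewrite -[leRHS]mul1r ler_wpM2r// ger0_norm; last first.
    by apply: prodr_ge0 => l _; have /andP[] := step_bound (inv0 n) (bary (tet j) x 0 l).
  by apply: prodr_ile1 => l _; exact: step_bound.
have [_ _ L] := dominated_convergence mt mEc (measurable_int _ iEt) lim (integrable_abse iEt) dom.
have L0 : (\int[leb 3]_(x in tets j) (E x * psi x)%:E = 0)%E.
  apply: (cvg_unique _ L) => //; apply: cvg_near_cst; apply: nearW => n /=.
  rewrite -[LHS]fineK; first exact: (congr1 EFin (Z n)).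
  apply: integrable_fin_num => //.
  have Lc : L2 (ph_body K) (fun x => cutoff j n x * psi x).
    by apply: (continuous_L2 (body_compact Kp)); apply: C1_continuous.
  exact: integrableS (L2_integrableM mK LE Lc).
by rewrite /Rintegral L0.
Qed.

End mesh.

(** * The triangulation of a face *)

Section facets.
Context {R : realType}.
Variables (K : polyhedron R).
Hypothesis Kp : is_polyhedron K.
Variable T : tet_mesh R.
Local Notation tet := (@tm_tet R T).
Local Notation tets := (fun j => tet_set (tet j)).
Hypothesis nd : forall j, Defs.nondegenerate (tet j).
Hypothesis conf : forall i j, i != j -> tet_set (tet i) <> tet_set (tet j) /\
  tet_set (tet i) `&` tet_set (tet j) = hull (tet i) (common_vertices (tet i) (tet j)).
Variable f : 'I_(ph_size K).
Local Notation pt := (@bd_patch R K f).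
Local Notation plane := (fun x => dot (cross (frame pt)) (x - org pt)).

Lemma facetE j l x : facet (tet j) l x <->
  (forall l', 0 <= bary (tet j) x 0 l') /\ bary (tet j) x 0 l = 0.
Proof.
rewrite /facet hullE//=; split => [H|[H1 H2] l'].
  split => [l'|]; first by have [] := H l'.
  by have [_] := H l; apply; rewrite finset.inE negbK finset.inE.
split => //; rewrite finset.inE negbK finset.inE => /eqP ->.
by [].
Qed.

Lemma facet_row j l l' : l' != l -> facet (tet j) l (row l' (tet j)).
Proof.
move=> ll'; apply/facetE; split => [l2|]; rewrite bary_vertex//.
by rewrite (negPf ll').
Qed.

Lemma fc_set_plane x : fc_set (ph_face f) x -> plane x = 0 /\ emb pt (Defs.coord pt x) = x.
Proof.
move=> [t _ <-]; split; first exact: dot_emb.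
by rewrite coord_emb//; exact: face_isometric.
Qed.

(** An affine function is the barycentric mean of its values at the vertices. *)
Lemma plane_bary j x : plane x = \sum_l bary (tet j) x 0 l * plane (row l (tet j)).
Proof.
have [b1 bx] := bary_sum x (nd j).
transitivity (\sum_l bary (tet j) x 0 l * dot (cross (frame pt)) (row l (tet j)) -
    (\sum_l bary (tet j) x 0 l) * dot (cross (frame pt)) (org pt)).
  rewrite b1 mul1r dotBr; congr (_ - _); rewrite -{1}bx /dot.
  under eq_bigr do rewrite [(_ *m _) _ _]mxE mulr_sumr.
  rewrite exchange_big /=; apply: eq_bigr => l _; rewrite mulr_sumr.
  by apply: eq_bigr => k _; rewrite [row _ _ _ _]mxE mulrCA.
rewrite mulr_suml -sumrB; apply: eq_bigr => l _; rewrite dotBr mulrBr.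
by [].
Qed.

(** Otherwise all four vertices lie in the plane and its equation vanishes identically; but it takes
    the value 1 one unit along the normal. *)
Lemma facet_opposite j l : facet (tet j) l `<=` fc_set (ph_face f) -> plane (row l (tet j)) != 0.
Proof.
move=> sub; apply/eqP => p0.
have pl l' : plane (row l' (tet j)) = 0.
  have [->//|ll'] := eqVneq l' l.
  by have [] := fc_set_plane (sub _ (facet_row j ll')).
have := plane_bary j (org pt + cross (frame pt)).
rewrite big1; last by move=> l' _; rewrite pl mulr0.
rewrite addrC addKr.
have := cross_unit (face_isometric Kp f) => /matrixP/(_ 0 0).
rewrite -dotE => -> /eqP; by rewrite mxE eqxx oner_eq0.
Qed.

(** By [plane_bary] only the vertex opposite to the facet contributes to the equation of the plane,
    so its coordinate is zero. *)
Lemma facet_in_plane j l x : facet (tet j) l `<=` fc_set (ph_face f) ->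
  tets j x -> plane x = 0 -> facet (tet j) l x.
Proof.
move=> sub /=; rewrite tet_setE//= => tx px; apply/facetE; split => //.
have := plane_bary j x; rewrite px (bigD1 l)//= big1 ?addr0; last first.
  move=> l' ll'; have [-> _] := fc_set_plane (sub _ (facet_row j ll')).
  exact: mulr0.
by move=> /esym/eqP; rewrite mulf_eq0 (negPf (facet_opposite sub)) orbF => /eqP.
Qed.

Definition facet_dom (p : 'I_(tm_size T) * 'I_4) : set 'rV[R]_2 :=
  emb pt @^-1` facet (tet p.1) p.2.

(** On the plane of the face the coordinate is still affine, with values 1 and 0 at two vertices of
    the facet. *)
Lemma facet_edge_null j l l2 : facet (tet j) l `<=` fc_set (ph_face f) -> l2 != l ->
  (leb 2).-negligible [set t | bary (tet j) (emb pt t) 0 l2 = 0].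
Proof.
move=> sub l2l; have [l3 /andP[l32 l3l]] := other3 l l2.
have E t : bary (tet j) (emb pt t) 0 l2 =
    dot ((col l2 (bary_slope (tet j)))^T *m (frame pt)^T) t +
    (dot (col l2 (bary_slope (tet j)))^T (org pt) + bary_shift (tet j) 0 l2).
  rewrite bary_dot /emb dotDr [X in X + _]addrC -addrA; congr (_ + _).
  by rewrite !dotE trmx_mul !trmxK mulmxA.
have [_ E2] := fc_set_plane (sub _ (facet_row j l2l)).
have [_ E3] := fc_set_plane (sub _ (facet_row j l3l)).
have ne : dot ((col l2 (bary_slope (tet j)))^T *m (frame pt)^T) (Defs.coord pt (row l2 (tet j))) !=
    dot ((col l2 (bary_slope (tet j)))^T *m (frame pt)^T) (Defs.coord pt (row l3 (tet j))).
  rewrite -(inj_eq (addIr (dot (col l2 (bary_slope (tet j)))^T (org pt) + bary_shift (tet j) 0 l2))).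
  by rewrite -!E E2 E3 !bary_vertex// eqxx (negPf l32) oner_eq0.
have := affine_zero_null (dot (col l2 (bary_slope (tet j)))^T (org pt) + bary_shift (tet j) 0 l2) ne.
by apply: negligibleS => t /=; rewrite E.
Qed.

(* Either the conformity condition leaves out a vertex of the facet p, and the
   overlap lies on an edge, or p is contained in the facet q. *)
Lemma facet_half p q : p.1 != q.1 ->
  facet (tet p.1) p.2 `<=` fc_set (ph_face f) -> facet (tet q.1) q.2 `<=` fc_set (ph_face f) ->
  facet (tet p.1) p.2 `<=` facet (tet q.1) q.2 \/
  (leb 2).-negligible (facet_dom p `&` facet_dom q).
Proof.
move=> pq subp subq; have [_ E] := conf pq.
have [/existsP[l /andP[lp lc]]|H] := boolP [exists l, (l != p.2) &&
    (l \notin common_vertices (tet p.1) (tet q.1))].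
  right; have := facet_edge_null subp lp; apply: negligibleS => t [/= /facetE[tp _] /facetE[tq _]].
  have : (tet_set (tet p.1) `&` tet_set (tet q.1)) (emb pt t) by rewrite !tet_setE.
  by rewrite E hullE// => /(_ l)[_]; apply.
left => x xp; apply: facet_in_plane => //; last by have [] := fc_set_plane (subp _ xp).
have [xp1 xp2] := (facetE _ _ _).1 xp.
suff : (tet_set (tet p.1) `&` tet_set (tet q.1)) x by case.
rewrite E hullE//= => l; split => // lc.
have [->//|lp] := eqVneq l p.2.
by move: H; rewrite negb_exists => /forallP/(_ l); rewrite lp lc.
Qed.

Lemma facet_overlap p q :
  facet (tet p.1) p.2 `<=` fc_set (ph_face f) -> facet (tet q.1) q.2 `<=` fc_set (ph_face f) ->
  facet_dom p = facet_dom q \/ (leb 2).-negligible (facet_dom p `&` facet_dom q).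
Proof.
move=> subp subq; have [pq|pq] := eqVneq p.1 q.1.
  have [pq2|pq2] := eqVneq p.2 q.2; first by left; rewrite /facet_dom pq pq2.
  have qp2 : q.2 != p.2 by rewrite eq_sym.
  (* Two facets of one tetrahedron meet where the coordinate belonging to the second vanishes
     too. *)
  right; have := facet_edge_null subp qp2.
  by apply: negligibleS => t [/= _ /facetE[_]]; rewrite -pq.
have [pq1|] := facet_half pq subp subq; last by right.
have qp : q.1 != p.1 by rewrite eq_sym.
have [qp1|] := facet_half qp subq subp.
  by left; apply/seteqP; split => t /=; [exact: pq1|exact: qp1].
by rewrite setIC; right.
Qed.

Lemma facet_dom_closed p : closed (facet_dom p).
Proof.
apply: closed_comp => [t _|]; first exact: emb_continuous.
by apply: hull_closed; exact: nd.
Qed.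

Lemma facet_dom_sub p : facet (tet p.1) p.2 `<=` fc_set (ph_face f) -> facet_dom p `<=` dom pt.
Proof.
move=> sub t /sub[t' dt' tt'].
by rewrite -(coord_emb t (face_isometric Kp f)) -tt' coord_emb//; exact: face_isometric.
Qed.

Lemma facet_dom_compact p : facet (tet p.1) p.2 `<=` fc_set (ph_face f) -> compact (facet_dom p).
Proof.
move=> sub; apply: subclosed_compact (face_compact Kp (f := f)) _; first exact: facet_dom_closed.
exact: facet_dom_sub.
Qed.

(** Two distinct vertices suffice. This is what makes the scaled monomials on the facet span the
    polynomials. *)
Lemma facet_dom_diam p : facet (tet p.1) p.2 `<=` fc_set (ph_face f) -> diam (facet_dom p) != 0.
Proof.
move=> sub; have [M HM] := compact_coord_bound (facet_dom_compact sub).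
have [l lp] := other2 p.2; have [l' /andP[l'l l'p]] := other3 p.2 l.
have [_ E] := fc_set_plane (sub _ (facet_row p.1 lp)).
have [_ E'] := fc_set_plane (sub _ (facet_row p.1 l'p)).
apply: (@diam_neq0 _ _ _ (Defs.coord pt (row l (tet p.1))) (Defs.coord pt (row l' (tet p.1))) M) => //.
- by rewrite /facet_dom /= E; exact: facet_row.
- by rewrite /facet_dom /= E'; exact: facet_row.
apply/eqP => ll; have := bary_vertex l l (nd p.1).
rewrite -E ll E' bary_vertex// eqxx (negPf l'l) => /eqP.
by rewrite eq_sym oner_eq0.
Qed.

Hypothesis fcov : forall x, fc_set (ph_face f) x -> exists j i,
  facet (tet j) i x /\ facet (tet j) i `<=` fc_set (ph_face f).

Lemma face_from_facets h : (leb 2).-integrable (dom pt) (EFin \o h) ->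
  (forall p, facet (tet p.1) p.2 `<=` fc_set (ph_face f) -> \int[leb 2]_(t in facet_dom p) h t = 0) ->
  \int[leb 2]_(t in dom pt) h t = 0.
Proof.
move=> ih h0.
pose P (p : 'I_(tm_size T) * 'I_4) := `[< facet (tet p.1) p.2 `<=` fc_set (ph_face f) >].
pose s := [seq facet_dom p | p <- enum P].
have memE A : List.In A s -> exists2 p, facet (tet p.1) p.2 `<=` fc_set (ph_face f) & A = facet_dom p.
  have : forall p, p \in enum P -> P p by move=> p; rewrite mem_enum.
  rewrite /s; elim: (enum _) => [//|p l IH] Pl /= [<-|/IH]; last first.
    by apply => q ql; apply: Pl; rewrite inE ql orbT.
  by exists p => //; apply/asboolP/Pl; rewrite inE eqxx.
have dE : dom pt = \big[setU/set0]_(A <- s) A.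
  rewrite /s big_map -bigcup_seq; apply/seteqP; split => [t dt|t [p /=]].
    have [|j [l [xl sub]]] := fcov (x := emb pt t); first by exists t.
    by exists (j, l) => //=; rewrite mem_enum; apply/asboolP.
  by rewrite mem_enum => /asboolP sub; exact: facet_dom_sub.
rewrite dE; apply: cover_zero; last by rewrite -dE.
- by move=> A /memE[p sub ->]; apply: compact_measurable_rV; exact: facet_dom_compact.
- by move=> A B /memE[p sp ->] /memE[q sq ->]; exact: facet_overlap.
- by move=> A /memE[p sub ->]; exact: h0.
Qed.

End facets.

(** * Integration by parts *)

Section integration_by_parts.
Context {R : realType}.
Variables (K : polyhedron R) (c : 'rV[R]_3) (r : R).
Hypothesis r0 : 0 < r.
Hypothesis star : forall y, enorm (y - c) < r ->
  ph_body K y /\ forall x, ph_body K x -> seg y x `<=` ph_body K.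
Hypothesis Kp : is_polyhedron K.
Variable T : tet_mesh R.
Local Notation tet := (@tm_tet R T).
Local Notation tets := (fun j => tet_set (tet j)).
Hypothesis nd : forall j, Defs.nondegenerate (tet j).
Hypothesis cov : ph_body K = \bigcup_j tets j.

Local Notation pt := (@bd_patch R K).
Local Notation pw := (@pw R (tm_size T) tets).

Let mK : measurable (ph_body K) := body_measurable Kp.

Lemma pw_L2 d : (forall j, continuous (d j)) -> L2 (ph_body K) (pw d).
Proof.
move=> cd; have [B HB] := pw_bounded Kp cov cd.
have mp : measurable_fun [set: 'rV[R]_3] (pw d).
  apply: measurable_pw => j; first exact: measurable_tets.
  exact: continuous_measurable_rV.
have mpK : measurable_fun (ph_body K) (pw d) by exact: measurable_funS mp.
split => //.
apply: (bounded_integrable (B := B ^+ 2)); [exact: body_compact|exact: measurable_funX|].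
by move=> x _; rewrite normrX lerXn2r ?nnegrE// (le_trans _ (HB x)).
Qed.

Lemma face_pw_L2 d f : (forall j, continuous (d j)) -> L2 (dom (pt f)) (pw d \o emb (pt f)).
Proof.
move=> cd; have [B HB] := pw_bounded Kp cov cd.
have mp := measurable_int _ (face_pw_integrable Kp nd cov f cd).
have mpf : measurable_fun (dom (pt f)) (pw d \o emb (pt f)) by exact/measurable_EFinP.
split => //.
apply: (bounded_integrable (B := B ^+ 2)); [exact: face_compact|exact: measurable_funX|].
by move=> x _; rewrite normrX lerXn2r ?nnegrE//= (le_trans _ (HB (emb (pt f) x))).
Qed.

Section piecewise.
Variables (w : 'rV[R]_3 -> R) (p : 'I_(tm_size T) -> 'rV[R]_3 -> R).
Hypothesis C1p : forall j, C1 (p j).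
Hypothesis wE : forall j x, tets j x -> w x = p j x.
Hypothesis cw : {within ph_body K, continuous w}.

Definition pw_grad (x : 'rV[R]_3) : 'rV[R]_3 := \row_i pw (fun j x => grad (p j) x 0 i) x.

Lemma w_pw x : ph_body K x -> pw p x = w x.
Proof. by apply: (pw_eq cov) => j; exact: wE. Qed.

Lemma w_L2 : L2 (ph_body K) w.
Proof.
have [mp ip2] := pw_L2 (fun j => C1_continuous (C1p j)); split.
  by apply: eq_measurable_fun mp => x; rewrite inE => /w_pw.
by apply: eq_integrable ip2 => // x; rewrite inE => /w_pw ->.
Qed.

Lemma w_face_L2 f : L2 (dom (pt f)) (w \o emb (pt f)).
Proof.
have E t : dom (pt f) t -> pw p (emb (pt f) t) = w (emb (pt f) t).
  by move=> ft; apply: w_pw; have [] := face_frontier Kp ft.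
have [mp ip2] := face_pw_L2 f (fun j => C1_continuous (C1p j)); split.
  by apply: eq_measurable_fun mp => x; rewrite inE => /E.
apply: eq_integrable ip2 => [|x]; first exact: compact_measurable_rV (@face_compact R K Kp f).
by rewrite inE /= => /E ->.
Qed.

Lemma pw_grad_L2 i : L2 (ph_body K) (fun x => pw_grad x 0 i).
Proof.
rewrite (_ : (fun x => _) = pw (fun j x => grad (p j) x 0 i)).
  by apply: pw_L2 => j; exact: (C1p j).2.
by apply/funext => x; rewrite mxE.
Qed.

(** Green's formula for the product of [w] and [psi], with the products [p j * psi] as its
    pieces. *)
Lemma integration_by_parts_pw psi i : C1 psi ->
  ip (ph_body K) w (fun x => grad psi x 0 i) + ip (ph_body K) (fun x => pw_grad x 0 i) psi =
  \sum_f @nu R K c f 0 i * ip (dom (pt f)) (w \o emb (pt f)) (psi \o emb (pt f)).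
Proof.
move=> cpsi.
have C1u j : C1 (fun x => p j x * psi x) by exact: C1M.
have uE j x : tets j x -> w x * psi x = p j x * psi x by move=> jx; rewrite (wE jx).
have cu : {within ph_body K, continuous (fun x => w x * psi x)}.
  move=> x; apply: (@continuousM R (subspace (ph_body K)) w psi); first exact: cw.
  by apply: continuous_subspaceT; exact: C1_continuous.
have := green_dir r0 star Kp nd cov C1u uE cu i.
rewrite /ip => <-.
have Lpsi : L2 (ph_body K) psi by apply: (continuous_L2 (body_compact Kp)); exact: C1_continuous.
have Lgpsi : L2 (ph_body K) (fun x => grad psi x 0 i).
  by apply: (continuous_L2 (body_compact Kp)); exact: cpsi.2.
rewrite -RintegralD//; last 2 first.
- exact: (L2_integrableM mK w_L2 Lgpsi).
- exact: (L2_integrableM mK (pw_grad_L2 i) Lpsi).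
apply: eq_Rintegral => x; rewrite inE => Kx.
have : ph_body K x by []. rewrite {1}cov => -[j _ jx].
have [j0 fj] := @first_in_ex R _ tets x j jx.
have -> : pw_grad x 0 i = grad (p j0) x 0 i by rewrite [LHS]mxE (pw_first _ fj).
by rewrite (pw_first _ fj) (wE fj.1) gradM// [X in _ + X]mulrC.
Qed.

(** A test function vanishes on the faces, its support being interior to [K], so the boundary terms
    drop out. *)
Lemma pw_is_wgrad : is_wgrad (ph_body K) w pw_grad.
Proof.
move=> i; split; first exact: pw_grad_L2.
move=> phi [cphi _ sphi]; apply/eqP; rewrite -addr_eq0 integration_by_parts_pw//.
rewrite big1// => f _; rewrite [X in _ * X](_ : _ = 0) ?mulr0//.
have -> : 0 = ip (dom (pt f)) (fun=> 0) (w \o emb (pt f)) by rewrite ip0l.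
rewrite ipC; apply: ip_eql => t ft /=; apply/eqP; apply: contrapT => /negP nz.
have [_] := face_frontier Kp ft; apply; apply: sphi.
exact: subset_closure.
Qed.

End piecewise.

Section trace.
Variables (v g : 'rV[R]_3 -> R).
Hypothesis Lv : L2 (ph_body K) v.
Hypothesis wv : exists G, is_wgrad (ph_body K) v G.
Hypothesis tr : is_trace (ph_body K) pt v g.

Lemma wgradP : is_wgrad (ph_body K) v (wgrad (ph_body K) v).
Proof. exact: (xgetPex (fun=> 0) wv). Qed.

Lemma ip_cvg n (S : set 'rV[R]_n) (fj : nat -> 'rV[R]_n -> R) (f h : 'rV[R]_n -> R) :
  measurable S -> (forall j, L2 S (fj j)) -> L2 S f -> L2 S h ->
  (fun j => ip S (fun x => fj j x - f x) (fun x => fj j x - f x)) @ \oo --> (0 : R) ->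
  (fun j => ip S (fj j) h) @ \oo --> ip S f h.
Proof.
move=> mS Lj Lf Lh H; apply/cvgrPdist_lt => e e0.
(* The summand 1 avoids division by zero when [h] has norm zero; Cauchy-Schwarz then keeps the
   squared difference below [e ^+ 2]. *)
have d0 : 0 < e ^+ 2 / (ip S h h + 1).
  by rewrite divr_gt0 ?exprn_gt0// ltr_wpDl// ip_ge0.
have /cvgrPdist_lt/(_ _ d0) := H; apply: filterS => j.
have Ld : L2 S (fun x => fj j x - f x) by exact: L2B.
rewrite sub0r normrN ger0_norm ?ip_ge0// ltr_pdivlMr; last by rewrite ltr_wpDl// ip_ge0.
move=> Hj; rewrite distrC -ipBl//.
rewrite -(@ltr_pXn2r _ 2)// ?nnegrE//; last exact: ltW.
rewrite real_normK ?num_real//.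
apply: le_lt_trans (cauchy_schwarz mS Ld Lh) _; apply: le_lt_trans Hj.
by rewrite ler_wpM2l ?ip_ge0// lerDl.
Qed.

(** The definition of a trace controls sums over components and over faces, while the limits are
    needed for each term. *)
Lemma squeeze0 (I : finType) (a : I -> nat -> R) i : (forall i j, 0 <= a i j) ->
  (fun j => \sum_i a i j) @ \oo --> (0 : R) -> a i @ \oo --> (0 : R).
Proof.
move=> a0 H; apply: (@squeeze_cvgr _ _ _ _ (fun=> 0) (fun j => \sum_i a i j)) => //.
  by apply: nearW => j; rewrite a0 (bigD1 i)//= lerDl sumr_ge0.
exact: cvg_cst.
Qed.

Lemma integration_by_parts_trace psi i : C1 psi ->
  ip (ph_body K) v (fun x => grad psi x 0 i) +
    ip (ph_body K) (fun x => wgrad (ph_body K) v x 0 i) psi =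
  \sum_f @nu R K c f 0 i * ip (dom (pt f)) (g \o emb (pt f)) (psi \o emb (pt f)).
Proof.
move=> cpsi; have [Lg [phi [cphi H1 H2 H3]]] := tr.
have LK (h : 'rV[R]_3 -> R) : continuous h -> L2 (ph_body K) h.
  by move=> ch; exact: (continuous_L2 (body_compact Kp) ch).
have Lpsi : L2 (ph_body K) psi by apply: LK; exact: C1_continuous.
have Lgpsi : L2 (ph_body K) (fun x => grad psi x 0 i) by apply: LK; exact: cpsi.2.
have Lphi j : L2 (ph_body K) (phi j) by apply: LK; exact: C1_continuous.
have Lgphi j i' : L2 (ph_body K) (fun x => grad (phi j) x 0 i') by apply: LK; exact: (cphi j).2.
have Lf f (h : 'rV[R]_3 -> R) : continuous h -> L2 (dom (pt f)) (h \o emb (pt f)).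
  move=> ch; apply: (continuous_L2 (@face_compact R K Kp f)) => t.
  by apply: continuous_comp; [exact: emb_continuous|exact: ch].
have Lw i' := (wgradP i').1.
have c1 : (fun j => ip (ph_body K) (phi j) (fun x => grad psi x 0 i)) @ \oo -->
    ip (ph_body K) v (fun x => grad psi x 0 i) by exact: ip_cvg.
have c2 : (fun j => ip (ph_body K) (fun x => grad (phi j) x 0 i) psi) @ \oo -->
    ip (ph_body K) (fun x => wgrad (ph_body K) v x 0 i) psi.
  apply: ip_cvg => //.
  pose a (i' : 'I_3) j := ip (ph_body K) (fun x => grad (phi j) x 0 i' - wgrad (ph_body K) v x 0 i')
     (fun x => grad (phi j) x 0 i' - wgrad (ph_body K) v x 0 i').
  apply: (squeeze0 (a := a)) => [i' j|]; first exact: ip_ge0.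
  apply: cvg_trans H2; apply: near_eq_cvg; apply: nearW => j; apply: eq_bigr => i' _.
  by rewrite /a; congr ip; apply/funext => x; rewrite !mxE.
have c3 f : (fun j => ip (dom (pt f)) (phi j \o emb (pt f)) (psi \o emb (pt f))) @ \oo -->
    ip (dom (pt f)) (g \o emb (pt f)) (psi \o emb (pt f)).
  apply: ip_cvg.
  - exact: compact_measurable_rV (@face_compact R K Kp f).
  - by move=> j; apply: Lf; exact: C1_continuous.
  - exact: Lg.
  - by apply: Lf; exact: C1_continuous.
  pose a f j := ip (dom (pt f)) (fun x => (phi j \o emb (pt f)) x - (g \o emb (pt f)) x)
     (fun x => (phi j \o emb (pt f)) x - (g \o emb (pt f)) x).
  apply: (squeeze0 (a := a)) => [f' j|]; first exact: ip_ge0.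
  apply: cvg_trans H3; apply: near_eq_cvg; apply: nearW => j; apply: eq_bigr => f' _.
  by apply: eq_Rintegral => t _; rewrite /= expr2.
have E j : ip (ph_body K) (phi j) (fun x => grad psi x 0 i) +
    ip (ph_body K) (fun x => grad (phi j) x 0 i) psi =
    \sum_f @nu R K c f 0 i * ip (dom (pt f)) (phi j \o emb (pt f)) (psi \o emb (pt f)).
  have cphiK : {within ph_body K, continuous (phi j)}.
    by apply: continuous_subspaceT; exact: C1_continuous.
  (* A C^1 function is piecewise C^1, with the same function on every tetrahedron. *)
  have := @integration_by_parts_pw (phi j) (fun=> phi j) (fun=> cphi j) (fun _ _ _ => erefl) cphiK psi i cpsi.
  move=> <-; congr (_ + _); apply: ip_eql => x Kx.
  rewrite (_ : pw_grad _ x 0 i = pw (fun=> fun x => grad (phi j) x 0 i) x); last by rewrite [LHS]mxE.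
  by rewrite (pw_eq cov (u := fun x => grad (phi j) x 0 i)).
rewrite -(cvg_lim (@norm_hausdorff _ _) (cvgD c1 c2)); apply/cvg_lim => //.
rewrite (_ : _ + _ = fun j =>
  \sum_f @nu R K c f 0 i * ip (dom (pt f)) (phi j \o emb (pt f)) (psi \o emb (pt f))); last first.
  by apply/funext => j; rewrite -E.
apply: (cvg_big (U := R) (op := +%R)) => [|f _]; first exact: add_continuous.
by apply: cvgM; [exact: cvg_cst|exact: c3].
Qed.

End trace.
End integration_by_parts.

(** * Moments of degree [k] on the body and on its faces *)

Section moments.
Context {R : realType}.

Lemma L2_subset n (A S : set 'rV[R]_n) (h : 'rV[R]_n -> R) :
  measurable A -> measurable S -> A `<=` S -> L2 S h -> L2 A h.
Proof.
move=> mA mS AS [mh ih]; split; first exact: measurable_funS mh.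
exact: integrableS ih.
Qed.

Variables (K : polyhedron R) (T : tet_mesh R) (k : nat).
Hypothesis Kp : is_polyhedron K.
Local Notation tet := (@tm_tet R T).
Local Notation tets := (fun j => tet_set (tet j)).
Local Notation pt := (@bd_patch R K).
Hypothesis nd : forall j, Defs.nondegenerate (tet j).
Hypothesis cov : ph_body K = \bigcup_j tets j.
Hypothesis conf : forall i j, i != j -> tets i <> tets j /\
  tets i `&` tets j = hull (tet i) (common_vertices (tet i) (tet j)).

Lemma tets_diam j : diam (tets j) != 0.
Proof.
have cj : compact (tets j) by exact: (tets_compact Kp nd cov (j := j)).
have [M HM] := compact_coord_bound cj.
have [l l0] := other2 0.
have V l' : tets j (row l' (tet j)).
  by rewrite tet_setE//= => l2; rewrite bary_vertex// ler0n.
apply: (@diam_neq0 _ _ _ (row l (tet j)) (row 0 (tet j)) M) => //.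
apply/eqP => ll; have := bary_vertex l l (nd j).
by rewrite {1}ll bary_vertex// eqxx eq_sym (negPf l0) => /eqP; rewrite eq_sym oner_eq0.
Qed.

(** The scaled monomials span P_k on each tetrahedron, so [w] minus the projection of [v] is
    orthogonal to P_k there and, by summation, on [K], where the projection may be replaced by
    [v]. *)
Lemma moments_body w v : L2 (ph_body K) w -> L2 (ph_body K) v ->
  (forall j q, SMono k (tets j) q -> ip (tets j) (w \- Qproj k (ph_body K) v) q = 0) ->
  forall q, Pol k q -> ip (ph_body K) w q = ip (ph_body K) v q.
Proof.
move=> Lw Lv H q Pq.
have cK := body_compact Kp; have mK := body_measurable Kp.
have [PQ QE] := QprojP cK k Lv.
rewrite -QE//; apply/eqP; rewrite -subr_eq0.
have LQ := Pol_L2 cK PQ; have Lq := Pol_L2 cK Pq.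
have Ld := L2B mK Lw LQ.
rewrite -ipBl//; apply/eqP; apply: (body_from_tets nd cov conf).
  exact: (L2_integrableM mK Ld Lq).
move=> j; have cj : compact (tets j) by exact: (tets_compact Kp nd cov (j := j)).
apply: (SMono_orth cj (D := tets j) (k := k)) => //.
- apply: L2_subset Ld => //; first exact: measurable_tets.
  exact: tets_body.
- exact: tets_diam.
- exact: H.
- exact: Pol_polyf.
Qed.

Variable f : 'I_(ph_size K).
Hypothesis fcov : forall x, fc_set (ph_face f) x -> exists j i,
  facet (tet j) i x /\ facet (tet j) i `<=` fc_set (ph_face f).

(** A polynomial in space restricted to the plane of the face keeps its degree bound, so the facet
    moments test it. *)
Lemma moments_face (w g : 'rV[R]_3 -> R) :
  L2 (dom (pt f)) (w \o emb (pt f)) -> L2 (dom (pt f)) (g \o emb (pt f)) ->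
  (forall j i, facet (tet j) i `<=` fc_set (ph_face f) ->
    let S := emb (pt f) @^-1` facet (tet j) i in
    forall q, SMono k S q -> ip S ((w \o emb (pt f)) \- QF k (ph_face f) g) q = 0) ->
  forall psi, polyf k psi ->
    ip (dom (pt f)) (w \o emb (pt f)) (psi \o emb (pt f)) =
    ip (dom (pt f)) (g \o emb (pt f)) (psi \o emb (pt f)).
Proof.
move=> Lw Lg H psi pol.
have cD := @face_compact R K Kp f; have mD := compact_measurable_rV cD.
have polE : polyf k (psi \o emb (pt f)).
  rewrite (_ : _ \o _ = fun t => psi (t *m frame (pt f) + org (pt f))); first exact: polyf_comp.
  by apply/funext => t; rewrite /= /emb addrC.
have [PQ QE] := QprojP cD k Lg.
rewrite -(QE _ (polyf_Pol polE)); apply/eqP; rewrite -subr_eq0.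
have LQ := Pol_L2 cD PQ; have Lq := polyf_L2 cD polE.
have Ld := L2B mD Lw LQ.
rewrite -ipBl//; apply/eqP; apply: (face_from_facets Kp nd conf fcov).
  exact: (L2_integrableM mD Ld Lq).
move=> p sub; have cp := facet_dom_compact Kp nd sub.
apply: (SMono_orth cp (D := facet_dom f p) (k := k)) => //.
- by apply: L2_subset Ld => //; [exact: compact_measurable_rV|exact: facet_dom_sub].
- exact: facet_dom_diam.
- exact: H.
Qed.

End moments.

Theorem lemma3p4 (R : realType) (K : polyhedron R) (T : tet_mesh R)
    (rho gamma : R) (k : nat) (v g b w : 'rV[R]_3 -> R) :
  0 < rho -> 0 < gamma ->
  is_polyhedron K -> mesh_assumptions rho K -> is_subdivision gamma K T ->
  (1 <= k)%N ->
  Vc3 k K v g b -> interpolant k K T v g b w ->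
  forall q : 'rV[R]_3 -> R, Pol k q ->
    ipv (ph_body K) (wgrad (ph_body K) w) (grad q) =
      ipv (ph_body K) (wgrad (ph_body K) v) (grad q) /\
    ip (ph_body K) w q = ip (ph_body K) v q.
Proof.
move=> _ _ Kp [[r [r0 _] [c star]] _ _] [cov [nd conf] _ _ [fcov _]] _.
move=> [[Lv wv] _ tr _ _] [[cw Vw] _ _ Hfacet Htet] q Pq.
have [Lg _] := tr.
have [p pP] : {p : 'I_(tm_size T) -> 'rV[R]_3 -> R & forall j,
    C1 (p j) /\ forall x, tet_set (tm_tet j) x -> w x = p j x}.
  apply: (@choice _ _ (fun j p => C1 p /\ forall x, tet_set (tm_tet j) x -> w x = p x)) => j.
  by have [p [d pd] wE] := Vtet_poly (Vw j); exists p; split => //; exact: polyf_C1 pd.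
have C1p j : C1 (p j) by exact: (pP j).1.
have wE j x : tet_set (tm_tet j) x -> w x = p j x by exact: (pP j).2.
have Lw : L2 (ph_body K) w := w_L2 Kp nd cov C1p wE.
have body := moments_body Kp nd cov conf Lw Lv Htet.
split; last exact: body.
have Wp := pw_is_wgrad r0 star Kp nd cov C1p wE cw.
have Ww : is_wgrad (ph_body K) w (wgrad (ph_body K) w).
  exact: (@wgradP R K w (ex_intro _ _ Wp)).
apply: eq_bigr => i _.
have polq := polyf_grad i (Pol_polyf Pq).
have C1q := polyf_C1 polq.
rewrite (wgrad_unique Kp nd cov conf i Ww Wp C1q).
(* The same volume term is added to both sides, so that the left one is an integration by parts for
   [w]; on the right, [body] turns [w] into [v] in this term, and the trace formula applies. *)
apply: (addrI (ip (ph_body K) w (fun x => grad (fun y => grad q y 0 i) x 0 i))).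
rewrite (integration_by_parts_pw r0 star Kp nd cov C1p wE cw i C1q).
rewrite body; last by apply: polyf_Pol; exact: polyf_grad.
rewrite (integration_by_parts_trace r0 star Kp nd cov Lv wv tr i C1q).
apply: eq_bigr => f _; congr (_ * _).
apply: (moments_face Kp nd conf (fcov f)) polq => //.
- exact: (w_face_L2 Kp nd cov C1p wE f).
- by move=> j i'; exact: (Hfacet j i').1.
Qed.
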